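(* Let $C,D$ be real constants with $D\ge-\frac14$, let $\theta$ be a solution of $\theta''(x)=\big(2C+\frac{D}{x^2}\big)\theta(x)$ on $x>0$, and let $X$ be the diffusion $dX_t=\frac{\theta'(X_t)}{\theta(X_t)}dt+dW_t$, $X_0=x_0$. Let $g(t)\equiv b(t)$ be a boundary, let $T^g=\inf\{t\ge0:X_t\le g(t)\}$, and let $T^b=\inf\{t\ge0:Z^\delta_t\le b(t)\}$, where $Z^\delta$ is the Bessel process of dimension $\delta=2+\sqrt{4D+1}$ started from $Z^\delta_0=x_0$. Then the densities of $T^g$ and $T^b$ satisfy $$\rho^{T^g}_{x_0}(t)=\frac{x_0^{\frac{\delta-1}{2}}}{b(t)^{\frac{\delta-1}{2}}}\,\frac{\theta(b(t))}{\theta(x_0)}\,e^{-Ct}\,\rho^{T^b}_{x_0}(t),$$ and the Laplace transform of $T^g$ is $$\mathbb E_{x_0}\big[e^{-\lambda T^g}\big]=\frac{x_0^{\frac{\delta-1}{2}}}{\theta(x_0)}\,\mathbb E_{x_0}\!\left[\frac{\theta(Z^\delta_{T^b})}{(Z^\delta_{T^b})^{\frac{\delta-1}{2}}}\,e^{-(\lambda+C)T^b}\right].$$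
   Context: $W$ is a standard Brownian motion. The $\delta$-dimensional Bessel process solves $dZ^\delta_t=\frac{\delta-1}{2Z^\delta_t}dt+dW_t$. The SDE for $X$ is assumed to have a unique non-explosive solution; $X$ lives on an interval of $(0,\infty)$ on which $\theta>0$. Boundaries are positive and sufficiently smooth/regular, lying in that interval, and the processes start strictly above them. $\rho^{T}_{x_0}(t)$ denotes the (possibly defective) density of the first passage time $T$ for the process started at $x_0$; $\mathbb E_{x_0}$ is expectation for the process started at $x_0$, taken over the event that the stopping time in question is finite.
   Formalization: The interval on which θ>0 and X lives is taken to be (l,∞) with l≥0; for an interval bounded above the claim fails, e.g. D=0, C=-1/2, θ=sin on (0,π), b constant, where the right side of the density formula has infinite mass. *)

(* Defs.v *)
From HB Require Import structures.
From mathcomp Require Import all_boot all_order all_algebra.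
From mathcomp Require Import all_classical all_reals all_analysis.
From mathcomp Require Import measurable_realfun.

Set Implicit Arguments.
Unset Strict Implicit.
Unset Printing Implicit Defensive.

Import Order.TTheory GRing.Theory Num.Theory.
Import numFieldNormedType.Exports.

Local Open Scope classical_set_scope.
Local Open Scope ring_scope.

(* Processes are functions [R -> Omega -> R]; only times [t >= 0] are meaningful. *)

Definition filtration (R : realType) (d : measure_display)
    (Omega : measurableType d) (F : R -> set (set Omega)) : Prop :=
  [/\ forall t : R, 0 <= t -> sigma_algebra setT (F t),
      forall t : R, 0 <= t -> F t `<=` measurable &
      forall s t : R, 0 <= s -> s <= t -> F s `<=` F t].

Definition adapted (R : realType) (d : measure_display)
    (Omega : measurableType d) (F : R -> set (set Omega))
    (X : R -> Omega -> R) : Prop :=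
  forall t : R, 0 <= t -> forall B : set R, measurable B -> F t (X t @^-1` B).

Definition continuous_process (R : realType) (Omega : Type)
    (X : R -> Omega -> R) : Prop :=
  forall w, {within `[0, +oo[, continuous (fun t => X t w)}.

Definition brownian_motion (R : realType) (d : measure_display)
    (Omega : measurableType d) (P : probability Omega R)
    (F : R -> set (set Omega)) (W : R -> Omega -> R) : Prop :=
  [/\ adapted F W,
      continuous_process W,
      {ae P, forall w, W 0 w = 0},
      forall s t : R, 0 <= s -> s < t -> forall B : set R, measurable B ->
        P [set w | B (W t w - W s w)] = normal_prob 0 (Num.sqrt (t - s)) B &
      forall s t : R, 0 <= s -> s < t ->
        forall (A : set Omega) (B : set R), F s A -> measurable B ->
        P (A `&` [set w | B (W t w - W s w)]) =
          (P A * P [set w | B (W t w - W s w)%R])%E].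

(* The equation dX_t = drift(X_t) dt + dW_t, X_0 = x0, with state space I.  The
   noise is additive, so the integrated equation involves no stochastic integral.
   Non-explosion is the requirement that X stays in I for all time. *)
Definition sde_solution (R : realType) (d : measure_display)
    (Omega : measurableType d) (P : probability Omega R)
    (F : R -> set (set Omega)) (W : R -> Omega -> R)
    (I : set R) (drift : R -> R) (x0 : R) (X : R -> Omega -> R) : Prop :=
  [/\ adapted F X,
      continuous_process X,
      forall (w : Omega) (t : R), 0 <= t -> I (X t w) &
      {ae P, forall w, forall t : R, 0 <= t ->
        lebesgue_measure.-integrable `[0, t] (fun s => (drift (X s w))%:E) /\
        X t w = x0 + \int[lebesgue_measure]_(s in `[0, t]) drift (X s w)
                + W t w}].

Definition unique_sde_solution (R : realType) (d : measure_display)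
    (Omega : measurableType d) (P : probability Omega R)
    (F : R -> set (set Omega)) (W : R -> Omega -> R)
    (I : set R) (drift : R -> R) (x0 : R) (X : R -> Omega -> R) : Prop :=
  sde_solution P F W I drift x0 X /\
  forall Y, sde_solution P F W I drift x0 Y ->
    {ae P, forall w, forall t : R, 0 <= t -> Y t w = X t w}.

(* The value is +oo when the boundary is never reached. *)
Definition first_passage (R : realType) (Omega : Type)
    (X : R -> Omega -> R) (b : R -> R) (w : Omega) : \bar R :=
  ereal_inf [set t%:E | t in [set t : R | 0 <= t /\ X t w <= b t]].

(* The density may be defective: its total mass is P(T < +oo). *)
Definition is_density (R : realType) (d : measure_display)
    (Omega : measurableType d) (P : probability Omega R)
    (T : Omega -> \bar R) (rho : R -> R) : Prop :=
  [/\ measurable_fun setT T,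
      measurable_fun (`[0, +oo[%classic : set R) rho,
      forall t : R, 0 <= t -> 0 <= rho t &
      forall A : set R, measurable A -> A `<=` `[0, +oo[ ->
        P [set w | exists2 t, A t & T w = t%:E] =
          (\int[lebesgue_measure]_(t in A) (rho t)%:E)%E].

(* Main.v *)
Require Import Defs.
From HB Require Import structures.
From mathcomp Require Import all_boot all_order all_algebra.
From mathcomp Require Import all_classical all_reals all_analysis.
From mathcomp Require Import measurable_realfun.
From mathcomp Require Import ring lra.
Import Order.TTheory GRing.Theory Num.Theory.
Import numFieldNormedType.Exports.
Local Open Scope classical_set_scope.
Local Open Scope ring_scope.

(* Put [a = (delta - 1) / 2] and [H = ln theta - a ln]. The ODE for [theta] says that
   [exp (H (Z_t) - C t)] is the local martingale whose Girsanov transform turns the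
   Bessel process [Z] into the diffusion [X]; since the noise is additive, this can
   be proved without stochastic integrals, at the level of Gaussian kernels. With a
   step [h], the Euler kernel of [Z] weighted by [exp (H y - H x - C h)] agrees up to
   [O(h ^ (3 / 2))] with the kernel of a modified Euler step for [X], so that over
   [tau / h] steps the weighted probabilities that [Z] is detected below [b + eps]
   and the corresponding probabilities for [X] differ by [O(sqrt h)]. Both schemes
   converge pathwise up to the passage time; letting first [h], then [eps] go to [0],
   and using [Z_Tb = b (Tb)], one gets
   [P1 (Tg <= tau) = E2 [exp (H (b Tb) - H x0 - C Tb); Tb <= tau]].
   Hence the law of [Tg] has the density [exp (H (b t) - H x0 - C t)] with respect to
   that of [Tb], and both claims follow. *)

(** * One Gaussian step *)

(** The two processes live on different probability spaces, so only laws can be compared, and the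
    comparison is made for discrete chains. The modified step for [X] is forced: the weight of one
    step contains the quadratic term [H''(x) y^2 / 2], of order [h]. A Gaussian kernel of unchanged
    variance would miss it in total variation, and over [tau / h] steps such errors add up to order
    1. Tilting a Gaussian by a quadratic exponent changes its variance as well as its mean, hence
    the noise factor. The terms of order [h] cancel because [H'' + H'^2 + 2 nu H' = 2 C] with
    [nu x = a / x]; given the equation of [theta], this is the relation [a^2 = a + D], which the
    prescribed dimension satisfies. The coefficients are singular at [0] and may be so at [l], while
    Lipschitz bounds are needed throughout. They are therefore replaced by constants below a level
    [m] lying under the boundary. Paths are followed only up to the passage, where the cut-off is
    invisible; this is why every pathwise estimate carries a time horizon. *)

Section gaussian_kernels.
Local Set Implicit Arguments.
Local Unset Strict Implicit.
Variable R : realType.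
Implicit Types C K a b h l m n s u v x y : R.

Lemma expR_dist_le a b c : a <= c -> b <= c ->
  `|expR a - expR b| <= `|a - b| * expR c.
Proof.
move=> ac bc.
have le x y : x <= y -> y <= c -> expR y - expR x <= (y - x) * expR c.
  move=> xy yc.
  have e : expR y - expR x = expR y * (1 - expR (x - y)).
    by rewrite mulrBr mulr1 -expRD subrKC.
  have e1 : 1 - expR (x - y) <= y - x by have := expR_ge1Dx (x - y); lra.
  rewrite e (le_trans (ler_wpM2l (expR_ge0 _) e1))// mulrC.
  by rewrite ler_wpM2l ?subr_ge0// ler_expR.
wlog ab : a b ac bc / a <= b => [hw|].
  have [|/ltW] := leP a b; first exact: hw.
  by rewrite distrC (distrC a); exact: hw.
rewrite distrC (distrC a) !ger0_norm ?subr_ge0 ?ler_expR//; exact: le.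
Qed.

(** Both sides come from [ln (1 + y) <= y], applied once to [1 - v] and once to its inverse
    [1 + v / (1 - v)]. *)
Lemma ln_sub1_bound v : `|v| <= 1 / 16 -> `|ln (1 - v) + v| <= 2 * v ^+ 2.
Proof.
rewrite ler_norml => /andP[v1 v2].
have v0 : 0 < 1 - v by lra.
have l1 : ln (1 - v) <= - v by apply: le_ln1Dx; lra.
have l2 : - ln (1 - v) <= v / (1 - v).
  have e : (1 - v)^-1 = 1 + v / (1 - v) by field; lra.
  rewrite -lnV ?posrE// {1}e; apply: le_ln1Dx; rewrite ltr_pdivlMr//; lra.
have l3 : v / (1 - v) - v <= 2 * v ^+ 2.
  have -> : v / (1 - v) - v = v ^+ 2 / (1 - v) by field; lra.
  rewrite ler_pdivrMr//; have := sqr_ge0 v; nra.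
rewrite ler_norml; apply/andP; split; have := sqr_ge0 v; lra.
Qed.

(** The relative error of one Gaussian step grows like a cubic in the number of standard deviations;
    this bound absorbs it into a wider Gaussian. The square of [1 + u ^ 2 / 8] already dominates the
    cubic, up to the factor 64. *)
Lemma cubic_le_expR u : 0 <= u -> 1 + u + u ^+ 3 <= 64 * expR (u ^+ 2 / 4).
Proof.
move=> u0.
have e1 := expR_ge1Dx (u ^+ 2 / 8).
have u2 := sqr_ge0 u.
have e2 : (1 + u ^+ 2 / 8) ^+ 2 <= expR (u ^+ 2 / 4).
  have -> : u ^+ 2 / 4 = 2%:R * (u ^+ 2 / 8) by field.
  rewrite expRM_natl ler_sqr// nnegrE; lra.
have u1 : 0 <= (u - 1) ^+ 2 by exact: sqr_ge0.
have u4 : 0 <= (u ^+ 2 - u) ^+ 2 by exact: sqr_ge0.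
have u5 : 0 <= u ^+ 2 * u ^+ 2 by rewrite mulr_ge0.
apply: (le_trans _ (ler_wpM2l _ e2)) => //.
nra.
Qed.

(* The normal density with mean [l h / (1 - v)] and variance [h / (1 - v)],
   where [h = s ^ 2] and [v = e h], is the exponential tilt of the centred one with variance
   [h] by [l x + e x ^ 2 / 2]. *)
Lemma normal_pdf_tilt s l e x : 0 < s -> e * s ^+ 2 < 1 ->
  normal_pdf (l * s ^+ 2 / (1 - e * s ^+ 2)) (s / Num.sqrt (1 - e * s ^+ 2)) x =
  normal_pdf 0 s x * expR (l * x + e * x ^+ 2 / 2
    + ln (1 - e * s ^+ 2) / 2 - l ^+ 2 * s ^+ 2 / (2 * (1 - e * s ^+ 2))).
Proof.
move=> s0 es.
have v0 : 0 < 1 - e * s ^+ 2 by lra.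
set v := 1 - e * s ^+ 2 in v0 *.
have r0 : 0 < Num.sqrt v by rewrite sqrtr_gt0.
have r2 : Num.sqrt v ^+ 2 = v by rewrite sqr_sqrtr// ltW.
have sr0 : s / Num.sqrt v != 0 by rewrite mulf_neq0 ?invr_eq0 ?gt_eqF.
rewrite !normal_pdfE ?gt_eqF//; last by rewrite divr_gt0.
have pk : normal_peak (s / Num.sqrt v) = normal_peak s * expR (ln v / 2).
  have -> : expR (ln v / 2) = Num.sqrt v.
    apply/eqP; rewrite -(eqrXn2 (_ : 0 < 2)%N) ?expR_ge0 ?sqrtr_ge0//.
    rewrite r2 -expRM_natl; apply/eqP.
    have -> : 2%:R * (ln v / 2) = ln v by field.
    by rewrite lnK.
  rewrite /normal_peak expr_div_n r2.
  have -> : (s ^+ 2 / v * pi *+ 2) = (s ^+ 2 * pi *+ 2) / v.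
    by rewrite -(mulr_natr _ 2) -[in RHS](mulr_natr _ 2); ring.
  rewrite sqrtrM; last by rewrite mulrn_wge0// mulr_ge0 ?sqr_ge0 ?pi_ge0.
  by rewrite sqrtrV ?(ltW v0)// invfM invrK.
rewrite pk /normal_fun -[LHS]mulrA -[RHS]mulrA -!expRD; congr (_ * expR _).
rewrite expr_div_n r2.
have ev : e = (1 - v) / s ^+ 2 by rewrite /v; field; rewrite gt_eqF.
rewrite ev -(mulr_natr (s ^+ 2 / v) 2) -(mulr_natr (s ^+ 2) 2); field.
by rewrite !gt_eqF.
Qed.

(** The first two terms are the logarithm of the normalising constant in [normal_pdf_tilt]. Its
    first-order part [- (e + l ^ 2) h / 2] is what the factor [exp (- C h)] of the weight has to
    compensate, so only the second-order remainder may survive. *)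
Lemma log_tilt_bound K l e h : 1 <= K -> 0 <= h -> K * h <= 1 / 16 ->
  `|l| <= K -> `|e| <= K ->
  `|ln (1 - e * h) / 2 - l ^+ 2 * h / (2 * (1 - e * h))
    + (e + l ^+ 2) * h / 2| <= 2 * K ^+ 3 * h ^+ 2.
Proof.
move=> K1 h0 Kh lK eK.
have eh : `|e * h| <= K * h by rewrite normrM (ger0_norm h0) ler_wpM2r.
have eh' : `|e * h| <= 1 / 16 := le_trans eh Kh.
have := ln_sub1_bound eh'.
have [v ve] : exists v, e * h = v by exists (e * h).
rewrite ve in eh eh' *; move: eh'; rewrite ler_norml => /andP[v1 v2] lnv.
have v0 : 0 < 1 - v by lra.
have -> : ln (1 - v) / 2 - l ^+ 2 * h / (2 * (1 - v)) + (e + l ^+ 2) * h / 2 =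
  (ln (1 - v) + v) / 2 - l ^+ 2 * h * v / (2 * (1 - v)).
  by rewrite (mulrDl e) ve; field; rewrite gt_eqF.
have vK : v ^+ 2 <= K ^+ 3 * h ^+ 2.
  have : v ^+ 2 <= (K * h) ^+ 2.
    by rewrite -(real_normK (num_real v)) ler_sqr ?nnegrE ?mulr_ge0//; lra.
  rewrite (exprMn _ K h) => /le_trans; apply; rewrite ler_wpM2r ?sqr_ge0//.
  by rewrite ler_weXn2l//; lra.
have l2 : l ^+ 2 <= K ^+ 2.
  by rewrite -(real_normK (num_real l)) ler_sqr ?nnegrE//; lra.
have h2 : `|l ^+ 2 * h * v / (2 * (1 - v))| <= K ^+ 3 * h ^+ 2.
  have -> : l ^+ 2 * h * v / (2 * (1 - v)) = l ^+ 2 * h / (2 * (1 - v)) * v.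
    by rewrite mulrAC.
  have c0 : 0 <= l ^+ 2 * h / (2 * (1 - v)).
    by apply: divr_ge0; rewrite ?(mulr_ge0 (sqr_ge0 l))// mulr_ge0// ltW.
  rewrite normrM (ger0_norm c0).
  have -> : K ^+ 3 * h ^+ 2 = K ^+ 2 * h * (K * h) by ring.
  rewrite ler_pM// ler_pdivrMr; last by lra.
  have : l ^+ 2 * h <= K ^+ 2 * h by rewrite ler_wpM2r.
  have : 0 <= K ^+ 2 * h by rewrite (mulr_ge0 (sqr_ge0 K)).
  nra.
apply: (le_trans (ler_normB _ _)).
rewrite normrM (ger0_norm (_ : 0 <= 2^-1)); last by lra.
nra.
Qed.

(* [u] stands for the increment [H (x + _) - H x] of a function with
   [H'(x) = l] and [H''(x) = e]; the relation between [e], [l], [n], [C] makes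
   the two exponents agree up to an error of order [h ^ (3 / 2)], [h = s ^ 2]. *)
Lemma kernel_dist K C n l e s (u : R -> R) x :
  1 <= K -> 0 < s -> K * s ^+ 2 <= 1 / 16 ->
  `|C| <= K -> `|n| <= K -> `|l| <= K -> `|e| <= K ->
  e + l ^+ 2 + 2 * l * n = 2 * C ->
  (forall y, `|u y| <= K * `|y|) ->
  (forall y, `|u y - l * y - e * y ^+ 2 / 2| <= K * `|y| ^+ 3) ->
  `|normal_pdf 0 s x * expR (- C * s ^+ 2 + u (n * s ^+ 2 + x)) -
    normal_pdf (l * s ^+ 2 / (1 - e * s ^+ 2))
               (s / Num.sqrt (1 - e * s ^+ 2)) x|
  <= 896 * K ^+ 4 * expR (4 * K ^+ 3) * s ^+ 3 * normal_pdf 0 (2 * s) x.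
Proof.
move=> K1 s0 Ks CK nK lK eK elnC uK uT.
set h := s ^+ 2 in Ks *.
have h0 : 0 < h by rewrite exprn_gt0.
have h1 : h <= 1.
  have : h <= K * h by rewrite ler_peMl// ltW.
  lra.
have s1 : s <= 1 by rewrite -(@ler_pXn2r _ 2)// ?nnegrE ?(ltW s0)// expr1n.
have eh : `|e * h| <= 1 / 16.
  by rewrite normrM (gtr0_norm h0) (le_trans _ Ks)// ler_wpM2r// ltW.
have eh1 : e * h < 1 by move: eh; rewrite ler_norml => /andP[]; lra.
rewrite normal_pdf_tilt// -/h -mulrBr normrM (ger0_norm (normal_pdf_ge0 _ _ _)).
set y := n * h + x.
set a := - C * h + u y; set b := (X in expR a - expR X).
pose N := - ln (1 - e * h) / 2 + l ^+ 2 * h / (2 * (1 - e * h)).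
have N1 : `|N - (e + l ^+ 2) * h / 2| <= 2 * K ^+ 3 * h ^+ 2.
  have := @log_tilt_bound K l e h K1 (ltW h0) Ks lK eK.
  rewrite -normrN; congr (`|_| <= _); rewrite /N; lra.
have be : b = l * x + e * x ^+ 2 / 2 - N by rewrite /b /N; lra.
(* [w] measures [|x|] in standard deviations, so that the powers of [s] can be read off separately
   from the Gaussian decay in [w]. *)
have [w xw w0] : exists2 w, `|x| = s * w & 0 <= w.
  exists (`|x| / s); last by rewrite divr_ge0// ltW.
  by rewrite mulrC divfK// gt_eqF.
have S3 : 0 <= s ^+ 3 by rewrite exprn_ge0// ltW.
have Sw : 0 <= s ^+ 3 * w := mulr_ge0 S3 w0.
have Sw3 : 0 <= s ^+ 3 * w ^+ 3 := mulr_ge0 S3 (exprn_ge0 3 w0).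
have K40 : 0 <= K ^+ 4 by rewrite exprn_ge0//; lra.
have K2 : K <= K ^+ 2 by rewrite expr2 ler_peMr//; lra.
have K3 : K ^+ 2 <= K ^+ 3 by rewrite ler_weXn2l.
have K4 : K ^+ 3 <= K ^+ 4 by rewrite ler_weXn2l.
have hs : h ^+ 2 <= s ^+ 3.
  have -> : h ^+ 2 = s * s ^+ 3 by rewrite /h; ring.
  by rewrite ler_piMl// exprn_ge0// ltW.
have yK : `|y| <= K * h + s * w.
  rewrite /y -xw (le_trans (ler_normD _ _))// lerD2r normrM (gtr0_norm h0).
  by rewrite ler_wpM2r// ltW.
have Kh0 : 0 <= K * h by rewrite mulr_ge0//; lra.
have sw0 : 0 <= s * w by rewrite mulr_ge0// ltW.
have d1 : `|a - b| <= 7 * K ^+ 4 * s ^+ 3 * (1 + w + w ^+ 3).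
  (* The terms of order [h] cancel by the relation between [e], [l], [n] and [C]. What remains is
     the Taylor remainder of [u], the second-order part of the normalising constant, and the cross
     terms due to the shift [n h] inside the quadratic term. *)
  have -> : a - b = (u y - l * y - e * y ^+ 2 / 2) +
      ((N - (e + l ^+ 2) * h / 2) + (e * n * h * x + e * n ^+ 2 * h ^+ 2 / 2)).
    have CE : C = (e + l ^+ 2 + 2 * l * n) / 2 by rewrite elnC; field.
    by rewrite /a be /y CE; field.
  have en : `|e * n| <= K ^+ 2 by rewrite normrM expr2 ler_pM.
  have t1 : `|e * n * h * x| <= K ^+ 2 * (s ^+ 3 * w).
    rewrite normrM xw normrM (gtr0_norm h0).
    have -> : K ^+ 2 * (s ^+ 3 * w) = K ^+ 2 * h * (s * w) by rewrite /h; ring.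
    by rewrite !ler_wpM2r// ltW.
  have t2 : `|e * n ^+ 2 * h ^+ 2 / 2| <= K ^+ 3 * h ^+ 2.
    have -> : e * n ^+ 2 * h ^+ 2 / 2 = (e * n) * n / 2 * h ^+ 2 by field.
    rewrite normrM (ger0_norm (sqr_ge0 h)) ler_wpM2r ?sqr_ge0//.
    rewrite normrM (ger0_norm (_ : 0 <= 2^-1))//.
    have : `|e * n * n| <= K ^+ 3 by rewrite normrM exprSr ler_pM.
    have := normr_ge0 (e * n * n); lra.
  have t3 : `|y| ^+ 3 <= 4 * (K ^+ 3 * h ^+ 3 + s ^+ 3 * w ^+ 3).
    have : `|y| ^+ 3 <= (K * h + s * w) ^+ 3.
      by rewrite lerXn2r ?nnegrE// addr_ge0.
    move=> /le_trans; apply; rewrite -!exprMn.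
    move: (K * h) (s * w) Kh0 sw0 => p q p0 q0.
    have : 0 <= (p + q) * (p - q) ^+ 2 by rewrite mulr_ge0 ?sqr_ge0 ?addr_ge0.
    nra.
  have hh : h ^+ 3 <= s ^+ 3.
    by rewrite lerXn2r ?nnegrE ?(ltW h0) ?(ltW s0)// /h expr2 ler_piMl// ltW.
  have t3' : K * `|y| ^+ 3 <= 4 * K ^+ 4 * s ^+ 3 + 4 * K ^+ 4 * (s ^+ 3 * w ^+ 3).
    have K0 : 0 <= K by lra.
    apply: (le_trans (ler_wpM2l K0 t3)).
    have q1 : K ^+ 4 * h ^+ 3 <= K ^+ 4 * s ^+ 3.
      by rewrite ler_wpM2l// exprn_ge0.
    have q2 : K * (s ^+ 3 * w ^+ 3) <= K ^+ 4 * (s ^+ 3 * w ^+ 3).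
      by rewrite ler_wpM2r//; lra.
    have -> : K * (4 * (K ^+ 3 * h ^+ 3 + s ^+ 3 * w ^+ 3)) =
      4 * (K ^+ 4 * h ^+ 3) + 4 * (K * (s ^+ 3 * w ^+ 3)) by ring.
    lra.
  have z1 : K ^+ 3 * h ^+ 2 <= K ^+ 4 * s ^+ 3.
    by rewrite ler_pM// ?exprn_ge0//; lra.
  have z2 : K ^+ 2 * (s ^+ 3 * w) <= K ^+ 4 * (s ^+ 3 * w).
    by rewrite ler_wpM2r//; lra.
  apply: (le_trans (ler_normD _ _)).
  apply: (le_trans (lerD (uT y) (ler_normD _ _))).
  have := ler_normD (e * n * h * x) (e * n ^+ 2 * h ^+ 2 / 2).
  have p0 := mulr_ge0 K40 S3.
  have p1 := mulr_ge0 K40 Sw.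
  have p3 := mulr_ge0 K40 Sw3.
  have -> : 7 * K ^+ 4 * s ^+ 3 * (1 + w + w ^+ 3) =
    7 * (K ^+ 4 * s ^+ 3) + 7 * (K ^+ 4 * (s ^+ 3 * w))
    + 7 * (K ^+ 4 * (s ^+ 3 * w ^+ 3)) by ring.
  lra.
(* Young's inequality: thanks to [K s ^ 2 <= 1 / 16], a linear exponent costs at most [w ^ 2 / 16]
   plus a constant. This leaves room for both exponents to stay below [w ^ 2 / 8]. *)
have Ksw : K * (s * w) <= K / 4 + w ^+ 2 / 16.
  have : 0 <= (2 * (K * s) - w / 4) ^+ 2 by exact: sqr_ge0.
  have : K * (K * s ^+ 2) <= K * (1 / 16) by rewrite ler_wpM2l//; lra.
  nra.
have am : a <= 4 * K ^+ 3 + w ^+ 2 / 8.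
  have q1 : - C * h <= K.
    apply: (le_trans (ler_norm _)); rewrite normrM normrN (gtr0_norm h0).
    by rewrite -[leRHS]mulr1 ler_pM// ltW.
  have q2 : u y <= K * (K * h + s * w).
    apply: (le_trans (ler_norm _)); apply: (le_trans (uK _)).
    by rewrite ler_wpM2l//; lra.
  have q3 : K * (K * h) <= K * (1 / 16) by rewrite ler_wpM2l//; lra.
  have := sqr_ge0 w; rewrite /a; lra.
have bm : b <= 4 * K ^+ 3 + w ^+ 2 / 8.
  have q1 : l * x <= K * (s * w).
    by rewrite (le_trans (ler_norm _))// normrM xw ler_wpM2r.
  have q2 : e * x ^+ 2 / 2 <= w ^+ 2 / 32.
    have xx : x ^+ 2 = h * w ^+ 2.
      by rewrite -(real_normK (num_real x)) xw exprMn.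
    rewrite xx mulrA -(mulrA (e * h)).
    have := le_trans (ler_norm _) eh; have := sqr_ge0 w; nra.
  have q3 : - N <= K ^+ 3 * 3.
    have := N1; rewrite ler_norml => /andP[+ _].
    have r1 : - ((e + l ^+ 2) * h) <= K + K ^+ 2.
      apply: (le_trans (ler_norm _)); rewrite normrN normrM (gtr0_norm h0).
      rewrite -[leRHS]mulr1 ler_pM// ?(ltW h0)//.
      apply: (le_trans (ler_normD _ _)); rewrite lerD// normrX.
      by rewrite lerXn2r ?nnegrE//; lra.
    have r2 : K ^+ 3 * h ^+ 2 <= K ^+ 3.
      rewrite ler_piMr ?exprn_ge0//; first lra.
      by rewrite exprn_ile1// ltW.
    lra.
  have := sqr_ge0 w; rewrite be; lra.
have d2 := expR_dist_le am bm.
have cw := cubic_le_expR w0.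
have pk : normal_peak (2 * s) = normal_peak s / 2 :> R.
  rewrite /normal_peak exprMn.
  have -> : 2 ^+ 2 * s ^+ 2 * pi *+ 2 = 2 ^+ 2 * (s ^+ 2 * pi *+ 2) :> R.
    by rewrite -(mulr_natr _ 2) -[in RHS](mulr_natr _ 2); ring.
  by rewrite sqrtrM// sqrtr_sqr ger0_norm// invfM mulrC.
rewrite !normal_pdfE ?gt_eqF ?mulr_gt0// pk /normal_fun !subr0.
have xs : x ^+ 2 = h * w ^+ 2.
  by rewrite -(real_normK (num_real x)) xw exprMn.
have -> : - x ^+ 2 / (s ^+ 2 *+ 2) = - (w ^+ 2 / 2).
  by rewrite xs /h -(mulr_natr _ 2); field; rewrite gt_eqF.
have -> : - x ^+ 2 / ((2 * s) ^+ 2 *+ 2) = - (w ^+ 2 / 8).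
  by rewrite xs /h -(mulr_natr _ 2); field; rewrite gt_eqF.
set p := normal_peak s; have p0 : 0 <= p by exact: normal_peak_ge0.
(* The budget of exponents: [1/2] from the kernel, minus [1/4] for the cubic factor and [1/8] for
   the exponential, leaves [1/8], the exponent of a Gaussian of standard deviation [2 s]. The
   constant is [7 * 64 * 2], the last factor being the ratio of the two peaks. *)
have -> : 896 * K ^+ 4 * expR (4 * K ^+ 3) * s ^+ 3 * (p / 2 * expR (- (w ^+ 2 / 8)))
  = p * expR (- (w ^+ 2 / 2)) * ((7 * K ^+ 4 * s ^+ 3 * (64 * expR (w ^+ 2 / 4)))
     * expR (4 * K ^+ 3 + w ^+ 2 / 8)).
  have -> : - (w ^+ 2 / 8) = - (w ^+ 2 / 2) + w ^+ 2 / 4 + w ^+ 2 / 8 by field.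
  by rewrite !expRD; field.
rewrite ler_wpM2l ?mulr_ge0 ?expR_ge0//.
apply: (le_trans d2); rewrite ler_wpM2r ?expR_ge0//.
apply: (le_trans d1); rewrite ler_wpM2l//.
by rewrite -mulrA mulr_ge0// (mulr_ge0 K40 S3).
Qed.

End gaussian_kernels.

(** * Integrals against a density; freezing *)

Section integral_density.
Local Set Implicit Arguments.
Local Unset Strict Implicit.
Local Open Scope ereal_scope.
Context d (T : measurableType d) (R : realType).
Variables (mu nu : {measure set T -> \bar R}) (D : set T) (f : T -> R).
Hypotheses (mD : measurable D) (mf : measurable_fun D f).
Hypothesis f0 : forall x, D x -> (0 <= f x)%R.
Hypothesis nuE : forall A, measurable A -> A `<=` D ->
  nu A = \int[mu]_(x in A) (f x)%:E.

Import HBNNSimple.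

Let ge0_integral_density_nnsfun (g : {nnsfun T >-> R}) :
  \int[nu]_(x in D) (g x)%:E = \int[mu]_(x in D) ((g x)%:E * (f x)%:E).
Proof.
under eq_integral do rewrite fimfunE -fsumEFin//.
rewrite ge0_integral_fsum//; last 2 first.
- by move=> y; exact/measurable_EFinP/measurable_funM.
- by move=> y x _; rewrite nnfun_muleindic_ge0.
transitivity (\sum_(k \in range g) \int[mu]_(x in D)
    (k%:E * ((\1_(g @^-1` [set k]) x)%:E * (f x)%:E))).
  apply: eq_fsbigr => r /[!inE] -[z _ gz].
  have r0 : (0 <= r)%R by rewrite -gz.
  rewrite integralZl_indic_nnsfun// integral_indic//=.
  rewrite ge0_integralZl//; last 2 first.
  - apply: emeasurable_funM; last exact/measurable_EFinP.
    by apply/measurable_EFinP/measurable_funTS/measurable_indic.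
  - by move=> x Dx; rewrite mule_ge0// lee_fin// f0.
  congr (_ * _); rewrite nuE; last 2 first.
  - by apply: measurableI => //; exact: measurable_sfunP.
  - by move=> x [].
  rewrite setIC integral_mkcondr epatch_indic.
  by apply: eq_integral => x _; rewrite muleC.
rewrite -ge0_integral_fsum//; last 2 first.
- move=> r; apply: emeasurable_funM => //.
  apply: emeasurable_funM; last exact/measurable_EFinP.
  by apply/measurable_EFinP/measurable_funTS/measurable_indic.
- move=> r x Dx; rewrite muleA mule_ge0//; last by rewrite lee_fin f0.
  by rewrite nnfun_muleindic_ge0.
apply: eq_integral => x /[!inE] Dx.
rewrite [in RHS]fimfunE -fsumEFin// ge0_mule_fsuml//.
  by apply: eq_fsbigr => r _; rewrite EFinM muleA.
by move=> r; rewrite nnfun_muleindic_ge0.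
Qed.

(** Simple functions first, then monotone convergence. The statement is relative to [D] because a
    passage density represents the law only on subsets of [[0, +oo[]. *)
Lemma ge0_integral_density (g : T -> \bar R) :
  measurable_fun D g -> (forall x, D x -> 0 <= g x) ->
  \int[nu]_(x in D) g x = \int[mu]_(x in D) (g x * (f x)%:E).
Proof.
move=> mg g0; pose g_ := nnsfun_approx mD mg.
transitivity (limn (fun n => \int[nu]_(x in D) (g_ n x)%:E)).
  rewrite -monotone_convergence//=.
  - apply: eq_integral => x /[!inE] xD; apply/esym/cvg_lim => //=.
    exact: cvg_nnsfun_approx.
  - by move=> n; exact/measurable_EFinP/measurable_funTS.
  - by move=> n x _; rewrite lee_fin.
  - by move=> x _ m n mn; rewrite lee_fin; exact/lefP/nd_nnsfun_approx.
under eq_fun do rewrite ge0_integral_density_nnsfun.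
rewrite -monotone_convergence//=.
- apply: eq_integral => x /[!inE] xD; apply/cvg_lim => //=.
  apply: cvgeZr => //; exact: cvg_nnsfun_approx.
- move=> n; apply: emeasurable_funM; last exact/measurable_EFinP.
  exact/measurable_EFinP/measurable_funTS.
- by move=> n x Dx; rewrite mule_ge0// lee_fin// f0.
- move=> x Dx m n mn; rewrite lee_wpmul2r ?lee_fin ?f0//.
  exact/lefP/nd_nnsfun_approx.
Qed.

End integral_density.

Section normal_integrals.
Local Set Implicit Arguments.
Local Unset Strict Implicit.
Local Open Scope ereal_scope.
Variable R : realType.
Notation mu := (@lebesgue_measure R).

Lemma ge0_integral_normal_prob (m s : R) (g : R -> \bar R) :
  measurable_fun setT g -> (forall x, 0 <= g x) ->
  \int[normal_prob m s]_x g x = \int[mu]_x (g x * (normal_pdf m s x)%:E).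
Proof.
move=> mg g0; apply: (ge0_integral_density (mu := mu)) => //.
- exact: measurable_normal_pdf.
- by move=> x _; exact: normal_pdf_ge0.
Qed.

(** The rescaled image measure gives half-open intervals their length, and this characterises
    Lebesgue measure. *)
Lemma lebesgue_measure_affine (c k : R) (A : set R) : (0 < k)%R ->
  measurable A ->
  mu A = k%:E * pushforward mu (fun x : measurableTypeR R => (c + k * x)%R) A.
Proof.
move=> k0 mA.
pose phi := fun x : measurableTypeR R => ((c + k * x)%R : measurableTypeR R).
have mphi : measurable_fun setT phi.
  by apply: measurable_funD => //; exact: measurable_funM.
pose Phi : {mfun measurableTypeR R >-> measurableTypeR R} :=
  HB.pack phi (isMeasurableFun.Build _ _ _ _ _ mphi).
rewrite (@lebesgue_measure_unique _
  (mscale (NngNum (ltW k0)) (pushforward mu Phi)))// => _ [[a b]] _ <-.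
rewrite /= /mscale/= /pushforward/=.
have -> : Phi @^-1` `]a, b] = `]((a - c) / k)%R, ((b - c) / k)%R]%classic :> set R.
  apply/seteqP; split => x /=; rewrite !in_itv/= ltr_pdivrMr// ler_pdivlMr//.
    by rewrite /phi => /andP[]; rewrite mulrC => ? ?; apply/andP; split; lra.
  by rewrite /phi => /andP[]; rewrite mulrC => ? ?; apply/andP; split; lra.
rewrite !lebesgue_measure_itv/= !lte_fin ltr_pM2r ?invr_gt0// ltrD2r.
case: ifPn => _; last by rewrite mule0.
rewrite -!EFinB -EFinM; congr EFin; field; exact: lt0r_neq0.
Qed.

(** The chain of the diffusion is driven by the same centred noise as the Bessel chain, transformed
    affinely at each step; this turns its transition into the kernel that appears in
    [kernel_dist]. *)
Lemma ge0_integral_normal_affine (c k s : R) (g : R -> \bar R) :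
  (0 < k)%R -> (0 < s)%R -> measurable_fun setT g -> (forall x, 0 <= g x) ->
  \int[normal_prob 0 s]_x g (c + k * x)%R =
  \int[mu]_x (g x * (normal_pdf c (k * s) x)%:E).
Proof.
move=> k0 s0 mg g0.
pose phi := fun x : measurableTypeR R => ((c + k * x)%R : measurableTypeR R).
have mphi : measurable_fun setT phi.
  by apply: measurable_funD => //; exact: measurable_funM.
have mgf : measurable_fun setT (fun x => g x * (normal_pdf c (k * s) x)%:E).
  apply: emeasurable_funM => //.
  by apply/measurable_EFinP; exact: measurable_normal_pdf.
have gf0 x : 0 <= g x * (normal_pdf c (k * s) x)%:E.
  by rewrite mule_ge0// lee_fin normal_pdf_ge0.
rewrite (ge0_integral_normal_prob 0 s (measurableT_comp mg mphi) (fun x => g0 _)).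
pose Phi : {mfun measurableTypeR R >-> measurableTypeR R} :=
  HB.pack phi (isMeasurableFun.Build _ _ _ _ _ mphi).
rewrite [in RHS](eq_measure_integral
    (mscale (NngNum (ltW k0)) (pushforward mu Phi))); last first.
  by move=> A mA _; rewrite /mscale/= (@lebesgue_measure_affine c k).
rewrite ge0_integral_mscale//.
have E := @ge0_integral_pushforward _ _ _ _ _ phi mphi mu setT _ measurableT mgf (fun x _ => gf0 x).
transitivity (k%:E * \int[mu]_x (g (phi x) * (normal_pdf c (k * s) (phi x))%:E));
  last by congr (_ * _); exact/esym/E.
have mgfp := measurableT_comp mgf mphi.
have k0' : 0 <= k%:E by rewrite lee_fin ltW.
rewrite -(ge0_integralZl mu measurableT mgfp (fun x _ => gf0 _) k0').
apply: eq_integral => x _ /=.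
rewrite muleCA; congr (_ * _); rewrite -EFinM; congr EFin.
rewrite !normal_pdfE ?gt_eqF ?mulr_gt0// mulrA; congr (_ * _)%R.
  rewrite /normal_peak.
  have -> : ((k * s) ^+ 2 * pi *+ 2 = k ^+ 2 * (s ^+ 2 * pi *+ 2))%R.
    by rewrite exprMn -mulrA mulrnAr.
  rewrite (sqrtrM _ (sqr_ge0 k)) sqrtr_sqr gtr0_norm// invfM mulrA.
  by rewrite divff ?gt_eqF// mul1r.
rewrite /normal_fun /phi; congr expR.
rewrite -(mulr_natr (s ^+ 2) 2) -(mulr_natr ((k * s) ^+ 2) 2).
by field; rewrite !gt_eqF.
Qed.

End normal_integrals.

Section freezing.
Local Set Implicit Arguments.
Local Unset Strict Implicit.
Local Open Scope ereal_scope.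
Context (R : realType) d (Omega : measurableType d) (P : probability Omega R).
Variable F : set (set Omega).
Hypotheses (sF : sigma_algebra setT F) (F_measurable : F `<=` measurable).

Definition measurable_wrt d1 (T1 : measurableType d1) (Y : Omega -> T1) :=
  forall B, measurable B -> F (Y @^-1` B).

(** On the type whose sigma-algebra is [F], the general closure properties of measurable functions
    apply to [F]-measurability. *)
Lemma measurable_wrtP d1 (T1 : measurableType d1) (Y : Omega -> T1) :
  measurable_wrt Y <-> measurable_fun setT (Y : g_sigma_algebraType F -> T1).
Proof.
split=> mY => [_ B mB|B mB].
  by rewrite setTI measurable_g_measurableTypeE//; exact: mY.
have := mY measurableT B mB.
by rewrite setTI measurable_g_measurableTypeE.
Qed.

Lemma measurable_wrt_measurable d1 (T1 : measurableType d1) (Y : Omega -> T1) :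
  measurable_wrt Y -> measurable_fun setT Y.
Proof. by move=> mY _ B mB; rewrite setTI; exact/F_measurable/mY. Qed.

(* Conditionally on [F], [Y] may be treated as a constant and [xi] as an
   independent sample of its law [gam]. *)
Lemma freezing d1 (T1 : measurableType d1) d2 (T2 : measurableType d2)
    (gam : probability T2 R) (Y : Omega -> T1) (xi : Omega -> T2)
    (A : set Omega) (psi : T1 * T2 -> \bar R) :
  measurable_wrt Y -> measurable_fun setT xi ->
  (forall A' B, F A' -> measurable B ->
    P (A' `&` xi @^-1` B) = P A' * gam B) ->
  F A -> measurable_fun setT psi -> (forall z, 0 <= psi z) ->
  \int[P]_(w in A) psi (Y w, xi w) = \int[P]_(w in A) \int[gam]_y psi (Y w, y).
Proof.
move=> YF mxi indep FA mpsi psi0.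
have mA : measurable A by exact: F_measurable.
have i0 w : (0 <= \1_A w :> R)%R by rewrite indicE ler0n.
(* The event [A] is carried along as one more [F]-measurable coordinate, so that a single product
   law handles the restriction to [A]. *)
pose V := fun w => ((\1_A w : R), Y w).
have VF : measurable_wrt V.
  apply/measurable_wrtP/measurable_fun_pair => //.
    apply: measurable_indic; rewrite measurable_g_measurableTypeE//.
  exact/measurable_wrtP.
have mV : measurable_fun setT V by exact: measurable_wrt_measurable.
pose VM : {mfun Omega >-> (R * T1)%type} :=
  HB.pack V (isMeasurableFun.Build _ _ _ _ _ mV).
pose J := fun w => (V w, xi w).
have mJ : measurable_fun setT J by exact: measurable_fun_pair.
pose JM : {mfun Omega >-> ((R * T1) * T2)%type} :=
  HB.pack J (isMeasurableFun.Build _ _ _ _ _ mJ).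
(* The maximum makes the integrand nonnegative on the whole product space; on values of an indicator
   it is the identity. *)
pose Psi (z : (R * T1) * T2) := (Num.max z.1.1 0)%:E * psi (z.1.2, z.2).
have Psi0 z : 0 <= Psi z by rewrite mule_ge0// lee_fin le_max lexx orbT.
have mPsi : measurable_fun setT Psi.
  apply: emeasurable_funM.
    apply/measurable_EFinP; apply: measurable_maxr => //.
    exact: measurableT_comp.
  apply: measurableT_comp mpsi _; apply: measurable_fun_pair => //.
  exact: measurableT_comp.
have JE B : measurable B ->
    (distribution P VM \x gam) B = distribution P JM B.
  apply: product_measure_unique => A1 B1 mA1 mB1.
  change (P (V @^-1` A1 `&` xi @^-1` B1) = P (V @^-1` A1) * gam B1).
  by rewrite indep//; exact: VF.
transitivity (\int[P]_w Psi (J w)).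
  rewrite [LHS]integral_mkcond epatch_indic; apply: eq_integral => w _.
  by rewrite /Psi /J/= (max_idPl (i0 w)) muleC.
transitivity (\int[distribution P JM]_z Psi z).
  by rewrite ge0_integral_distribution.
transitivity (\int[distribution P VM \x gam]_z Psi z).
  by apply: eq_measure_integral => B mB _; exact/esym/JE.
rewrite fubini_tonelli1// ge0_integral_distribution; last 2 first.
- exact: measurable_fun_fubini_tonelli_F.
- by move=> x; exact: integral_ge0.
rewrite [RHS]integral_mkcond epatch_indic; apply: eq_integral => w _.
rewrite /fubini_F/= /Psi/= muleC -ge0_integralZl//.
  by rewrite (max_idPl (i0 w)).
by apply: measurableT_comp mpsi _; exact: measurable_fun_pair.
Qed.

End freezing.

(** * Stopped Euler chains *)

Lemma integral_probability_cst d (T : measurableType d) (R : realType)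
    (P : probability T R) (c : R) :
  (\int[P]_x c%:E = c%:E)%E.
Proof. by rewrite integral_cst//= probability_setT mule1. Qed.

Section stopped_euler_scheme.
Local Set Implicit Arguments.
Local Unset Strict Implicit.
Variable R : realType.
Implicit Types (beta : nat -> R) (G : nat -> R -> R) (dr sg : R -> R).

Fixpoint euler (x0 : R) dr sg (dw : nat -> R) (k : nat) : R :=
  if k is k'.+1 then
    let y := euler x0 dr sg dw k' in y + dr y + sg y * dw k'
  else x0.

(* [k] is the current time and [j] the number of steps left. *)
Fixpoint passage_value beta G (y : nat -> R) (j k : nat) : R :=
  if y k <= beta k then G k (y k)
  else if j is j'.+1 then passage_value beta G y j' k.+1 else 0.

(** The backward (dynamic programming) equation for the expectation of [passage_value] when the
    noise has law [gam]; [expectation_passage_value] proves that it computes this expectation.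
    [fine] loses nothing as long as the values are bounded. *)
Fixpoint mean_passage_value (gam : set (measurableTypeR R) -> \bar R) beta G dr sg (j k : nat)
    (x : R) : R :=
  if x <= beta k then G k x
  else if j is j'.+1 then
    fine (\int[gam]_z
      (mean_passage_value gam beta G dr sg j' k.+1 (x + dr x + sg x * z))%:E)%E
  else 0.

Section mean.
Variables (gam : probability (measurableTypeR R) R) (beta : nat -> R) (G : nat -> R -> R).
Variables (dr sg : R -> R) (c : nat -> R).
Hypotheses (mG : forall k, measurable_fun setT (G k)).
Hypotheses (mdr : measurable_fun setT dr) (msg : measurable_fun setT sg).
Hypothesis (G0 : forall k x, 0 <= G k x).
Hypothesis (Gc : forall k x, x <= beta k -> G k x <= c k).
Hypothesis (c0 : forall k, 0 <= c k).
Hypothesis c_mono : {homo c : i j / (i <= j)%N >-> i <= j}.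

Let Phi := mean_passage_value gam beta G dr sg.

Let mstep : measurable_fun setT (fun z : R * R => z.1 + dr z.1 + sg z.1 * z.2).
Proof.
apply: measurable_funD.
  by apply: measurable_funD => //; exact: measurableT_comp.
by apply: measurable_funM => //; exact: measurableT_comp.
Qed.

(** [G] is evaluated only at a detection, where it is at most [c] of the current index. That index
    never exceeds [j + k], and [c] is monotone. *)
Lemma mean_passage_value_props j k :
  [/\ measurable_fun setT (Phi j k), forall x, 0 <= Phi j k x
    & forall x, Phi j k x <= c (j + k)%N].
Proof.
elim: j k => [|j IH] k.
  split=> [|x|x]; rewrite /Phi/=; last 2 first.
  - by case: ifP.
  - by case: ifP => // ?; exact: Gc.
  by apply: measurable_fun_ifT => //; exact: measurable_fun_ler.
have [mP P0 Pc] := IH k.+1; rewrite addnS -addSn in Pc.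
have le1 x :
    (\int[gam]_z (Phi j k.+1 (x + dr x + sg x * z))%:E <= (c (j.+1 + k)%N)%:E)%E.
  apply: (@le_trans _ _ (\int[gam]_z (c (j.+1 + k)%N)%:E)%E).
    apply: ge0_le_integral => //.
    - by move=> z _; rewrite lee_fin.
    - apply/measurable_EFinP/(measurableT_comp mP).
      by apply: measurable_funD => //; exact: measurable_funM.
    - by move=> z _; rewrite lee_fin.
  by rewrite integral_probability_cst.
have ge1 x : (0 <= \int[gam]_z (Phi j k.+1 (x + dr x + sg x * z))%:E)%E.
  by apply: integral_ge0 => z _; rewrite lee_fin.
split=> [|x|x]; rewrite /Phi/=; last 2 first.
- by case: ifP => [//|_]; apply: fine_ge0; exact: ge1.
- case: ifP => [xk|_]; first by rewrite (le_trans (Gc xk))// c_mono// leq_addl.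
  by rewrite -lee_fin fineK// ge0_fin_numE// (le_lt_trans (le1 x))// ltry.
apply: measurable_fun_ifT => //; first exact: measurable_fun_ler.
apply: measurableT_comp => //.
apply: (@measurable_fun_fubini_tonelli_F _ _ _ _ _ gam
  (fun z : R * R => (Phi j k.+1 (z.1 + dr z.1 + sg z.1 * z.2))%:E)).
- exact/measurable_EFinP/(measurableT_comp mP).
- by move=> z; rewrite lee_fin.
Qed.

Lemma mean_passage_value_step j k x : beta k < x ->
  (Phi j.+1 k x)%:E = (\int[gam]_z (Phi j k.+1 (x + dr x + sg x * z))%:E)%E.
Proof.
move=> xk; rewrite /Phi/= leNgt xk/= -/Phi fineK//.
have [mP P0 Pc] := mean_passage_value_props j k.+1.
rewrite ge0_fin_numE; last by apply: integral_ge0 => z _; rewrite lee_fin.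
apply: (@le_lt_trans _ _ (\int[gam]_z (c (j + k.+1)%N)%:E)%E).
  apply: ge0_le_integral => //.
  - by move=> z _; rewrite lee_fin.
  - apply/measurable_EFinP/(measurableT_comp mP).
    by apply: measurable_funD => //; exact: measurable_funM.
  - by move=> z _; rewrite lee_fin.
by rewrite integral_probability_cst ltry.
Qed.

Context d (Omega : measurableType d) (P : probability Omega R).
Variables (F : nat -> set (set Omega)) (xi : nat -> Omega -> R) (x0 : R).
Hypotheses (sF : forall k, sigma_algebra setT (F k))
  (F_measurable : forall k, F k `<=` measurable)
  (F_mono : forall k, F k `<=` F k.+1).
Hypothesis xiF : forall k, measurable_wrt (F k.+1) (xi k).
Hypothesis indep : forall k A B, F k A -> measurable B ->
  (P (A `&` xi k @^-1` B) = P A * gam B)%E.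

Let Y k w := euler x0 dr sg (xi ^~ w) k.

Lemma euler_measurable_wrt k : measurable_wrt (F k) (Y k).
Proof.
elim: k => [|k IH].
  by apply/(measurable_wrtP (sF 0)); exact: measurable_cst.
have /(measurable_wrtP (sF k.+1)) mx := @xiF k.
have /(measurable_wrtP (sF k.+1)) mY : measurable_wrt (F k.+1) (Y k).
  by move=> B mB; exact/F_mono/IH.
apply/(measurable_wrtP (sF k.+1)).
have -> : Y k.+1 = (fun w => Y k w + dr (Y k w) + sg (Y k w) * xi k w) by [].
apply: measurable_funD.
  by apply: measurable_funD => //; exact: measurableT_comp mdr mY.
by apply: measurable_funM => //; exact: measurableT_comp msg mY.
Qed.

Lemma euler_measurable k : measurable_fun setT (Y k).
Proof.
exact: (measurable_wrt_measurable (F_measurable (k := k))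
  (euler_measurable_wrt k)).
Qed.

Let V j k w := passage_value beta G (Y^~ w) j k.

Lemma passage_value_props j k :
  [/\ measurable_fun setT (V j k), forall w, 0 <= V j k w
    & forall w, V j k w <= c (j + k)%N].
Proof.
elim: j k => [|j IH] k; last have [mV V0 Vc] := IH k.+1.
  split=> [|w|w]; rewrite /V/=; last 2 first.
  - by case: ifP.
  - by case: ifP => // ?; exact: Gc.
  apply: measurable_fun_ifT => //.
    by apply: measurable_fun_ler => //; exact: euler_measurable.
  by apply: measurableT_comp => //; exact: euler_measurable.
split=> [|w|w]; rewrite /V/=; last 2 first.
- by case: ifP => // _; exact: V0.
- case: ifP => [yk|_]; first by rewrite (le_trans (Gc yk))// c_mono// leq_addl.
  by have := Vc w; rewrite addnS -addSn.
apply: measurable_fun_ifT => //.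
  by apply: measurable_fun_ler => //; exact: euler_measurable.
by apply: measurableT_comp => //; exact: euler_measurable.
Qed.

(** This is the Markov property of the chain. Localising on an arbitrary [F k]-event [A] makes the
    induction work: the undetected part of [A] is again such an event and belongs to [F k.+1]. *)
Lemma integral_passage_value j k A : F k A ->
  (\int[P]_(w in A) (V j k w)%:E = \int[P]_(w in A) (Phi j k (Y k w))%:E)%E.
Proof.
elim: j k A => [//|j IH] k A FA.
have mA := F_measurable FA.
pose B0 := [set w | Y k w <= beta k].
have FB : F k B0.
  have := @euler_measurable_wrt k (`]-oo, beta k]%classic) (measurable_itv _).
  by congr (F k _); apply/seteqP; split=> w /=; rewrite in_itv.
have FA' : F k (A `\` B0).
  have [_ FC FU] := sF k.
  have := measurableD (T := g_sigma_algebraType (F k)) (A := A)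
    (B := B0).
  by rewrite measurable_g_measurableTypeE//; apply.
have mB := F_measurable FB.
have mA' := F_measurable FA'.
have [mV V0 Vc] := passage_value_props j.+1 k.
have [mP P0 Pc] := mean_passage_value_props j.+1 k.
have [mV' V0' Vc'] := passage_value_props j k.+1.
have [mP' P0' Pc'] := mean_passage_value_props j k.+1.
have AE : A = (A `&` B0) `|` (A `\` B0).
  by rewrite -setIUr setUv setIT.
rewrite AE !ge0_integral_setU//; first last.
- by apply/disj_setPS => w [[_ ?] [_]].
- by move=> w _; rewrite lee_fin.
- exact/measurable_EFinP/measurable_funTS.
- exact: measurableI.
- by apply/disj_setPS => w [[_ ?] [_]].
- by move=> w _; rewrite lee_fin.
- apply/measurable_EFinP/measurable_funTS/(measurableT_comp mP).
  exact: euler_measurable.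
- exact: measurableI.
congr (_ + _)%E.
  by apply: eq_integral => w /[!inE] -[_ /= yk]; rewrite /V /Phi/= yk.
transitivity (\int[P]_(w in A `\` B0) (V j k.+1 w)%:E)%E.
  apply: eq_integral => w /[!inE] -[_ /negP yk].
  by rewrite /V/= (negbTE yk).
(* After the induction hypothesis at time [k.+1], the integrand depends on the current position and
   the fresh noise [xi k]; [freezing] integrates the latter out, which is one step of the backward
   equation. *)
rewrite IH; last exact: F_mono.
have := @freezing R _ _ P (F k) (sF k) (F_measurable (k := k)) _ _ _ _ gam
  (Y k) (xi k) _ (fun z : R * R => (Phi j k.+1 (z.1 + dr z.1 + sg z.1 * z.2))%:E)
  (@euler_measurable_wrt k)
  (measurable_wrt_measurable (F_measurable (k := k.+1)) (@xiF k))
  (@indep k) FA'.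
move=> ->; last 2 first.
- exact/measurable_EFinP/(measurableT_comp mP').
- by move=> z; rewrite lee_fin.
apply: eq_integral => w /[!inE] -[_ /negP yk].
by rewrite mean_passage_value_step// ltNge.
Qed.

Lemma expectation_passage_value j :
  (\int[P]_w (V j 0 w)%:E = (Phi j 0 x0)%:E)%E.
Proof.
rewrite integral_passage_value.
  by rewrite /Y/= integral_probability_cst.
have [F0 FC _] := sF 0.
by have := FC _ F0; rewrite setTD setC0.
Qed.

End mean.
End stopped_euler_scheme.

(** No extended reals are subtracted: [f <= g + e] and [g <= f + e] are integrated separately, and
    all three integrals are bounded by real numbers afterwards. *)
Lemma integral_dist_le d (T : measurableType d) (R : realType)
    (mu : {measure set T -> \bar R}) (f g e : T -> R) (a b c : R) :
  measurable_fun setT f -> measurable_fun setT g -> measurable_fun setT e ->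
  (forall x, 0 <= f x) -> (forall x, 0 <= g x) -> (forall x, 0 <= e x) ->
  (forall x, `|f x - g x| <= e x) ->
  a%:E = (\int[mu]_x (f x)%:E)%E -> b%:E = (\int[mu]_x (g x)%:E)%E ->
  (\int[mu]_x (e x)%:E <= c%:E)%E -> `|a - b| <= c.
Proof.
move=> mf mg me f0 g0 e0 fge aE bE ec.
have key (f1 g1 : T -> R) : measurable_fun setT f1 -> measurable_fun setT g1 ->
    (forall x, 0 <= f1 x) -> (forall x, 0 <= g1 x) ->
    (forall x, f1 x <= g1 x + e x) ->
    (\int[mu]_x (f1 x)%:E <= \int[mu]_x (g1 x)%:E + c%:E)%E.
  move=> mf1 mg1 f10 g10 fg1.
  apply: (@le_trans _ _ (\int[mu]_x ((g1 x)%:E + (e x)%:E))%E).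
    apply: ge0_le_integral => //.
    - by move=> x _; rewrite lee_fin.
    - exact/measurable_EFinP.
    - by apply/measurable_EFinP; exact: measurable_funD.
    - by move=> x _; rewrite -EFinD lee_fin.
  rewrite ge0_integralD//.
  - by rewrite leeD2l.
  - by move=> x _; rewrite lee_fin.
  - exact/measurable_EFinP.
  - by move=> x _; rewrite lee_fin.
  - exact/measurable_EFinP.
have fg x : f x <= g x + e x.
  by have := fge x; rewrite ler_norml => /andP[]; lra.
have gf x : g x <= f x + e x.
  by have := fge x; rewrite ler_norml => /andP[]; lra.
have := key _ _ mf mg f0 g0 fg; have := key _ _ mg mf g0 f0 gf.
rewrite -aE -bE -!EFinD !lee_fin ler_norml => h1 h2.
by apply/andP; split; lra.
Qed.

(** * Change of measure along a chain *)

Section comparison.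
Local Set Implicit Arguments.
Local Unset Strict Implicit.
Variables (R : realType) (s h C rho : R) (H : R -> R) (beta : nat -> R) (y0 : R).
Variables (dr c sg : R -> R).
Hypotheses (s0 : 0 < s) (rho0 : 0 <= rho).
Hypotheses (mH : measurable_fun setT H) (mdr : measurable_fun setT dr)
  (mc : measurable_fun setT c) (msg : measurable_fun setT sg).
Hypothesis sg0 : forall x, 0 < sg x.
Hypothesis close : forall k x z, beta k < x ->
  `|normal_pdf 0 s z * expR (- C * h + (H (x + dr x + z) - H x)) -
    normal_pdf (c x) (sg x * s) z| <= rho * normal_pdf 0 (2 * s) z.

(* Weighting the paths of the Euler scheme of the Bessel process by
   [martingale_weight] turns them, approximately, into paths of the diffusion. *)
Definition martingale_weight (k : nat) (x : R) : R :=
  expR (- C * (k%:R * h) + (H x - H y0)).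
Notation w := martingale_weight.

Variable bnd : nat -> R.
Hypothesis wbnd : forall k x, x <= beta k -> w k x <= bnd k.
Hypothesis bnd_mono : {homo bnd : i j / (i <= j)%N >-> i <= j}.

Let gam : probability (measurableTypeR R) R := normal_prob 0 s.
Let Phi1 := mean_passage_value gam beta (fun _ _ => 1)
  (fun x => dr x + c x) sg.
Let Phi2 := mean_passage_value gam beta w dr (fun=> 1).

Let w0 k x : 0 < w k x. Proof. exact: expR_gt0. Qed.

Let bnd0 k : 0 <= bnd k.
Proof. exact: le_trans (expR_ge0 _) (wbnd (lexx _)). Qed.

Lemma measurable_martingale_weight k : measurable_fun setT (w k).
Proof.
apply: measurableT_comp => //; apply: measurable_funD => //.
exact: measurable_funB.
Qed.
Let mw := measurable_martingale_weight.

Let props1 j k : [/\ measurable_fun setT (Phi1 j k),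
  forall x, 0 <= Phi1 j k x & forall x, Phi1 j k x <= 1].
Proof.
apply: (@mean_passage_value_props R gam beta (fun _ _ => 1) _ sg (fun=> 1)) => //.
exact: measurable_funD.
Qed.

Let props2 j k : [/\ measurable_fun setT (Phi2 j k),
  forall x, 0 <= Phi2 j k x & forall x, Phi2 j k x <= bnd (j + k)%N].
Proof.
by apply: mean_passage_value_props => // ? ?; exact: expR_ge0.
Qed.

(** Dividing by the weight is a discrete Doob transform: [Phi2 / w] solves the backward equation for
    the tilted kernel, which [close] compares with that of [Phi1]. An error [kap] becomes
    [kap + (kap + 1) rho] after one more step, and this recursion from [0] gives
    [(1 + rho) ^ j - 1]. *)
Lemma mean_passage_value_dist j k x :
  `|Phi2 j k x / w k x - Phi1 j k x| <= (1 + rho) ^+ j - 1.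
Proof.
have rj i : 0 <= (1 + rho) ^+ i - 1 by rewrite subr_ge0 exprn_ege1// lerDl.
elim: j k x => [|j IH] k x.
  rewrite /Phi2 /Phi1/=; case: ifP => _.
    by rewrite divff ?gt_eqF// subrr normr0.
  by rewrite mul0r subrr normr0.
have [xk|kx] := leP x (beta k).
  by rewrite /Phi2 /Phi1/= xk divff ?gt_eqF// subrr normr0.
have [mP1 P10 P1c] := props1 j k.+1.
have [mP2 P20 P2c] := props2 j k.+1.
pose x' z := x + dr x + z.
have mx' : measurable_fun setT x' by exact: measurable_funD.
have [kap kapE] : exists kap, (1 + rho) ^+ j - 1 = kap by exists ((1 + rho) ^+ j - 1).
have kap0 : 0 <= kap by rewrite -kapE.
have kap1 : 0 <= kap + 1 by rewrite addr_ge0.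
pose q z := normal_pdf (c x) (sg x * s) z.
pose g z := normal_pdf 0 (2 * s) z.
have mq : measurable_fun setT q by exact: measurable_normal_pdf.
have mg : measurable_fun setT g by exact: measurable_normal_pdf.
have q0 z : 0 <= q z by exact: normal_pdf_ge0.
have g0 z : 0 <= g z by exact: normal_pdf_ge0.
apply: (@integral_dist_le _ _ _ (@lebesgue_measure R)
  (fun z => Phi2 j k.+1 (x' z) / w k x * normal_pdf 0 s z)
  (fun z => Phi1 j k.+1 (x' z) * q z)
  (fun z => kap * q z + (kap + 1) * rho * g z)).
- apply: measurable_funM; last exact: measurable_normal_pdf.
  by apply: measurable_funM => //; exact: measurableT_comp mP2 mx'.
- by apply: measurable_funM => //; exact: measurableT_comp mP1 mx'.
- by apply: measurable_funD => //; exact: measurable_funM.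
- by move=> z; rewrite !mulr_ge0 ?invr_ge0 ?normal_pdf_ge0// ltW.
- by move=> z; rewrite mulr_ge0.
- by move=> z; rewrite addr_ge0 ?mulr_ge0// addr_ge0// rj.
- move=> z; set p := normal_pdf 0 s z * expR (- C * h + (H (x' z) - H x)).
  (* The quotient of the weights at two successive times is exactly the exponential factor of
     [close]; it is moved from the value function to the Gaussian kernel. *)
  have -> : Phi2 j k.+1 (x' z) / w k x * normal_pdf 0 s z =
      Phi2 j k.+1 (x' z) / w k.+1 (x' z) * p.
    rewrite /p /w -!mulrA; congr (_ * _); rewrite -!expRN mulrCA.
    rewrite [RHS]mulrCA -expRD mulrC; congr (_ * expR _).
    by rewrite -addn1 natrD; ring.
  have d1 : `|p - q z| <= rho * g z by exact: close kx.
  have d2 := IH k.+1 (x' z); rewrite kapE in d2.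
  set u := Phi2 _ _ _ / _ in d2 *; set v := Phi1 _ _ _ in d2 *.
  have v1 : `|v| <= 1 by rewrite ger0_norm ?P10// P1c.
  have p0 : 0 <= p by rewrite mulr_ge0 ?expR_ge0// normal_pdf_ge0.
  (* The inherited error [u - v] is integrated against the tilted kernel [p], which is at most
     [q + rho g]; the fresh error of the kernel only meets [v], which is bounded by 1. Hence errors
     are not multiplied by the size of the weight. *)
  have -> : u * p - v * q z = (u - v) * p + v * (p - q z) by ring.
  apply: (le_trans (ler_normD _ _)); rewrite (normrM (u - v)) (normrM v) (ger0_norm p0).
  have e1 : `|u - v| * p <= kap * p by rewrite ler_wpM2r.
  have e2 : `|v| * `|p - q z| <= rho * g z.
    by rewrite -[leRHS]mul1r ler_pM.
  have e3 : kap * p <= kap * (q z + rho * g z).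
    by rewrite ler_wpM2l//; move: d1; rewrite ler_norml => /andP[_]; lra.
  lra.
- rewrite EFinM (@mean_passage_value_step R gam beta w dr _ bnd)//; last first.
    by move=> ? ?; exact: expR_ge0.
  have mPx : measurable_fun setT (fun z : R => (Phi2 j k.+1 (x + dr x + 1 * z))%:E).
    apply/measurable_EFinP/(measurableT_comp mP2).
    by apply: measurable_funD => //; exact: measurable_funM.
  have wV : (0 <= (w k x)^-1%:E)%E by rewrite lee_fin invr_ge0 ltW.
  rewrite muleC -ge0_integralZl//; last by move=> z _; rewrite lee_fin; exact: P20.
  rewrite ge0_integral_normal_prob.
  + apply: eq_integral => z _; rewrite -!EFinM mul1r; congr (_ * _)%:E.
    by rewrite mulrC.
  + exact: measurable_funeM.
  + by move=> z; rewrite mule_ge0// lee_fin; exact: P20.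
- rewrite (@mean_passage_value_step R gam beta _ _ _ (fun=> 1))//; last first.
    exact: measurable_funD.
  transitivity (\int[gam]_z (Phi1 j k.+1 (x + dr x + (c x + sg x * z)))%:E)%E.
    by apply: eq_integral => z _; rewrite !addrA.
  rewrite (@ge0_integral_normal_affine _ (c x) (sg x) s
    (fun z => (Phi1 j k.+1 (x' z))%:E))//.
  + by apply/measurable_EFinP; exact: (measurableT_comp mP1 mx').
  + by move=> z; rewrite lee_fin.
- under eq_integral do rewrite EFinD (EFinM kap) (EFinM ((kap + 1) * rho)).
  rewrite ge0_integralD//.
  + rewrite !ge0_integralZl//; try by [exact/measurable_EFinP
      | move=> z _; rewrite lee_fin | rewrite lee_fin// mulr_ge0].
    rewrite !integral_normal_pdf !mule1 -EFinD lee_fin exprSr.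
    have {kapE} -> : kap = (1 + rho) ^+ j - 1 by rewrite kapE.
    by rewrite le_eqVlt; apply/orP; left; apply/eqP; ring.
  + by move=> z _; rewrite -EFinM lee_fin mulr_ge0.
  + by apply: emeasurable_funM => //; exact/measurable_EFinP.
  + by move=> z _; rewrite -EFinM lee_fin !mulr_ge0.
  + by apply: emeasurable_funM => //; exact/measurable_EFinP.
Qed.

End comparison.

(** * Coefficients solving the differential equation *)

Section ode_bounds.
Local Set Implicit Arguments.
Local Unset Strict Implicit.
Variable R : realType.
Implicit Types (f df : R -> R) (l m x y z K : R).

Lemma MVT_ray f df l x y :
  (forall z, l < z -> is_derive z 1 f (df z)) -> l < x -> l < y ->
  exists z, [/\ Num.min x y <= z, `|z - x| <= `|y - x| &
    f y - f x = df z * (y - x)].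
Proof.
move=> dfE lx ly.
have cf a b : l < a -> {within `[a, b], continuous f}.
  move=> la; apply: derivable_within_continuous => z; rewrite in_itv/=.
  by move=> /andP[az _]; apply: ex_derive; exact/dfE/(lt_le_trans la).
have [xy|/ltW yx] := leP x y.
  have [z|z] := MVT_segment xy _ (cf _ _ lx) (df := df).
    by rewrite in_itv/= => /andP[xz _]; apply: dfE; exact: lt_trans xz.
  rewrite in_itv/= => /andP[xz zy] ->; exists z; split => //.
  by rewrite !ger0_norm ?subr_ge0// lerD2r.
have [z|z] := MVT_segment yx _ (cf _ _ ly) (df := df).
  by rewrite in_itv/= => /andP[xz _]; apply: dfE; exact: lt_trans xz.
rewrite in_itv/= => /andP[yz zx] e; exists z; split => //.
  by rewrite !ler0_norm ?subr_le0//; lra.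
by rewrite -opprB e; ring.
Qed.

Lemma derive_bound_lipschitz f df l m K :
  (forall z, l < z -> is_derive z 1 f (df z)) -> l < m ->
  (forall z, m <= z -> `|df z| <= K) ->
  forall x y, m <= x -> m <= y -> `|f y - f x| <= K * `|y - x|.
Proof.
move=> dfE lm dfK x y mx my.
have [z [xyz _ ->]] := MVT_ray dfE (lt_le_trans lm mx) (lt_le_trans lm my).
by rewrite normrM ler_wpM2r// dfK// (le_trans _ xyz)// le_min mx.
Qed.

Lemma derive_le0_nonincreasing f df l m :
  (forall z, l < z -> is_derive z 1 f (df z)) -> l < m ->
  (forall z, m <= z -> df z <= 0) ->
  forall x y, m <= x -> x <= y -> f y <= f x.
Proof.
move=> dfE lm df0 x y mx xy; have my := le_trans mx xy.
have [z [xyz _ e]] := MVT_ray dfE (lt_le_trans lm mx) (lt_le_trans lm my).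
rewrite -subr_le0 e mulr_le0_ge0 ?subr_ge0// df0// (le_trans _ xyz)//.
by rewrite le_min mx.
Qed.

(** The mean value theorem is used twice, on the remainder and then on [df]. A Lipschitz second
    derivative takes the place of a third derivative, at the price of a constant larger than the
    usual [K / 6]. *)
Lemma taylor2_bound f df ddf l m K :
  (forall z, l < z -> is_derive z 1 f (df z)) ->
  (forall z, l < z -> is_derive z 1 df (ddf z)) -> l < m -> 0 <= K ->
  (forall x y, m <= x -> m <= y -> `|ddf y - ddf x| <= K * `|y - x|) ->
  forall x y, m <= x -> m <= y ->
  `|f y - f x - df x * (y - x) - ddf x * (y - x) ^+ 2 / 2| <= K * `|y - x| ^+ 3.
Proof.
move=> dfE ddfE lm K0 ddfK x y mx my.
pose r z := f z - df x * (z - x) - ddf x / 2 * (z - x) ^+ 2.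
pose dr z := df z - df x - ddf x * (z - x).
have drE z : l < z -> is_derive z 1 r (dr z).
  move=> lz; have := dfE _ lz => ?; rewrite /r.
  by apply: is_derive_eq; rewrite /dr /GRing.scale/=; field.
have [z [xyz zx e]] := MVT_ray drE (lt_le_trans lm mx) (lt_le_trans lm my).
have mz : m <= z by rewrite (le_trans _ xyz)// le_min mx.
have [t [xzt tx e']] := MVT_ray ddfE (lt_le_trans lm mx) (lt_le_trans lm mz).
have mt : m <= t by rewrite (le_trans _ xzt)// le_min mx.
have -> : f y - f x - df x * (y - x) - ddf x * (y - x) ^+ 2 / 2 = r y - r x.
  by rewrite /r; field.
rewrite e /dr.
have -> : df z - df x - ddf x * (z - x) = (ddf t - ddf x) * (z - x).
  by rewrite e'; ring.
rewrite !normrM (exprSr _ 2) mulrA ler_wpM2r// expr2 mulrA.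
rewrite ler_pM// (le_trans (ddfK _ _ mx mt))// ler_wpM2l//.
exact: le_trans zx.
Qed.

(* [f' / f] solves a Riccati equation with bounded source; it cannot grow, and
   it cannot become very negative because [f] would then reach [0]. *)
Lemma log_derivative_bounded f df ddf l m Q :
  (forall z, l < z -> is_derive z 1 f (df z)) ->
  (forall z, l < z -> is_derive z 1 df (ddf z)) ->
  (forall z, l < z -> 0 < f z) -> l < m -> 0 <= Q ->
  (forall z, m <= z -> `|ddf z| <= Q * f z) ->
  exists2 k, 0 <= k & forall z, m <= z -> `|df z / f z| <= k.
Proof.
move=> dfE ddfE f0 lm Q0 ddfQ.
(* [k] has to dominate [|f' / f|] at [m] and, through its square, [Q]; the summand [1] turns
   [Q <= k] into [Q <= k ^ 2]. *)
pose k := 1 + Q + `|df m / f m|.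
have q0 := normr_ge0 (df m / f m).
have k1 : 1 <= k by rewrite /k; lra.
have kQ : Q <= k ^+ 2.
  have : Q <= k by rewrite /k; lra.
  nra.
have k0 : 0 <= k by exact: le_trans k1.
have ddfk z : m <= z -> `|ddf z| <= k ^+ 2 * f z.
  move=> mz; rewrite (le_trans (ddfQ _ mz))// ler_wpM2r// ltW// f0//.
  exact: lt_le_trans mz.
exists k => // z mz; have lz := lt_le_trans lm mz.
rewrite normrM normfV (gtr0_norm (f0 _ lz)) ler_pdivrMr ?f0// ler_norml.
apply/andP; split; last first.
  (* The derivative of [(f' - k f) exp (k y)] is [(f'' - k ^ 2 f) exp (k y) <= 0]. The sign at [m]
     therefore persists and gives [f' <= k f]. *)
  pose g y := (df y - k * f y) * expR (k * y).
  pose dg y := (ddf y - k ^+ 2 * f y) * expR (k * y).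
  have dgE y : l < y -> is_derive y 1 g (dg y).
    move=> ly; have ? := dfE _ ly; have ? := ddfE _ ly; rewrite /g.
    apply: is_derive_eq; rewrite /dg /GRing.scale/= !mulr1; ring.
  have dg0 y : m <= y -> dg y <= 0.
    move=> my; rewrite mulr_le0_ge0 ?expR_ge0// subr_le0.
    by rewrite (le_trans (ler_norm _))// ddfk.
  have := derive_le0_nonincreasing dgE lm dg0 (lexx m) mz.
  have gm : g m <= 0.
    rewrite mulr_le0_ge0 ?expR_ge0// subr_le0 -ler_pdivrMr ?f0//.
    by rewrite (le_trans (ler_norm _))// /k lerDr addr_ge0.
  move=> /le_trans/(_ gm); rewrite pmulr_lle0 ?expR_gt0//; lra.
rewrite leNgt; apply/negP => dfz.
(* If [f' + k f] is negative at [z], then [(f' + k f) exp (- k y)] stays below its value there. So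
   the derivative [(f' + k f) exp (k y)] of [f exp (k y)] is at most a fixed [- c < 0] beyond
   [z]. *)
pose g y := (df y + k * f y) * expR (- k * y).
pose dg y := (ddf y - k ^+ 2 * f y) * expR (- k * y).
have dgE y : l < y -> is_derive y 1 g (dg y).
  move=> ly; have ? := dfE _ ly; have ? := ddfE _ ly; rewrite /g.
  apply: is_derive_eq; rewrite /dg /GRing.scale/= !mulr1; ring.
have dg0 y : m <= y -> dg y <= 0.
  move=> my; rewrite mulr_le0_ge0 ?expR_ge0// subr_le0.
  by rewrite (le_trans (ler_norm _))// ddfk.
have gz : g z < 0 by rewrite /g pmulr_llt0 ?expR_gt0//; lra.
have [c c0 cE] : exists2 c, 0 < c & c = - g z * expR (2 * k * z).
  by exists (- g z * expR (2 * k * z)); rewrite // mulr_gt0 ?expR_gt0// oppr_gt0.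
pose p y := f y * expR (k * y) + c * y.
pose dp y := (df y + k * f y) * expR (k * y) + c.
have dpE y : l < y -> is_derive y 1 p (dp y).
  move=> ly; have ? := dfE _ ly; rewrite /p.
  apply: is_derive_eq; rewrite /dp /GRing.scale/= !mulr1; ring.
have dp0 y : z <= y -> dp y <= 0.
  move=> zy; have gy := derive_le0_nonincreasing dgE lm dg0 mz zy.
  have -> : dp y = g y * expR (2 * k * y) + c.
    by rewrite /dp /g -mulrA -expRD; congr (_ * expR _ + _); ring.
  have : expR (2 * k * z) <= expR (2 * k * y).
    by rewrite ler_expR ler_wpM2l// mulr_ge0.
  have := expR_gt0 (2 * k * z); rewrite cE; nra.
have fz := f0 _ lz.
(* At this point a decrease of slope at least [c] has used up the value of [f exp (k y)] at [z],
   contradicting [f > 0]. *)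
pose y := z + f z * expR (k * z) / c.
have zy : z <= y by rewrite lerDl (divr_ge0 (mulr_ge0 (ltW fz) (expR_ge0 _)) (ltW c0)).
have := derive_le0_nonincreasing dpE lz dp0 (lexx z) zy.
have cy : c * y = c * z + f z * expR (k * z).
  by rewrite /y; field; rewrite gt_eqF.
rewrite /p cy.
have := mulr_gt0 (f0 _ (lt_le_trans lz zy)) (expR_gt0 (k * y)).
lra.
Qed.

End ode_bounds.

(** * Cut-off coefficients with global bounds *)

Section h_transforms.
Local Set Implicit Arguments.
Local Unset Strict Implicit.
Variable R : realType.

(* Coefficients for which [exp (H (Z_t) - C t)] is, to second order, the density
   of the diffusion with drift [nu + lam] with respect to the one with drift
   [nu]; the second-order expansion of [H] is only available above [m + eta]. *)
Record h_transform (C m eta K : R) (nu lam el H : R -> R) : Prop :=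
  HTransform {
    ht_K : 1 <= K;
    ht_C : `|C| <= K;
    ht_nu : forall x, `|nu x| <= K;
    ht_lam : forall x, `|lam x| <= K;
    ht_el : forall x, `|el x| <= K;
    ht_elE : forall x, el x + lam x ^+ 2 + 2 * lam x * nu x = 2 * C;
    ht_nu_lip : forall x y, `|nu y - nu x| <= K * `|y - x|;
    ht_lam_lip : forall x y, `|lam y - lam x| <= K * `|y - x|;
    ht_el_lip : forall x y, `|el y - el x| <= K * `|y - x|;
    ht_H_lip : forall x y, `|H y - H x| <= K * `|y - x|;
    ht_taylor : forall x y, m + eta <= x ->
      `|H (x + y) - H x - lam x * y - el x * y ^+ 2 / 2| <= K * `|y| ^+ 3 }.

Lemma max_dist (m x y : R) :
  `|Num.max y m - Num.max x m| <= `|y - x|.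
Proof.
have [a|a] := leP y m; have [b|b] := leP x m.
- by rewrite subrr normr0.
- by rewrite !ler0_norm ?subr_le0//; lra.
- by rewrite !ger0_norm ?subr_ge0//; lra.
- by [].
Qed.

Lemma normM_lipschitz (f g : R -> R) (A : set R) (K L : R) :
  0 <= K -> (forall x, A x -> `|f x| <= K) -> (forall x, A x -> `|g x| <= K) ->
  (forall x y, A x -> A y -> `|f y - f x| <= L * `|y - x|) ->
  (forall x y, A x -> A y -> `|g y - g x| <= L * `|y - x|) ->
  forall x y, A x -> A y -> `|f y * g y - f x * g x| <= 2 * K * L * `|y - x|.
Proof.
move=> K0 fK gK fL gL x y Ax Ay.
have -> : f y * g y - f x * g x = f y * (g y - g x) + g x * (f y - f x) by ring.
apply: (le_trans (ler_normD _ _)); rewrite !normrM.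
have h1 : `|f y| * `|g y - g x| <= K * (L * `|y - x|) by rewrite ler_pM ?fK ?gL.
have h2 : `|g x| * `|f y - f x| <= K * (L * `|y - x|) by rewrite ler_pM ?gK ?fL.
lra.
Qed.

Lemma ln_ratio_is_derive (theta dtheta : R -> R) (a x : R) :
  0 < x -> 0 < theta x -> is_derive x 1 theta (dtheta x) ->
  is_derive x 1 (fun z => ln (theta z) - a * ln z) (dtheta x / theta x - a / x).
Proof.
move=> x0 tx0 dt.
have dln := is_derive1_ln x0.
have dlnt : is_derive x 1 (fun z => ln (theta z)) ((theta x)^-1 * dtheta x).
  by apply: is_derive1_comp; exact: is_derive1_ln.
apply: is_derive_eq; rewrite /GRing.scale/=; field.
by rewrite !gt_eqF.
Qed.

(** Replacing [x] by [Num.max x m] makes every coefficient constant below [m], so bounds and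
    Lipschitz constants on [[m, +oo[] become global. The relation [ht_elE] then holds by the choice
    of [el]; the content is that [el] is the derivative of [lam] above [l], and this is where the
    differential equation enters. *)
Lemma h_transform_exists (C D a l m eta : R) (theta dtheta : R -> R) :
  0 <= a -> a ^+ 2 = a + D -> 0 <= l -> l < m -> 0 < eta ->
  (forall x : R, 0 < x -> is_derive x 1 theta (dtheta x)) ->
  (forall x : R, 0 < x ->
    is_derive x 1 dtheta ((2 * C + D / x ^+ 2) * theta x)) ->
  (forall x : R, l < x -> 0 < theta x) ->
  exists K, h_transform C m eta K
    (fun x : R => a / Num.max x m)
    (fun x : R => dtheta (Num.max x m) / theta (Num.max x m) - a / Num.max x m)
    (fun x : R => 2 * C
      - (dtheta (Num.max x m) / theta (Num.max x m) - a / Num.max x m) ^+ 2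
      - 2 * (dtheta (Num.max x m) / theta (Num.max x m) - a / Num.max x m)
        * (a / Num.max x m))
    (fun x : R => ln (theta (Num.max x m)) - a * ln (Num.max x m)).
Proof.
move=> a0 aD l0 lm eta0 dt ddt t0.
have m0 : 0 < m by exact: le_lt_trans lm.
have pos x : l < x -> 0 < x by exact: le_lt_trans.
pose mu x := dtheta x / theta x; pose nu x := a / x.
pose lam x := mu x - nu x; pose el x := 2 * C - lam x ^+ 2 - 2 * lam x * nu x.
pose H x := ln (theta x) - a * ln x.
pose Q := 2 * `|C| + `|D| / m ^+ 2.
have m20 : 0 < m ^+ 2 by rewrite exprn_gt0.
have C2 : 0 <= 2 * `|C| := mulr_ge0 (ler0n R 2) (normr_ge0 C).
have Q0 : 0 <= Q := addr_ge0 C2 (divr_ge0 (normr_ge0 D) (ltW m20)).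
have sq x : m <= x -> x ^- 2 <= m ^- 2.
  by move=> mx; rewrite lef_pV2 ?posrE ?exprn_gt0 ?(lt_le_trans m0)//
    lerXn2r ?nnegrE ?(ltW m0) ?(le_trans (ltW m0)).
have ddQ x : m <= x -> `|(2 * C + D / x ^+ 2) * theta x| <= Q * theta x.
  move=> mx; have lx := lt_le_trans lm mx.
  rewrite normrM (gtr0_norm (t0 _ lx)) ler_wpM2r ?(ltW (t0 _ lx))//.
  apply: (le_trans (ler_normD _ _)); rewrite !normrM normfV.
  rewrite (ger0_norm (_ : 0 <= 2))// (ger0_norm (_ : 0 <= x ^+ 2)) ?sqr_ge0//.
  by rewrite lerD2l ler_wpM2l// sq.
have [k k0 muk] := log_derivative_bounded (fun z lz => dt z (pos z lz))
  (fun z lz => ddt z (pos z lz)) t0 lm Q0 ddQ.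
have nuk x : m <= x -> `|nu x| <= a / m.
  move=> mx; have x0 := lt_le_trans m0 mx.
  by rewrite (ger0_norm (divr_ge0 a0 (ltW x0))) ler_wpM2l// lef_pV2 ?posrE.
pose K0 := k + a / m.
have am0 : 0 <= a / m := divr_ge0 a0 (ltW m0).
have K00 : 0 <= K0 := addr_ge0 k0 am0.
have lamK x : m <= x -> `|lam x| <= K0.
  move=> mx; rewrite (le_trans (ler_normB _ _))// lerD//; [exact: muk|exact: nuk].
have nuK x : m <= x -> `|nu x| <= K0.
  by move=> mx; rewrite (le_trans (nuk _ mx))// lerDr.
have elK x : m <= x -> `|el x| <= 2 * `|C| + 3 * K0 ^+ 2.
  move=> mx; rewrite /el -addrA (le_trans (ler_normD _ _))//.
  rewrite normrM (ger0_norm (_ : 0 <= 2))// lerD2l -opprD normrN.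
  rewrite (le_trans (ler_normD _ _))// -mulrA (normrM 2) (ger0_norm (_ : 0 <= 2))//.
  have := ler_pM (normr_ge0 _) (normr_ge0 _) (lamK x mx) (lamK x mx).
  have := ler_pM (normr_ge0 _) (normr_ge0 _) (lamK x mx) (nuK x mx).
  rewrite -!normrM -!expr2; lra.
have dH z : l < z -> is_derive z 1 H (lam z).
  by move=> lz; apply: ln_ratio_is_derive; [exact: pos|exact: t0|exact/dt/pos].
have dnu z : l < z -> is_derive z 1 nu (- (a / z ^+ 2)).
  move=> lz; have z0 : z != 0 by rewrite gt_eqF ?pos.
  have ? : is_derive z 1 (fun x : R => x^-1) (- z ^- 2 *: 1).
    exact: is_deriveV.
  rewrite /nu; apply: is_derive_eq; rewrite /GRing.scale/=; by field.
have dlam z : l < z -> is_derive z 1 lam (el z).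
  move=> lz; have z0 : z != 0 by rewrite gt_eqF ?pos.
  have t0z : theta z != 0 by rewrite gt_eqF ?t0.
  have ? := dnu _ lz; have ? := dt z (pos _ lz); have ? := ddt z (pos _ lz).
  have ? : is_derive z 1 (fun x : R => (theta x)^-1) (- theta z ^- 2 *: dtheta z).
    exact: is_deriveV.
  rewrite /lam /mu; apply: is_derive_eq; rewrite /GRing.scale/= /el /lam /mu /nu.
  (* In [lam'] the terms in [1 / x ^ 2] add up to [(D + a) / x ^ 2], that is, to [nu ^ 2]; this
     completes [2 C - mu ^ 2] to [2 C - lam ^ 2 - 2 lam nu]. *)
  have -> : D = a ^+ 2 - a by rewrite aD; ring.
  by field; rewrite z0.
pose L := 2 * `|C| + 3 * K0 ^+ 2 + a / m ^+ 2.
have K02 : 0 <= 3 * K0 ^+ 2 := mulr_ge0 (ler0n R 3) (sqr_ge0 K0).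
have L0 : 0 <= L := addr_ge0 (addr_ge0 C2 K02) (divr_ge0 a0 (ltW m20)).
have nuL : forall x y, m <= x -> m <= y -> `|nu y - nu x| <= L * `|y - x|.
  apply: (derive_bound_lipschitz dnu lm) => z mz; rewrite normrN.
  rewrite (ger0_norm (divr_ge0 a0 (sqr_ge0 z))).
  have := ler_wpM2l a0 (sq _ mz); have := sqr_ge0 K0; have := normr_ge0 C.
  rewrite /L; lra.
have lamL : forall x y, m <= x -> m <= y -> `|lam y - lam x| <= L * `|y - x|.
  apply: (derive_bound_lipschitz dlam lm) => z mz.
  by rewrite (le_trans (elK _ mz))// lerDl (divr_ge0 a0 (ltW m20)).
have HL : forall x y, m <= x -> m <= y -> `|H y - H x| <= K0 * `|y - x|.
  exact: (derive_bound_lipschitz dH lm).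
have elL : forall x y, m <= x -> m <= y ->
    `|el y - el x| <= 6 * K0 * L * `|y - x|.
  move=> x y mx my.
  have h1 := normM_lipschitz K00 lamK lamK lamL lamL mx my.
  have h2 := normM_lipschitz K00 lamK nuK lamL nuL mx my.
  have -> : el y - el x = - (lam y * lam y - lam x * lam x)
      - 2 * (lam y * nu y - lam x * nu x) by rewrite /el; ring.
  apply: (le_trans (ler_normB _ _)); rewrite normrN normrM (ger0_norm (_ : 0 <= 2))//.
  lra.
have K6 : 0 <= 6 * K0 * L := mulr_ge0 (mulr_ge0 (ler0n R 6) K00) L0.
have tay := taylor2_bound dH dlam lm K6 elL.
pose E := 2 * `|C| + 3 * K0 ^+ 2.
have E0 : 0 <= E := addr_ge0 C2 K02.
pose T := 2 * K0 / eta ^+ 2 + E / (2 * eta).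
have T1 : 0 <= 2 * K0 / eta ^+ 2.
  exact: divr_ge0 (mulr_ge0 (ler0n R 2) K00) (sqr_ge0 eta).
have T2 : 0 <= E / (2 * eta).
  exact: divr_ge0 E0 (mulr_ge0 (ler0n R 2) (ltW eta0)).
have T0 : 0 <= T := addr_ge0 T1 T2.
pose K := 1 + `|C| + K0 + E + L + 6 * K0 * L + T.
have C0 := normr_ge0 C.
pose c x := Num.max x m.
have mc x : m <= c x by rewrite le_max lexx orbT.
have cL (f : R -> R) (M : R) : 0 <= M -> M <= K ->
    (forall x y, m <= x -> m <= y -> `|f y - f x| <= M * `|y - x|) ->
    forall x y, `|f (c y) - f (c x)| <= K * `|y - x|.
  move=> M0 MK fM x y; apply: (le_trans (fM _ _ (mc x) (mc y))).
  by rewrite ler_pM// max_dist.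
exists K; split.
- rewrite /K; lra.
- rewrite /K; lra.
- move=> x; apply: (le_trans (nuK _ (mc x))); rewrite /K; lra.
- move=> x; apply: (le_trans (lamK _ (mc x))); rewrite /K; lra.
- move=> x; apply: (le_trans (elK _ (mc x))); rewrite /K /E; lra.
- by move=> x; ring.
- by apply: (cL nu L) => //; rewrite /K; lra.
- by apply: (cL lam L) => //; rewrite /K; lra.
- by apply: (cL el (6 * K0 * L)) => //; rewrite /K; lra.
- by apply: (cL H K0) => //; rewrite /K; lra.
move=> x y mx.
have mx' : m <= x by lra.
have -> : Num.max x m = x by exact/max_idPl.
rewrite -/(mu x) -/(nu x) -/(lam x) -/(el x) -/(H x).
(* If the increment jumps below the cut-off, the Taylor expansion is lost, but then [|y| >= eta]:
   the terms linear and quadratic in [y] are dominated by [|y| ^ 3] after division by powers of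
   [eta], which explains [T]. *)
have [my|ym] := leP m (x + y).
  have := tay x (x + y) mx' my; rewrite (addrC x y) addrK addrC => /le_trans; apply.
  by rewrite ler_wpM2r ?exprn_ge0// /K; lra.
rewrite -/(H m).
have ny : `|y| = - y by rewrite ler0_norm//; lra.
have etay : eta <= `|y| by rewrite ny; lra.
have h1 : `|H m - H x| <= K0 * `|y|.
  apply: (le_trans (HL _ _ mx' (lexx m))); rewrite ler_wpM2l// ler0_norm ?subr_le0//.
  rewrite ny; lra.
have h2 : `|lam x * y| <= K0 * `|y| by rewrite normrM ler_wpM2r// lamK.
have h3 : `|el x * y ^+ 2 / 2| <= E / 2 * `|y| ^+ 2.
  have -> : el x * y ^+ 2 / 2 = el x / 2 * y ^+ 2 by field.
  rewrite (normrM _ (y ^+ 2)) (normrX 2) ler_wpM2r ?exprn_ge0//.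
  rewrite (normrM (el x)) (ger0_norm (_ : 0 <= 2^-1))//.
  by rewrite ler_wpM2r// elK.
have h4 : 2 * K0 * `|y| <= 2 * K0 / eta ^+ 2 * `|y| ^+ 3.
  have -> : 2 * K0 * `|y| = 2 * K0 / eta ^+ 2 * (eta ^+ 2 * `|y|).
    by field; rewrite gt_eqF.
  rewrite (ler_wpM2l T1)// (exprSr `|y| 2) ler_wpM2r//.
  by rewrite lerXn2r ?nnegrE// ltW.
have h5 : E / 2 * `|y| ^+ 2 <= E / (2 * eta) * `|y| ^+ 3.
  have -> : E / 2 * `|y| ^+ 2 = E / (2 * eta) * (eta * `|y| ^+ 2).
    by field; rewrite gt_eqF.
  by rewrite (ler_wpM2l T2)// (exprS `|y| 2) ler_wpM2r ?exprn_ge0.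
apply: (@le_trans _ _ (T * `|y| ^+ 3)).
  apply: (le_trans (ler_normB _ _)).
  apply: (le_trans (lerD (ler_normB _ _) (lexx _))).
  have := lerD h4 (le_trans h3 h5); rewrite -mulrDl -/T => h6.
  apply: le_trans h6; have := lerD h1 h2; lra.
by rewrite ler_wpM2r ?exprn_ge0// /K; lra.
Qed.

End h_transforms.

(** * Pathwise convergence of the schemes *)

Section path_estimates.
Local Set Implicit Arguments.
Local Unset Strict Implicit.
Variable R : realType.
Implicit Types (f x w : R -> R) (s t u : R).

Lemma within_continuous_dist f (A : set R) s e :
  {within A, continuous f} -> A s -> 0 < e ->
  exists2 d, 0 < d & forall t, A t -> `|t - s| < d -> `|f t - f s| < e.
Proof.
move=> /subspace_continuousP/(_ s) cf As e0.
have /cvgrPdist_lt/(_ e e0) := cf As.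
rewrite near_withinE => /nbhs_ballP[d/= d0 dP]; exists d => // t At ts.
by rewrite distrC; apply: dP => //=; rewrite /ball/= distrC.
Qed.

Lemma within_continuous_uniform f tau e :
  {within `[0, +oo[, continuous f} -> 0 < e ->
  exists2 d, 0 < d & forall s t, 0 <= s -> s <= tau -> 0 <= t -> t <= tau ->
    `|t - s| < d -> `|f t - f s| < e.
Proof.
move=> cf e0.
have /compact_near_coveringP/(_ _ (0^'+ : set_system R)
  (fun d s => forall t, 0 <= s -> 0 <= t -> `|t - s| < d -> `|f t - f s| < e))
  := @segment_compact R 0 tau.
move=> NC; case: (NC _); last first.
  move=> d /= d0 dP.
  exists (d / 2) => [|s t s0 st t0 tt ts]; first by rewrite divr_gt0.
  apply: (dP (d / 2)) => //=; rewrite ?divr_gt0//.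
    by rewrite distrC subr0 gtr0_norm ?divr_gt0// gtr_pMr// invf_lt1// ltr1n.
  by rewrite in_itv/= s0.
move=> s; rewrite /= in_itv/= => /andP[s0 _].
have e20 : 0 < e / 2 by rewrite divr_gt0.
have As : `[0, +oo[%classic s by rewrite /= in_itv/= s0.
have [d d0 dP] := within_continuous_dist cf As e20.
have d20 : 0 < d / 2 by rewrite divr_gt0.
exists (ball s (d / 2), [set r | r < d / 2]) => /=.
  split; first exact: nbhsx_ballx.
  exact: nbhs_right_lt.
move=> [s' r]/= [+ rd] t s'0 t0 tr; rewrite /ball/= => ss'.
have h1 : `|f t - f s| < e / 2.
  apply: dP; first by rewrite /= in_itv/= t0.
  rewrite (_ : t - s = (t - s') + (s' - s)); last by ring.
  rewrite (le_lt_trans (ler_normD _ _))// (splitr d) ltrD//.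
    exact: lt_trans rd.
  by rewrite distrC.
have h2 : `|f s' - f s| < e / 2.
  apply: dP; first by rewrite /= in_itv/= s'0.
  by rewrite distrC (lt_trans ss')// gtr_pMr// invf_lt1// ltr1n.
rewrite (_ : f t - f s' = (f t - f s) - (f s' - f s)); last by ring.
by rewrite (le_lt_trans (ler_normB _ _))// (splitr e) ltrD.
Qed.

Lemma Rintegral_dist_le (g : R -> R) s t c r : 0 <= s -> s <= t ->
  lebesgue_measure.-integrable `[0, t] (fun u => (g u)%:E) ->
  (forall u, s <= u -> u <= t -> `|g u - c| <= r) ->
  `|\int[lebesgue_measure]_(u in `[0, t]) g u
    - \int[lebesgue_measure]_(u in `[0, s]) g u - (t - s) * c| <= r * (t - s).
Proof.
move=> s0 st ig gr.
rewrite Rintegral_itvB ?bnd_simp//.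
have mI : measurable (`]s, t]%classic : set (measurableTypeR R)).
  exact: measurable_itv.
have ig' : lebesgue_measure.-integrable `]s, t] (EFin \o g).
  apply: integrableS ig => // u/=; rewrite !in_itv/= => /andP[su ->].
  by rewrite andbT (le_trans s0)// ltW.
have mst : lebesgue_measure (`]s, t]%classic : set R) = (t - s)%:E.
  rewrite lebesgue_measure_itv/= lte_fin; case: ltP => // ts.
  by have -> : s = t; [lra|rewrite subrr].
have ic k : lebesgue_measure.-integrable `]s, t] (EFin \o cst k).
  apply/integrableP; split; first by apply/measurable_EFinP; exact: measurable_cst.
  rewrite /= (integral_cst lebesgue_measure mI). by rewrite [X in (_ * X)%E]mst -EFinM ltry.
have -> : (t - s) * c = \int[lebesgue_measure]_(u in `]s, t]) c.
  by rewrite Rintegral_cst// [X in fine X]mst mulrC.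
have -> : r * (t - s) = \int[lebesgue_measure]_(u in `]s, t]) r.
  by rewrite Rintegral_cst// [X in fine X]mst.
rewrite -RintegralB//; last exact: ic.
have igc : lebesgue_measure.-integrable `]s, t] (EFin \o (fun u => g u - c)).
  have := integrableB mI ig' (ic c).
  by apply: eq_integrable => // u _; rewrite /= EFinB.
apply: (le_trans (le_normr_Rintegral _ igc)) => //.
apply: le_Rintegral => //; last 2 first.
- exact: ic.
- by move=> u/=; rewrite in_itv/= => /andP[su ut]; rewrite gr// ltW.
have := integrable_abse igc.
by apply: eq_integrable => // u _; rewrite /= abse_EFin.
Qed.

End path_estimates.

Section first_detection.
Local Set Implicit Arguments.
Local Unset Strict Implicit.
Variable R : realType.
Implicit Types (beta : nat -> R) (G : nat -> R -> R) (y : nat -> R).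

Lemma passage_value_never beta G y j k :
  (forall i, (k <= i)%N -> (i <= k + j)%N -> beta i < y i) ->
  passage_value beta G y j k = 0.
Proof.
elim: j k => [|j IH] k yi /=; rewrite leNgt yi ?leq_addr//=.
by apply: IH => i ki ij; apply: yi; [exact: ltnW|rewrite -addSnnS].
Qed.

Lemma passage_value_detected beta G y j k i0 :
  (k <= i0)%N -> (i0 <= k + j)%N -> y i0 <= beta i0 ->
  exists i, [/\ (k <= i)%N, (i <= i0)%N, y i <= beta i &
    passage_value beta G y j k = G i (y i)].
Proof.
elim: j k => [|j IH] k ki0 i0j yi0 /=.
  have ek : k = i0 by apply/eqP; rewrite eqn_leq ki0 -(addn0 k).
  by exists k; rewrite ek yi0 leqnn; split.
have [yk|ky] := leP (y k) (beta k); first by exists k; split.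
have ki0' : (k < i0)%N.
  rewrite ltn_neqAle ki0 andbT; apply: contraTneq yi0 => <-.
  by rewrite leNgt ky.
have [|i [ki ii0 yi ->]] := IH k.+1 ki0' _ yi0; first by rewrite addSnnS.
by exists i; split => //; exact: ltnW.
Qed.

(** The interval [[0, tau]] is cut into [n.+1] steps, so the mesh is well defined for [n = 0]
    too. *)
Definition mesh (tau : R) (n : nat) : R := tau / n.+1%:R.

Lemma mesh_gt0 tau n : 0 < tau -> 0 < mesh tau n.
Proof. by move=> t0; rewrite divr_gt0. Qed.

Lemma mesh_lt tau d : 0 < tau -> 0 < d ->
  exists N, forall n, (N <= n)%N -> mesh tau n < d.
Proof.
move=> t0 d0; exists (Num.bound (tau / d)) => n Nn.
rewrite /mesh ltr_pdivrMr// mulrC -ltr_pdivrMr//.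
rewrite (lt_le_trans (archi_boundP (divr_ge0 (ltW t0) (ltW d0))))//.
by rewrite ler_nat ltnW.
Qed.

Lemma mesh_mul tau n : n.+1%:R * mesh tau n = tau.
Proof. by rewrite /mesh mulrC divfK. Qed.

Lemma mesh_le tau n k : 0 < tau -> (k%:R * mesh tau n <= tau) = (k <= n.+1)%N.
Proof.
move=> t0; rewrite -[leRHS](mesh_mul tau n) ler_pM2r ?mesh_gt0//.
by rewrite ler_nat.
Qed.

End first_detection.

Section path_limits.
Local Set Implicit Arguments.
Local Unset Strict Implicit.
Variables (R : realType) (tau K x0 : R) (mu : R -> R) (x w : R -> R).
Variables (dr sg : nat -> R -> R) (N0 : nat).
Notation h := (mesh tau).
Hypotheses (tau0 : 0 < tau) (K0 : 0 < K).
Hypotheses (cx : {within `[0, +oo[, continuous x})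
  (cw : {within `[0, +oo[, continuous w}).
Hypothesis mu_lip : forall y z, `|mu z - mu y| <= K * `|z - y|.
Hypothesis dr_mu : forall n y, (N0 <= n)%N ->
  `|dr n y - h n * mu y| <= K * h n ^+ 2.
Hypothesis sg_1 : forall n y, (N0 <= n)%N -> `|sg n y - 1| <= K * h n.
Hypothesis xx0 : x 0 = x0.

(* On [[0, S]] the path [x] satisfies [dx = mu(x) dt + dw], in a form which
   needs no integral. *)
Definition drives (S : R) := forall s t r, 0 <= s -> s <= t -> t <= S ->
  (forall u, s <= u -> u <= t -> `|x u - x s| <= r) ->
  `|x t - x s - (w t - w s) - (t - s) * mu (x s)| <= K * r * (t - s).

Definition scheme n k := euler x0 (dr n) (sg n)
  (fun i => w (i.+1%:R * h n) - w (i%:R * h n)) k.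

(** A discrete Gronwall estimate. One step multiplies the error by at most [1 + K h] and adds three
    local errors of size [K h r]: the drift increment of the scheme, its noise factor, and the
    oscillation of the drift along the true path. These account for the factor 3. *)
Lemma scheme_error S n r k : drives S -> S <= tau -> (N0 <= n)%N -> h n <= r ->
  (forall s t, 0 <= s -> s <= tau -> 0 <= t -> t <= tau -> `|t - s| <= h n ->
    `|x t - x s| <= r /\ `|w t - w s| <= r) ->
  k%:R * h n <= S ->
  `|scheme n k - x (k%:R * h n)| <= 3 * r * ((1 + K * h n) ^+ k - 1).
Proof.
move=> drS St Nn hr osc; have h0 := mesh_gt0 n tau0.
elim: k => [|k IH] kS; first by rewrite mul0r /= xx0 !subrr mulr0 normr0.
set s := k%:R * h n; set t := k.+1%:R * h n in kS *.
have ts : t - s = h n by rewrite /t /s -addn1 natrD; ring.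
have s0 : 0 <= s by rewrite mulr_ge0// ltW.
have st : s <= t by rewrite -subr_ge0 ts ltW.
have {}IH := IH (le_trans st kS); rewrite -/s in IH.
have tt := le_trans kS St; have stau := le_trans st tt.
have t0 := le_trans s0 st.
have osc' u : s <= u -> u <= t -> `|x u - x s| <= r /\ `|w u - w s| <= r.
  move=> su ut; apply: osc => //; [exact: le_trans su|exact: le_trans tt|].
  by rewrite ger0_norm ?subr_ge0// -ts lerD2r.
have := drS s t r s0 st kS (fun u su ut => (osc' u su ut).1).
rewrite ts => D1.
have D2 := dr_mu (scheme n k) Nn.
have [_ ow] := osc' t st (lexx t).
have D3 : `|(sg n (scheme n k) - 1) * (w t - w s)| <= K * h n * r.
  by rewrite normrM ler_pM ?sg_1.
have D4 := mu_lip (x s) (scheme n k).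
set e := scheme n k - x s in IH D4.
have -> : scheme n k.+1 - x t = e + (dr n (scheme n k) - h n * mu (scheme n k))
    + (sg n (scheme n k) - 1) * (w t - w s)
    + h n * (mu (scheme n k) - mu (x s))
    - (x t - x s - (w t - w s) - h n * mu (x s)).
  by rewrite /e /scheme/= -/(scheme n k) -/t -/s; ring.
have D5 : `|h n * (mu (scheme n k) - mu (x s))| <= h n * (K * `|e|).
  by rewrite normrM (gtr0_norm h0) ler_wpM2l// ltW.
apply: (le_trans (ler_normB _ _)).
apply: (le_trans (lerD (ler_normD _ _) (lexx _))).
apply: (le_trans (lerD (lerD (ler_normD _ _) (lexx _)) (lexx _))).
apply: (le_trans (lerD (lerD (lerD (ler_normD _ _) (lexx _)) (lexx _)) (lexx _))).
have Kh0 : 0 < K * h n by rewrite mulr_gt0.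
have D6 : K * h n ^+ 2 <= K * h n * r.
  by rewrite expr2 mulrA ler_wpM2l// ltW.
have D7 : (1 + K * h n) * `|e| <=
    (1 + K * h n) * (3 * r * ((1 + K * h n) ^+ k - 1)).
  by rewrite ler_wpM2l// addr_ge0// ltW.
rewrite exprS.
move: D1 D2 D3 D5 D6 D7; move: ((1 + K * h n) ^+ k) => q.
nra.
Qed.

Lemma scheme_cvg S e : drives S -> S <= tau -> 0 < e ->
  exists N, forall n k, (N <= n)%N -> k%:R * h n <= S ->
    `|scheme n k - x (k%:R * h n)| <= e.
Proof.
(* [(1 + K h) ^ k <= exp (K tau)] uniformly in the grid points, so an oscillation of [r] per step
   yields a total error of at most [e]. *)
move=> drS St e0; pose r := e / (3 * expR (K * tau)).
have E0 := expR_gt0 (K * tau).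
have r0 : 0 < r by rewrite divr_gt0// mulr_gt0.
have [d1 d10 d1P] := within_continuous_uniform tau cx r0.
have [d2 d20 d2P] := within_continuous_uniform tau cw r0.
have [N1 N1P] := mesh_lt tau0 d10.
have [N2 N2P] := mesh_lt tau0 d20.
have [N3 N3P] := mesh_lt tau0 r0.
exists (maxn N0 (maxn N1 (maxn N2 N3))) => n k.
rewrite !geq_max => /and4P[n0 n1 n2 n3] kS.
have h0 := mesh_gt0 n tau0.
have := @scheme_error S n r k drS St n0 (ltW (N3P _ n3)) _ kS.
have osc s t : 0 <= s -> s <= tau -> 0 <= t -> t <= tau -> `|t - s| <= h n ->
    `|x t - x s| <= r /\ `|w t - w s| <= r.
  move=> s0 st t0 tt ts; split; apply: ltW.
    by apply: d1P => //; exact: le_lt_trans (N1P _ n1).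
  by apply: d2P => //; exact: le_lt_trans (N2P _ n2).
move=> /(_ osc)/le_trans; apply.
have q : (1 + K * h n) ^+ k <= expR (K * tau).
  apply: (@le_trans _ _ (expR (K * h n) ^+ k)).
    rewrite lerXn2r ?nnegrE ?expR_ge0 ?expR_ge1Dx//.
    by rewrite addr_ge0// mulr_ge0// ltW.
  rewrite -expRM_natl ler_expR mulrCA ler_wpM2l ?(ltW K0)//.
  exact: le_trans St.
have -> : e = 3 * r * expR (K * tau).
  by rewrite /r; field; rewrite gt_eqF.
rewrite ler_wpM2l; first by lra.
  by rewrite mulr_ge0// ltW.
by lra.
Qed.

Variables (b : R -> R) (C : R) (H : R -> R).
Hypothesis cb : {within `[0, +oo[, continuous b}.
Hypothesis H_lip : forall y z, `|H z - H y| <= K * `|z - y|.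

(* The margin [eps] makes detection insensitive to the uniform error of the
   scheme; it is removed after the mesh has gone to [0]. *)
Definition detected_weight (n : nat) (eps : R) :=
  passage_value (fun k => b (k%:R * h n) + eps)
    (martingale_weight (h n) C H x0) (scheme n) n.+1 0.

Lemma gap_bounded_below a : 0 <= a ->
  (forall s, 0 <= s -> s <= a -> b s < x s) ->
  exists2 c, 0 < c & forall s, 0 <= s -> s <= a -> c <= x s - b s.
Proof.
move=> a0 bx.
have cp0 : {within `[0, +oo[, continuous (fun s => x s - b s)}.
  by move=> s; apply: (@cvgB _ R^o); [exact: cx|exact: cb].
have sub : `[0, a]%classic `<=` (`[0, +oo[%classic : set R).
  by move=> s/=; rewrite !in_itv/= andbT => /andP[].
have cp := continuous_subspaceW sub cp0.
have [c + cP] := EVT_min a0 cp.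
rewrite in_itv/= => /andP[c0 ca]; exists (x c - b c); first by rewrite subr_gt0 bx.
by move=> s s0 sa; apply: cP; rewrite in_itv/= s0.
Qed.

(** By compactness the path keeps a distance [c] from the boundary. Raising the boundary by [eps]
    and an error [eps / 2] of the scheme consume less than [c], since [3 eps < c]. *)
Lemma detected_weight_never : drives tau ->
  (forall s, 0 <= s -> s <= tau -> b s < x s) ->
  exists2 e0, 0 < e0 & forall eps, 0 < eps -> eps < e0 ->
    exists N, forall n, (N <= n)%N -> detected_weight n eps = 0.
Proof.
move=> drS bx; have [c c0 cP] := gap_bounded_below (ltW tau0) bx.
exists (c / 3); first by rewrite divr_gt0.
move=> eps eps0 epsc.
have eps2 : 0 < eps / 2 by rewrite divr_gt0.
have [N NP] := scheme_cvg drS (lexx tau) eps2.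
exists N => n Nn; apply: passage_value_never => k _ kn; rewrite add0n in kn.
have kt : k%:R * h n <= tau by rewrite mesh_le.
have s0 : 0 <= k%:R * h n by rewrite mulr_ge0// ltW// mesh_gt0.
have := NP n k Nn kt; rewrite ler_norml => /andP[+ _].
by have := cP _ s0 kt; lra.
Qed.

(** Detection is neither late nor early. At the last grid point before [T], path and boundary have
    each moved by less than [eps / 4] and the scheme errs by [eps / 2], so the raised boundary is
    reached. Before [T - dl] the gap exceeds [3 eps], so it is not. The weight is thus read near [T]
    and near [x T]. *)
Lemma detected_weight_hit T eta : drives T -> 0 < T -> T <= tau ->
  x T <= b T -> (forall s, 0 <= s -> s < T -> b s < x s) -> 0 < eta ->
  exists2 e0, 0 < e0 & forall eps, 0 < eps -> eps < e0 ->
    exists N, forall n, (N <= n)%N ->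
      `|detected_weight n eps - expR (- C * T + (H (x T) - H x0))| <= eta.
Proof.
move=> drT T0 Tt xT bx eta0.
set u0 := - C * T + _.
have [zeta zeta0 zetaP] : exists2 zeta, 0 < zeta &
    forall u, `|u - u0| < zeta -> `|expR u - expR u0| < eta.
  have /cvgrPdist_lt/(_ _ eta0)/nbhs_ballP[z/= z0 zP] := @continuous_expR R u0.
  by exists z => // u uz; rewrite distrC; apply: zP; rewrite /ball/= distrC.
(* [e1] is the common tolerance for the detection time and the detected position: the exponent then
   moves by at most [(|C| + K) e1 < zeta]. *)
pose e1 := zeta / (2 * (`|C| + K + 1)).
have M0 : 0 < `|C| + K + 1 by rewrite -addrA ltr_wpDl// addr_gt0.
have e10 : 0 < e1 by rewrite divr_gt0// mulr_gt0.
have e1z : (`|C| + K) * e1 < zeta.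
  have : (`|C| + K + 1) * e1 = zeta / 2 by rewrite /e1; field; rewrite gt_eqF.
  lra.
have e12 : 0 < e1 / 2 by rewrite divr_gt0.
have [d d0 dP] := within_continuous_uniform tau cx e12.
pose dl := Num.min e1 d / 2.
have dl0 : 0 < dl by rewrite divr_gt0// lt_min e10.
have dl1 : dl < e1.
  have : dl <= e1 / 2 by rewrite ler_wpM2r// ge_min lexx.
  lra.
have dld : dl < d.
  have : dl <= d / 2 by rewrite ler_wpM2r// ge_min lexx orbT.
  lra.
have [c c0 cP] : exists2 c, 0 < c &
    forall s, 0 <= s -> s <= T - dl -> c <= x s - b s.
  have [Td|Td] := leP 0 (T - dl).
    have [s s0 sT|c c0 cP] := gap_bounded_below Td; last by exists c.
    by apply: bx => //; lra.
  (* If [T < dl] there is no time in question, and any positive gap will do. *)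
  by exists 1 => // s s0 sT; lra.
exists (Num.min e1 (c / 3)); first by rewrite lt_min e10 divr_gt0.
move=> eps eps0; rewrite lt_min => /andP[epse epsc].
have eps2 : 0 < eps / 2 by rewrite divr_gt0.
have [N1 N1P] := scheme_cvg drT Tt eps2.
have eps4 : 0 < eps / 4 by rewrite divr_gt0.
have [dx dx0 dxP] := within_continuous_uniform tau cx eps4.
have [db db0 dbP] := within_continuous_uniform tau cb eps4.
have [N2 N2P] := mesh_lt tau0 dx0.
have [N3 N3P] := mesh_lt tau0 db0.
exists (maxn N1 (maxn N2 N3)) => n; rewrite !geq_max => /and3P[n1 n2 n3].
have h0 := mesh_gt0 n tau0.
have T_0 := ltW T0.
(* The last grid point not after [T]: beyond [T] the path is not known to follow the drift [mu], so
   the scheme is not controlled there. *)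
pose k0 := Num.truncn (T / h n).
have Th : 0 <= T / h n by rewrite divr_ge0// ltW.
have [k0T Tk0] : k0%:R * h n <= T /\ T < k0.+1%:R * h n.
  have := truncn_itv Th => /andP[a1 a2].
  by rewrite -ler_pdivlMr// -ltr_pdivrMr.
have s00 : 0 <= k0%:R * h n by rewrite mulr_ge0// ltW.
have Tk : T - k0%:R * h n <= h n.
  move: Tk0; rewrite -addn1 natrD mulrDl mul1r; lra.
have k0n : (k0 <= n.+1)%N by rewrite -(mesh_le n k0 tau0) (le_trans k0T).
have yk0 : scheme n k0 <= b (k0%:R * h n) + eps.
  have a1 := N1P n k0 n1 k0T.
  have dist s : s < `|T - k0%:R * h n| -> s < h n.
    by move=> /lt_le_trans; apply; rewrite ger0_norm ?subr_ge0.
  have dT e : h n < e -> `|T - k0%:R * h n| < e.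
    by apply: le_lt_trans; rewrite ger0_norm ?subr_ge0.
  have a2 := dxP _ _ s00 (le_trans k0T Tt) T_0 Tt (dT _ (N2P _ n2)).
  have a3 := dbP _ _ s00 (le_trans k0T Tt) T_0 Tt (dT _ (N3P _ n3)).
  move: a1 a2 a3; rewrite !ltr_norml ler_norml.
  move=> /andP[_ a1] /andP[a2 _] /andP[_ a3].
  lra.
rewrite /detected_weight.
have [k [_ kk0 yk ->]] := @passage_value_detected _
  (fun k => b (k%:R * h n) + eps) (martingale_weight (h n) C H x0) _ _ _ _
  (leq0n k0) k0n yk0.
have kT : k%:R * h n <= T.
  by rewrite (le_trans _ k0T)// ler_wpM2r ?ler_nat// ltW.
have s0 : 0 <= k%:R * h n by rewrite mulr_ge0// ltW.
have a1 := N1P n k n1 kT; rewrite ler_norml in a1; case/andP: a1 => a1 a1'.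
have Tkd : T - dl < k%:R * h n.
  rewrite ltNge; apply/negP => kd; have := cP _ s0 kd; lra.
have a4 : `|T - k%:R * h n| < d by rewrite ger0_norm ?subr_ge0//; lra.
have a5 := dP _ _ s0 (le_trans kT Tt) T_0 Tt a4.
rewrite ltr_norml in a5; case/andP: a5 => a5 a5'.
apply/ltW/zetaP; rewrite /u0.
have -> : - C * (k%:R * h n) + (H (scheme n k) - H x0) - (- C * T + (H (x T) - H x0))
  = C * (T - k%:R * h n) + (H (scheme n k) - H (x T)) by ring.
apply: le_lt_trans e1z; apply: (le_trans (ler_normD _ _)); rewrite mulrDl lerD//.
  by rewrite normrM ler_wpM2l// ger0_norm ?subr_ge0//; lra.
apply: (le_trans (H_lip _ _)); rewrite ler_wpM2l ?(ltW K0)// ler_norml.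
by apply/andP; split; lra.
Qed.

End path_limits.

(** * The double limit *)

Section iterated_limit.
Local Set Implicit Arguments.
Local Unset Strict Implicit.
Context d (T : measurableType d) (R : realType) (P : probability T R).

Lemma nonincreasing_lt (A : nat -> set T) (e : R) :
  (forall n, measurable (A n)) -> {homo A : n m / (n <= m)%N >-> m `<=` n} ->
  (P (\bigcap_n A n) < e%:E)%E -> exists N, (P (A N) < e%:E)%E.
Proof.
move=> mA dA Ae.
have mI : measurable (\bigcap_n A n) by exact: bigcap_measurable.
have cvA : P \o A @ \oo --> P (\bigcap_n A n).
  apply: nonincreasing_cvg_mu => //.
    exact: le_lt_trans (probability_le1 P (mA 0)) (ltry _).
  by move=> n m nm; apply/subsetPset/dA.
have [N _ NP] := cvA _ (open_ereal_lt' Ae).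
by exists N; exact: NP (leqnn N).
Qed.

Variables (V : nat -> nat -> T -> R) (V0 : T -> R) (c : R).
Hypotheses (mV : forall j n, measurable_fun setT (V j n))
  (mV0 : measurable_fun setT V0) (Vc : forall j n w, `|V j n w - V0 w| <= c).
Hypothesis V_lim : {ae P, forall w, forall e, 0 < e ->
  exists J, forall j, (J <= j)%N -> exists N, forall n, (N <= n)%N ->
    `|V j n w - V0 w| <= e}.

(** The thresholds of [V_lim] depend on the path. They are made uniform off a set of probability
    below [e] by continuity from above, once for [j] and then, with [j] fixed, once for [n]. The
    bound [c] controls the exceptional set, and [e + c e = eta]. *)
Lemma iterated_bounded_convergence (eta : R) : 0 < eta ->
  exists J, forall j, (J <= j)%N -> exists N, forall n, (N <= n)%N ->
    (\int[P]_w `|V j n w - V0 w|%:E <= eta%:E)%E.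
Proof.
move=> eta0.
have c0 : 0 <= c := le_trans (normr_ge0 _) (Vc 0 0 point).
have c1 : 0 < 1 + c by lra.
pose e := eta / (1 + c); have e0 : 0 < e by rewrite divr_gt0.
have mD j n : measurable_fun setT (fun w => `|V j n w - V0 w|).
  by apply: measurableT_comp => //; exact: measurable_funB.
pose D j n := [set w | e < `|V j n w - V0 w|].
have mDs j n : measurable (D j n).
  have := mD j n measurableT _ (measurable_itv `]e, +oo[).
  by rewrite setTI; congr measurable; apply/seteqP; split=> w/=;
    rewrite in_itv/= andbT.
pose B j N := \bigcup_(n in [set n | (N <= n)%N]) D j n.
have mB j N : measurable (B j N) by exact: bigcup_measurable.
pose BI j := \bigcap_N B j N.
have mBI j : measurable (BI j) by exact: bigcap_measurable.
(* The intersection of all [L J] consists of the paths that, for arbitrarily large [j], deviate by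
   more than [e] for infinitely many [n]; [V_lim] makes it null. *)
pose L J := \bigcup_(j in [set j | (J <= j)%N]) BI j.
have mL J : measurable (L J) by exact: bigcup_measurable.
have L0 : P (\bigcap_J L J) = 0%E.
  have [A [mA PA0 subA]] := V_lim.
  apply/eqP; rewrite -measure_le0 -PA0; apply: le_measure.
  - by rewrite inE; exact: bigcap_measurable.
  - by rewrite inE.
  move=> w Lw; apply: subA => /= /(_ e e0)[J JP].
  have [j /= Jj Bw] := Lw J I.
  have [N NP] := JP j Jj.
  have [n /= Nn] := Bw N I.
  by rewrite /D/= ltNge NP.
have [|||J PJ] := @nonincreasing_lt L e => //.
- by move=> n m nm w [j /= mj Bj]; exists j => //=; exact: leq_trans mj.
- by rewrite L0 lte_fin.
exists J => j Jj.
have PBI : (P (BI j) < e%:E)%E.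
  apply: le_lt_trans PJ; apply: le_measure; rewrite ?inE//.
  by move=> w Bw; exists j.
have [|||N PN] := @nonincreasing_lt (B j) e => //.
  by move=> n m nm w [k /= mk Dk]; exists k => //=; exact: leq_trans mk.
exists N => n Nn.
apply: (@le_trans _ _ (\int[P]_w (e%:E + c%:E * (\1_(D j n) w)%:E))%E).
  apply: ge0_le_integral => //.
  - by apply/measurable_EFinP; exact: mD.
  - apply: emeasurable_funD => //; apply: measurable_funeM.
    by apply/measurable_EFinP; exact: measurable_indic.
  - move=> w _; rewrite -EFinM -EFinD lee_fin indicE.
    have [|] := boolP (w \in D j n); first by rewrite mulr1 => _; have := Vc j n w; lra.
    by rewrite notin_setE /D/= => /negP; rewrite -leNgt mulr0 addr0.
have mI : measurable_fun setT (fun w => (\1_(D j n) w : R)%:E).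
  by apply/measurable_EFinP; exact: measurable_indic.
rewrite ge0_integralD//; try by [exact: measurable_funeM
  | move=> w _; rewrite lee_fin ltW | move=> w _; rewrite mule_ge0// lee_fin].
rewrite integral_probability_cst ge0_integralZl//;
  try by [rewrite lee_fin | move=> w _; rewrite lee_fin].
rewrite integral_indic// setIT.
have PD : (P (D j n) <= e%:E)%E.
  apply: le_trans (ltW PN); apply: le_measure; rewrite ?inE//.
  by move=> w Dw; exists n.
apply: (@le_trans _ _ (e%:E + c%:E * e%:E)%E).
  by rewrite leeD2l// lee_wpmul2l.
rewrite -EFinM -EFinD lee_fin.
have -> : eta = e * (1 + c) by rewrite /e divfK// gt_eqF.
lra.
Qed.

End iterated_limit.

(** * First passage times *)

Section first_passage_time.
Local Set Implicit Arguments.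
Local Unset Strict Implicit.
Variables (R : realType) (Omega : Type) (X : R -> Omega -> R) (b : R -> R).
Hypotheses (cX : continuous_process X) (cb : {within `[0, +oo[, continuous b}).

Lemma gap_continuous w : {within `[0, +oo[, continuous (fun t => X t w - b t)}.
Proof. by move=> s; apply: (@cvgB _ R^o); [exact: cX|exact: cb]. Qed.

Lemma first_passage_ge0 w : (0 <= first_passage X b w)%E.
Proof.
by apply: le_ereal_inf_tmp => _ [t [t0 _] <-]; rewrite lee_fin.
Qed.

Lemma first_passage_hit w t : first_passage X b w = t%:E ->
  [/\ 0 <= t, X t w <= b t & forall s, 0 <= s -> s < t -> b s < X s w].
Proof.
move=> Tt; have t0 : 0 <= t by rewrite -lee_fin -Tt first_passage_ge0.
split => //; last first.
  move=> s s0 st; rewrite ltNge; apply/negP => Xs.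
  have : (first_passage X b w <= s%:E)%E.
    by apply: ereal_inf_lbound; exists s.
  by rewrite Tt lee_fin leNgt st.
rewrite leNgt; apply/negP => bX.
have p0 : 0 < X t w - b t by rewrite subr_gt0.
have At : `[0, +oo[%classic t by rewrite /= in_itv/= t0.
have [e e0 eP] := within_continuous_dist (@gap_continuous w) At p0.
have /ereal_inf_lt[_ [s [s0 Xs] <-]] : (first_passage X b w < (t + e)%:E)%E.
  by rewrite Tt lte_fin ltrDl.
rewrite lte_fin => st.
have ts : t <= s.
  by rewrite -lee_fin -Tt; apply: ereal_inf_lbound; exists s.
have /(_ _) := eP s; rewrite /= in_itv/= s0 => /(_ isT).
rewrite ger0_norm ?subr_ge0// => /(_ _).
have se : s - t < e by lra.
by move=> /(_ se); rewrite ltr_norml => /andP[+ _]; lra.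
Qed.

Lemma first_passage_leP w r :
  (first_passage X b w <= r%:E)%E <->
  exists s, [/\ 0 <= s, s <= r & X s w <= b s].
Proof.
split=> [Tr|[s [s0 sr Xs]]]; last first.
  by apply: ge_ereal_inf; exists s%:E; [exists s|rewrite lee_fin].
have T0 := first_passage_ge0 w.
have [t Tt] : exists t, first_passage X b w = t%:E.
  by case: (first_passage X b w) T0 Tr => // t _ _; exists t.
have [t0 Xt _] := first_passage_hit Tt.
by exists t; split => //; rewrite -lee_fin -Tt.
Qed.

End first_passage_time.

(** A passage up to time [r] means that the minimum of the gap over the compact interval [[0, r]] is
    nonpositive. By continuity this is the same as the gap falling below every [1 / (j + 1)] at
    suitable times of a countable set. *)
Lemma measurable_first_passage d (Omega : measurableType d) (R : realType)
    (X : R -> Omega -> R) (b : R -> R) :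
  continuous_process X -> {within `[0, +oo[, continuous b} ->
  (forall t, 0 <= t -> measurable_fun setT (X t)) ->
  measurable_fun setT (first_passage X b).
Proof.
move=> cX cb mX.
apply: (measurability _ (ErealGenOInfty.measurableE R)) => // _ [_ [r ->] <-].
rewrite setTI.
have -> : first_passage X b @^-1` `]r%:E, +oo[ =
    ~` [set w | (first_passage X b w <= r%:E)%E].
  apply/seteqP; split => w/=; rewrite in_itv/= andbT ltNge.
    by move/negP.
  by move/negP.
apply: measurableC.
have [r0|r0] := ltP r 0.
  rewrite (_ : mkset _ = set0)//; apply/seteqP; split=> w//=.
  have := first_passage_ge0 X b w => /le_trans h /h.
  by rewrite lee_fin leNgt r0.
(* Rational times are clamped to [[0, r]]: the endpoint [r] may be irrational and be the only
   passage, and negative times carry no information. *)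
pose cl (q : rat) : R := Num.min (Num.max (ratr q) 0) r.
have cl0 q : 0 <= cl q by rewrite le_min r0 le_max lexx orbT.
have clr q : cl q <= r by rewrite ge_min lexx orbT.
have cl_dist (s : R) q : 0 <= s -> s <= r -> `|cl q - s| <= `|ratr q - s|.
  move=> s0 sr; rewrite /cl.
  have [a|a] := leP (ratr q) 0; have [c|c] := leP r _.
  - by rewrite !ler0_norm; lra.
  - by rewrite !ler0_norm; lra.
  - by rewrite !ger0_norm; lra.
  - by [].
rewrite (_ : mkset _ = \bigcap_j \bigcup_q
    [set w | X (cl q) w - b (cl q) < j.+1%:R^-1]); last first.
  apply/seteqP; split=> w /=.
    move=> /(first_passage_leP cX cb)[s [s0 sr Xs]] j _.
    have j0 : 0 < j.+1%:R^-1 :> R by rewrite invr_gt0.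
    have As : `[0, +oo[%classic s by rewrite /= in_itv/= s0.
    have [e e0 eP] := within_continuous_dist (@gap_continuous _ _ _ _ cX cb w) As j0.
    have /rat_in_itvoo[q] : s < s + e by rewrite ltrDl.
    rewrite in_itv/= => /andP[sq qs]; exists q => //=.
    have := eP (cl q); rewrite /= in_itv/= cl0 => /(_ isT).
    have cs : `|cl q - s| < e.
      rewrite (le_lt_trans (cl_dist _ q s0 sr))//.
      by rewrite ger0_norm ?subr_ge0 ?(ltW sq)// ltrBlDl.
    move=> /(_ cs); rewrite ltr_norml => /andP[_].
    by rewrite ltrBlDl => /lt_le_trans; apply; rewrite gerDr subr_le0.
  move=> Xq; apply/(first_passage_leP cX cb).
  have sub : `[0, r]%classic `<=` (`[0, +oo[%classic : set R).
    by move=> s/=; rewrite !in_itv/= andbT => /andP[].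
  have := continuous_subspaceW sub (@gap_continuous _ _ _ _ cX cb w).
  move=> /(EVT_min r0)[s]; rewrite in_itv/= => /andP[s0 sr] smin.
  exists s; split => //; rewrite -subr_le0 leNgt; apply/negP => p0.
  have [j jp] : exists j, j.+1%:R^-1 < X s w - b s.
    exists (Num.bound (X s w - b s)^-1); rewrite invf_plt ?posrE//.
    apply: lt_trans (archi_boundP _) _; first by rewrite invr_ge0 ltW.
    by rewrite ltr_nat.
  have [q _ /=] := Xq j I.
  have := smin (cl q); rewrite in_itv/= cl0 clr => /(_ isT) h1 h2.
  by have := lt_trans (le_lt_trans h1 h2) jp; rewrite ltxx.
apply: bigcap_measurable => // j _.
apply: bigcupT_measurable_rat => q.
have := mX _ (cl0 q) measurableT _ (measurable_itv `]-oo, b (cl q) + j.+1%:R^-1[).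
rewrite setTI; congr measurable; by apply/seteqP; split=> w/=;
  rewrite in_itv/= ltrBlDl.
Qed.

(** * Convergence of the detected weights for a solution of the equation *)

Section stopped_process.
Local Set Implicit Arguments.
Local Unset Strict Implicit.
Context (R : realType) d (Omega : measurableType d) (P : probability Omega R).
Variables (F : R -> set (set Omega)) (W X : R -> Omega -> R).
Variables (tau K m B U x0 C : R) (mu f H b : R -> R).
Variables (dr sg : nat -> R -> R) (N0 : nat).
Notation h := (mesh tau).
Hypotheses (tau0 : 0 < tau) (K0 : 0 < K).
Hypotheses (hF : filtration F) (hW : brownian_motion P F W).
Hypotheses (aX : adapted F X) (cX : continuous_process X).
Hypothesis eqX : {ae P, forall w, forall t : R, 0 <= t ->
  lebesgue_measure.-integrable `[0, t] (fun s => (f (X s w))%:E) /\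
  X t w = x0 + \int[lebesgue_measure]_(s in `[0, t]) f (X s w) + W t w}.
Hypothesis f_mu : forall y, m <= y -> f y = mu y.
Hypothesis mu_lip : forall y z, `|mu z - mu y| <= K * `|z - y|.
Hypothesis dr_mu : forall n y, (N0 <= n)%N ->
  `|dr n y - h n * mu y| <= K * h n ^+ 2.
Hypothesis sg_1 : forall n y, (N0 <= n)%N -> `|sg n y - 1| <= K * h n.
Hypothesis H_lip : forall y z, `|H z - H y| <= K * `|z - y|.
Hypothesis H_ub : forall y, y <= B + 1 -> H y - H x0 <= U.
Hypotheses (mdr : forall n, measurable_fun setT (dr n))
  (msg : forall n, measurable_fun setT (sg n)) (mH : measurable_fun setT H).
Hypothesis cb : {within `[0, +oo[, continuous b}.
Hypotheses (bm : forall t, 0 <= t -> m <= b t) (bB : forall t, 0 <= t -> b t <= B).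
Hypothesis bx0 : b 0 < x0.

Let cW : continuous_process W. Proof. by case: hW. Qed.

Let beta (n : nat) (eps : R) (k : nat) := b (k%:R * h n) + eps.
Let wt n := martingale_weight (h n) C H x0.
Let bnd (n k : nat) := expR (`|C| * (k%:R * h n) + U).
Let Fk n k := F (k%:R * h n).
Let xi n k w := W (k.+1%:R * h n) w - W (k%:R * h n) w.

Let h0 n : 0 < h n. Proof. exact: mesh_gt0. Qed.

Let kh0 n k : 0 <= k%:R * h n. Proof. by rewrite mulr_ge0// ltW. Qed.

Let kh_mono n k : k%:R * h n <= k.+1%:R * h n.
Proof. by rewrite ler_wpM2r ?ler_nat// ltW. Qed.

Let wt0 n k x : 0 <= wt n k x. Proof. exact: expR_ge0. Qed.

Let mwt n k : measurable_fun setT (wt n k).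
Proof. exact: measurable_martingale_weight. Qed.

Let wt_bnd n eps k x : eps <= 1 -> x <= beta n eps k -> wt n k x <= bnd n k.
Proof.
move=> eps1 xb; rewrite ler_expR lerD//; last first.
  by apply: H_ub; rewrite (le_trans xb)// lerD// bB.
by rewrite ler_wpM2r// -normrN ler_norm.
Qed.

Let bnd0 n k : 0 <= bnd n k. Proof. exact: expR_ge0. Qed.

Let bnd_mono n : {homo bnd n : i j / (i <= j)%N >-> i <= j}.
Proof.
move=> i j ij; rewrite ler_expR lerD2r ler_wpM2l// ler_wpM2r ?ler_nat//.
exact: ltW.
Qed.

Let sF n k : sigma_algebra setT (Fk n k).
Proof. by have [sF _ _] := hF; exact: sF. Qed.

Let Fm n k : Fk n k `<=` measurable.
Proof. by have [_ Fm _] := hF; exact: Fm. Qed.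

Let F_mono n k : Fk n k `<=` Fk n k.+1.
Proof. by have [_ _ Fmo] := hF; exact: Fmo. Qed.

Let xiF n k : measurable_wrt (Fk n k.+1) (xi n k).
Proof.
have [aW _ _ _ _] := hW.
apply/(measurable_wrtP (sF n k.+1)); apply: measurable_funB.
  by apply/(measurable_wrtP (sF n k.+1)) => A mA; exact: aW.
by apply/(measurable_wrtP (sF n k.+1)) => A mA; apply/F_mono/aW.
Qed.

Let indep n k A A' : Fk n k A -> measurable A' ->
  (P (A `&` xi n k @^-1` A') = P A * normal_prob 0 (Num.sqrt (h n)) A')%E.
Proof.
move=> FA mA'; have [_ _ _ W_law W_indep] := hW.
have lt : k%:R * h n < k.+1%:R * h n by rewrite ltr_pM2r ?ltr_nat.
have hE : k.+1%:R * h n - k%:R * h n = h n by rewrite -addn1 natrD; ring.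
have := W_indep _ _ (kh0 n k) lt A A' FA mA'.
by rewrite (W_law _ _ (kh0 n k) lt _ mA') hE => ->.
Qed.

Let V eps n w := detected_weight tau x0 (W ^~ w) dr sg b C H n eps.
Let c := expR (`|C| * tau + U).

(** A detection occurs at a position below [b + eps <= B + 1], where [H_ub] bounds the weight from
    above; this is why the margin is kept at most 1. *)
Lemma detected_weight_props eps n : eps <= 1 ->
  [/\ measurable_fun setT (V eps n), forall w, 0 <= V eps n w
    & forall w, V eps n w <= c].
Proof.
move=> eps1.
have [mV V0 Vc] := @passage_value_props R (beta n eps) (wt n) (dr n) (sg n) (bnd n)
  (@mwt n) (mdr n) (msg n) (@wt0 n) (fun k x => @wt_bnd n eps k x eps1)
  (@bnd0 n) (@bnd_mono n) _ Omega (Fk n) (xi n) x0 (sF n) (@Fm n) (@F_mono n)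
  (@xiF n) n.+1 0.
split => // w; apply: (le_trans (Vc w)).
by rewrite /bnd addn0 mesh_mul.
Qed.

Lemma expectation_detected_weight eps n : eps <= 1 ->
  (\int[P]_w (V eps n w)%:E =
    (mean_passage_value (normal_prob 0 (Num.sqrt (h n)))
       (fun k => b (k%:R * h n) + eps) (martingale_weight (h n) C H x0)
       (dr n) (sg n) n.+1 0 x0)%:E)%E.
Proof.
move=> eps1.
exact: (@expectation_passage_value R (normal_prob 0 (Num.sqrt (h n)))
  (beta n eps) (wt n) (dr n) (sg n) (bnd n)
  (@mwt n) (mdr n) (msg n) (@wt0 n) (fun k x => @wt_bnd n eps k x eps1)
  (@bnd0 n) (@bnd_mono n) _ Omega P (Fk n) (xi n) x0 (sF n) (@Fm n) (@F_mono n)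
  (@xiF n) (@indep n) n.+1).
Qed.

Let T := first_passage X b.

(** [H] is taken at the boundary instead of at the stopped process: the two agree at a positive
    passage time, and measurability is then immediate. The maximum keeps the argument of [b] in [[0,
    +oo[], where [b] is continuous; on a passage time it changes nothing. *)
Definition passage_weight w :=
  if (T w <= tau%:E)%E then
    expR (- C * fine (T w) + (H (b (Num.max (fine (T w)) 0)) - H x0))
  else 0.
Let V0 := passage_weight.

Let mX t : 0 <= t -> measurable_fun setT (X t).
Proof.
move=> t0; have [_ FM _] := hF; move=> _ A mA; rewrite setTI.
by apply: (FM _ t0); exact: aX.
Qed.

Let mT : measurable_fun setT T.
Proof. exact: measurable_first_passage. Qed.

Lemma measurable_passage_weight : measurable_fun setT V0.
Proof.
have mfT : measurable_fun setT (fun w => fine (T w)).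
  by apply: measurableT_comp => //; exact: mT.
have mmax : measurable_fun setT (fun w => Num.max (fine (T w)) 0).
  exact: measurable_maxr.
have mb : measurable_fun (`[0, +oo[%classic : set R) b.
  exact: (subspace_continuous_measurable_fun (measurable_itv _) cb).
have mbT : measurable_fun setT (b \o (fun w => Num.max (fine (T w)) 0)).
  apply: measurable_comp mb mmax => //.
  by move=> _ [w _ <-]/=; rewrite in_itv/= andbT le_max lexx orbT.
apply: measurable_fun_ifT => //.
  by apply: measurable_fun_lee => //; exact: mT.
apply: measurableT_comp => //; apply: measurable_funD.
  exact: measurable_funM.
by apply: measurable_funB => //; exact: measurableT_comp mH mbT.
Qed.

Lemma passage_weight_bounds w : 0 <= V0 w <= c.
Proof.
rewrite /V0 /passage_weight; case: ifPn => [Ttau|_]; last first.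
  by rewrite lexx expR_ge0.
rewrite expR_ge0/= ler_expR lerD//; last first.
  apply: H_ub; rewrite (@le_trans _ _ B) ?lerDl//.
  by apply: bB; rewrite le_max lexx orbT.
have [T0 Ttau'] : 0 <= fine (T w) /\ fine (T w) <= tau.
  have := first_passage_ge0 X b w; rewrite -/(T w).
  by move: Ttau; case: (T w).
apply: (le_trans (ler_norm _)); rewrite normrM normrN (ger0_norm T0).
by rewrite ler_wpM2l.
Qed.

(** With additive noise, differences of the integrated equation leave only a drift integral. While
    the path stays above [m], its drift [f] is the cut-off drift [mu], whose Lipschitz bound
    controls the integral. *)
Lemma drives_path w S :
  (forall t : R, 0 <= t ->
    lebesgue_measure.-integrable `[0, t] (fun s => (f (X s w))%:E) /\
    X t w = x0 + \int[lebesgue_measure]_(s in `[0, t]) f (X s w) + W t w) ->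
  (forall s, 0 <= s -> s <= S -> m <= X s w) ->
  drives K mu (X ^~ w) (W ^~ w) S.
Proof.
move=> eqw mXs s t r s0 st tS Xr.
have t0 := le_trans s0 st.
have [_ ->] := eqw s s0; have [ig ->] := eqw t t0.
have mXs' u : s <= u -> u <= t -> m <= X u w.
  by move=> su ut; rewrite mXs ?(le_trans s0)// (le_trans ut).
have := Rintegral_dist_le (c := mu (X s w)) (r := K * r) s0 st ig.
have [_ <-] := eqw s s0.
set I1 := Rintegral _ _ _; set I2 := Rintegral _ _ _.
rewrite (_ : x0 + I1 + W t w - _ - _ - _ = I1 - I2 - (t - s) * mu (X s w)); last first.
  by have [_ ->] := eqw s s0; rewrite -/I2; ring.
apply => u su ut; rewrite f_mu ?mXs'//; apply: (le_trans (mu_lip _ _)).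
by rewrite ler_wpM2l ?(ltW K0)// Xr.
Qed.

Lemma first_passage_eq w t : 0 < t -> T w = t%:E -> X t w = b t.
Proof.
move=> t0 Tt; have [_ Xt Xs] := first_passage_hit cX cb Tt.
apply/eqP; rewrite eq_le Xt/= leNgt; apply/negP => Xb.
have p0 : 0 < b t - X t w by rewrite subr_gt0.
have At : `[0, +oo[%classic t by rewrite /= in_itv/= ltW.
have [e e0 eP] := within_continuous_dist (@gap_continuous _ _ _ _ cX cb w) At p0.
pose s := Num.max 0 (t - e / 2).
have s0 : 0 <= s by rewrite le_max lexx.
have st : s < t by rewrite gt_max t0/= gtrBl divr_gt0.
have se : `|s - t| < e.
  rewrite ltr0_norm ?subr_lt0//.
  have : t - e / 2 <= s by rewrite le_max lexx orbT.
  lra.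
have := eP s; rewrite /= in_itv/= s0 => /(_ isT se).
have := Xs s s0 st; rewrite ltr_norml => h1 /andP[_ h2].
by have : X s w - b s < 0; [lra|rewrite subr_lt0 ltNge ltW].
Qed.

Lemma detected_weight_cvg eta : 0 < eta ->
  exists J, forall j, (J <= j)%N -> exists N, forall n, (N <= n)%N ->
    (\int[P]_w `|V j.+1%:R^-1 n w - V0 w|%:E <= eta%:E)%E.
Proof.
have j1 (j : nat) : j.+1%:R^-1 <= 1 :> R by rewrite invf_le1// ler1n.
have j0 (j : nat) : 0 < j.+1%:R^-1 :> R by rewrite invr_gt0.
have j_lt (e0 : R) : 0 < e0 ->
    exists J, forall j, (J <= j)%N -> j.+1%:R^-1 < e0.
  move=> e00; exists (Num.bound e0^-1) => j Jj; rewrite invf_plt ?posrE//.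
  apply: (lt_le_trans (archi_boundP _)); first by rewrite invr_ge0 ltW.
  by rewrite ler_nat leqW.
apply: (@iterated_bounded_convergence _ _ R P (fun j n => V j.+1%:R^-1 n) V0 c).
- by move=> j n; have [] := detected_weight_props n (j1 j).
- exact: measurable_passage_weight.
- move=> j n w; have [_ V1 V2] := detected_weight_props n (j1 j).
  have /andP[V3 V4] := passage_weight_bounds w.
  have := V1 w; have := V2 w; rewrite ler_norml => ? ?.
  by apply/andP; split; lra.
have [_ _ W00 _ _] := hW.
move: eqX W00; apply: filterS2 => w eqw W0w e e0.
have Xw0 : X 0 w = x0.
  by have [_ ->] := eqw 0 (lexx 0); rewrite set_itv1 Rintegral_set1 W0w !addr0.
have [Ttau|tauT] := boolP (T w <= tau%:E)%E.
  have [t Tt] : exists t, T w = t%:E.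
    by move: (first_passage_ge0 X b w) Ttau; rewrite -/(T w);
      case: (T w) => // t _ _; exists t.
  have [t0 Xt Xs] := first_passage_hit cX cb Tt.
  (* A passage at time 0 is excluded for this path by [b 0 < x0]; positivity of [t] is what makes
     the path equal to the boundary at [t]. *)
  have {}t0 : 0 < t.
    rewrite lt_neqAle t0 andbT; apply/eqP => t00.
    by move: Xt; rewrite -t00 Xw0 leNgt bx0.
  have Xbt := first_passage_eq t0 Tt.
  have ttau : t <= tau by rewrite -lee_fin -Tt.
  have drw : drives K mu (X ^~ w) (W ^~ w) t.
    apply: drives_path => // s s0; rewrite le_eqVlt => /predU1P[->|st].
      by rewrite Xbt bm// ltW.
    by rewrite (le_trans (bm s0))// ltW// Xs.
  have [e1 e10 e1P] := @detected_weight_hit R tau K x0 mu (X ^~ w) (W ^~ w) dr sg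
    N0 tau0 K0 (@cX w) (@cW w) mu_lip dr_mu sg_1 Xw0 b C H cb H_lip t e drw t0 ttau
    Xt Xs e0.
  have [J JP] := j_lt e1 e10; exists J => j Jj.
  have [N NP] := e1P _ (j0 j) (JP j Jj); exists N => n Nn.
  have := NP n Nn; rewrite /V0 /passage_weight Ttau Tt /=.
  by rewrite Xbt max_l// ltW.
have bX s : 0 <= s -> s <= tau -> b s < X s w.
  move=> s0 stau; rewrite ltNge; apply: contra tauT => Xb.
  by apply/(first_passage_leP cX cb); exists s.
have drw : drives K mu (X ^~ w) (W ^~ w) tau.
  apply: drives_path => // s s0 stau.
  by rewrite (le_trans (bm s0))// ltW// bX.
have [e1 e10 e1P] := @detected_weight_never R tau K x0 mu (X ^~ w) (W ^~ w) dr sg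
  N0 tau0 K0 (@cX w) (@cW w) mu_lip dr_mu sg_1 Xw0 b C H cb drw bX.
have [J JP] := j_lt e1 e10; exists J => j Jj.
have [N NP] := e1P _ (j0 j) (JP j Jj); exists N => n Nn.
rewrite /V (NP n Nn) /V0 /passage_weight (negbTE tauT) subrr normr0.
exact: ltW.
Qed.

End stopped_process.

(** * Comparison of the two laws *)

Lemma bounded_integral_EFin {d} {T : measurableType d} {R : realType}
    (P : probability T R) {f : T -> R} {c : R} :
  measurable_fun setT f -> (forall w, 0 <= f w <= c) ->
  exists a, a%:E = (\int[P]_w (f w)%:E)%E.
Proof.
move=> mf fc; exists (fine (\int[P]_w (f w)%:E)%E); rewrite fineK//.
have f0 w : 0 <= f w by have /andP[] := fc w.
rewrite ge0_fin_numE; last by apply: integral_ge0 => w _; rewrite lee_fin.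
apply: (@le_lt_trans _ _ (\int[P]_w c%:E)%E).
  apply: ge0_le_integral => //.
  - by move=> w _; rewrite lee_fin.
  - exact/measurable_EFinP.
  - by move=> w _; rewrite lee_fin; have /andP[] := fc w.
by rewrite integral_probability_cst ltry.
Qed.

Lemma measurable_inv {R : realType} : measurable_fun setT (fun x : R => x^-1).
Proof.
have m0 : measurable [set (0 : R)] by exact: measurable_set1.
rewrite -(setvU [set (0 : R)]); apply/measurable_funU => //.
  exact: measurableC.
split.
  apply: open_continuous_measurable_fun.
    by apply: closed_openC; exact: closed_eq.
  by move=> x; rewrite inE/= => /eqP x0; exact: inv_continuous.
apply: (@eq_measurable_fun _ _ _ _ _ (cst (0 : R))) => //.
by move=> x; rewrite inE/= => ->; rewrite invr0.
Qed.

Lemma lipschitz_measurable {R : realType} {f : R -> R} {K : R} :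
  (forall x y, `|f y - f x| <= K * `|y - x|) -> measurable_fun setT f.
Proof.
move=> fL; apply: continuous_measurable_fun => x.
apply/cvgrPdist_lt => e e0; near=> y.
rewrite distrC (le_lt_trans (fL x y))//.
have K1 : 0 < `|K| + 1 by rewrite ltr_wpDl.
apply: (@le_lt_trans _ _ ((`|K| + 1) * `|y - x|)).
  by rewrite ler_wpM2r// (le_trans (ler_norm K))// lerDl.
rewrite mulrC -ltr_pdivlMr// distrC.
by near: y; apply: cvgr_dist_lt => //; rewrite divr_gt0.
Unshelve. all: by end_near. Qed.

Section first_passage_law.
Local Set Implicit Arguments.
Local Unset Strict Implicit.
Variables (R : realType) (tau C m eta K B U x0 : R) (nu lam el H : R -> R).
Variables (b f1 f2 : R -> R).
Notation h := (mesh tau).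
Hypothesis ht : h_transform C m eta K nu lam el H.
Hypotheses (tau0 : 0 < tau) (eta0 : 0 < eta).
Hypothesis cb : {within `[0, +oo[, continuous b}.
Hypotheses (bm : forall t, 0 <= t -> m + eta <= b t)
  (bB : forall t, 0 <= t -> b t <= B) (bx0 : b 0 < x0).
Hypothesis H_ub : forall y, y <= B + 1 -> H y - H x0 <= U.
Hypotheses (f1E : forall y, m <= y -> f1 y = nu y + lam y)
  (f2E : forall y, m <= y -> f2 y = nu y).

Let K1 : 1 <= K := ht_K ht.
Let Kp : 0 < K. Proof. by have := K1; lra. Qed.
Let h0 n : 0 < h n. Proof. exact: mesh_gt0. Qed.

Let mnu : measurable_fun setT nu := lipschitz_measurable (ht_nu_lip ht).
Let mlam : measurable_fun setT lam := lipschitz_measurable (ht_lam_lip ht).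
Let mel : measurable_fun setT el := lipschitz_measurable (ht_el_lip ht).
Let mH : measurable_fun setT H := lipschitz_measurable (ht_H_lip ht).

Let dr2 n y := nu y * h n.
(* The step of the scheme for the diffusion is not the plain Euler step: its shift
   and noise factor are those of [normal_pdf_tilt]. *)
Let sh n y := lam y * h n / (1 - el y * h n).
Let dr1 n y := dr2 n y + sh n y.
Let sg1 n y := (Num.sqrt (1 - el y * h n))^-1.
Let sg2 (n : nat) (y : R) : R := 1.

Let mdr2 n : measurable_fun setT (dr2 n).
Proof. exact: measurable_funM. Qed.

Let minv : measurable_fun setT (fun x : R => x^-1) := measurable_inv.

Let mden n : measurable_fun setT (fun y => 1 - el y * h n).
Proof. by apply: measurable_funB => //; exact: measurable_funM. Qed.

Let msh n : measurable_fun setT (sh n).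
Proof.
apply: measurable_funM; first exact: measurable_funM.
exact: measurableT_comp minv (mden n).
Qed.

Let mdr1 n : measurable_fun setT (dr1 n).
Proof. exact: measurable_funD. Qed.

Let msg1 n : measurable_fun setT (sg1 n).
Proof.
apply: (measurableT_comp minv); apply: (measurableT_comp _ (mden n)).
apply: continuous_measurable_fun; exact: sqrt_continuous.
Qed.

Let N0_exists : exists N0, forall n, (N0 <= n)%N -> K * h n <= 1 / 16.
Proof.
have d0 : 0 < 1 / 16 / K by rewrite divr_gt0//; lra.
have [N NP] := mesh_lt tau0 d0; exists N => n Nn.
by have := NP n Nn; rewrite ltr_pdivlMr// mulrC => /ltW.
Qed.

Let elh n y : K * h n <= 1 / 16 -> `|el y * h n| <= K * h n.
Proof.
by move=> _; rewrite normrM (gtr0_norm (h0 n)) ler_wpM2r ?(ltW (h0 n))// (ht_el ht).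
Qed.

Let den_gt0 n y : K * h n <= 1 / 16 -> 1 / 2 <= 1 - el y * h n.
Proof. by move=> Kh; have := elh y Kh; rewrite ler_norml => /andP[]; lra. Qed.

(** One constant for all hypotheses of the pathwise estimates: the drift of the modified step
    contributes [2 K ^ 2], the Lipschitz constant of [nu + lam] is [2 K], and [K >= 1] orders the
    two. *)
Let K2 := 2 * K ^+ 2.
Let K2p : 0 < K2. Proof. by rewrite mulr_gt0// exprn_gt0. Qed.
Let KK2 : 2 * K <= K2.
Proof. by rewrite /K2 ler_wpM2l// expr2 ler_peMl// ltW. Qed.

Let dr1_mu n y : K * h n <= 1 / 16 ->
  `|dr1 n y - h n * (nu y + lam y)| <= K2 * h n ^+ 2.
Proof.
move=> Kh; have dn := den_gt0 y Kh; have e1 := elh y Kh.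
have dn0 : 0 < 1 - el y * h n by lra.
rewrite /dr1 /dr2 /sh.
have -> : nu y * h n + lam y * h n / (1 - el y * h n) - h n * (nu y + lam y)
  = lam y * h n * ((el y * h n) / (1 - el y * h n)).
  by field; rewrite gt_eqF.
have Kh0 : 0 <= K * h n by rewrite mulr_ge0 ?ltW.
have -> : K2 * h n ^+ 2 = K * h n * (2 * (K * h n)) by rewrite /K2; ring.
rewrite normrM; apply: ler_pM => //.
  rewrite normrM (gtr0_norm (h0 n)) ler_wpM2r ?(ltW (h0 n))//.
  exact: (ht_lam ht).
rewrite (normrM (el y * h n)) normfV (gtr0_norm dn0) ler_pdivrMr//.
nra.
Qed.

Let sg1_1 n y : K * h n <= 1 / 16 -> `|sg1 n y - 1| <= K2 * h n.
Proof.
move=> Kh; have dn := den_gt0 y Kh; have e1 := elh y Kh.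
have dn0 : 0 < 1 - el y * h n by lra.
rewrite /sg1; set r := Num.sqrt _.
have r0 : 0 < r by rewrite sqrtr_gt0.
have r2 : r ^+ 2 = 1 - el y * h n by rewrite sqr_sqrtr// ltW.
have r12 : 1 / 2 <= r.
  have : 0 <= (r - 1) ^+ 2 by exact: sqr_ge0.
  nra.
have -> : r^-1 - 1 = (el y * h n) / ((1 + r) * r).
  have -> : el y * h n = 1 - r ^+ 2 by rewrite r2; ring.
  by field; rewrite !gt_eqF//; lra.
have q : 1 / 2 <= (1 + r) * r by nra.
rewrite normrM normfV (@gtr0_norm _ ((1 + r) * r)); last by lra.
rewrite ler_pdivrMr; last by lra.
have Kh0 : 0 <= K * h n by rewrite mulr_ge0 ?ltW.
have Kh2 : 2 * (K * h n) <= K2 * h n.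
  by rewrite mulrA ler_wpM2r// ltW.
nra.
Qed.

Let dr2_mu n y : `|dr2 n y - h n * nu y| <= K2 * h n ^+ 2.
Proof.
by rewrite /dr2 mulrC subrr normr0 (mulr_ge0 (ltW K2p)) ?sqr_ge0.
Qed.

Let sg2_1 n y : `|sg2 n y - 1| <= K2 * h n.
Proof. by rewrite /sg2 subrr normr0 mulr_ge0 ?ltW. Qed.

Let nu_lip x y : `|nu y - nu x| <= K2 * `|y - x|.
Proof.
apply: (le_trans (ht_nu_lip ht x y)); rewrite ler_wpM2r//.
by have := KK2; have := Kp; lra.
Qed.

Let mu_lip x y : `|(nu y + lam y) - (nu x + lam x)| <= K2 * `|y - x|.
Proof.
have -> : nu y + lam y - (nu x + lam x) = (nu y - nu x) + (lam y - lam x) by ring.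
apply: (le_trans (ler_normD _ _)).
apply: (le_trans (lerD (ht_nu_lip ht x y) (ht_lam_lip ht x y))).
by rewrite -mulrDl ler_wpM2r//; have := KK2; lra.
Qed.

Let H_lip x y : `|H y - H x| <= K2 * `|y - x|.
Proof.
apply: (le_trans (ht_H_lip ht x y)); rewrite ler_wpM2r//.
by have := KK2; have := Kp; lra.
Qed.

(* The constant of [kernel_dist]. *)
Let M := 896 * K ^+ 4 * expR (4 * K ^+ 3).
Let M0 : 0 < M. Proof.
apply: mulr_gt0; last exact: expR_gt0.
by apply: mulr_gt0; [rewrite ltr0n|exact: exprn_gt0].
Qed.

Let mean_value n eps (G : nat -> R -> R) dr sg :=
  mean_passage_value (normal_prob 0 (Num.sqrt (h n)))
    (fun k => b (k%:R * h n) + eps) G dr sg n.+1 0 x0.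

(** Each step costs [rho = M s ^ 3] with [s ^ 2 = h]. Since [n.+1] steps satisfy [n.+1 * h = tau],
    the accumulated factor [(1 + rho) ^ n.+1] is at most [exp (M tau s)], which tends to 1 with the
    mesh. *)
Lemma mean_value_dist n eps : K * h n <= 1 / 16 -> 0 < eps -> eps <= 1 ->
  `|mean_value n eps (martingale_weight (h n) C H x0) (dr2 n) (fun=> 1)
    - mean_value n eps (fun _ _ => 1) (dr1 n) (sg1 n)|
  <= expR (M * tau * Num.sqrt (h n)) - 1.
Proof.
move=> Kh eps0 eps1; set s := Num.sqrt (h n).
have s0 : 0 < s by rewrite sqrtr_gt0.
have s2 : s ^+ 2 = h n by rewrite sqr_sqrtr// ltW.
pose rho := M * s ^+ 3.
have rho0 : 0 <= rho by rewrite mulr_ge0 ?exprn_ge0 ?ltW.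
pose beta (k : nat) := b (k%:R * h n) + eps.
have kh0 k : 0 <= k%:R * h n by rewrite mulr_ge0// ltW.
have sg10 y : 0 < sg1 n y.
  by rewrite invr_gt0 sqrtr_gt0; have := den_gt0 y Kh; lra.
have close (k : nat) x z : beta k < x ->
  `|normal_pdf 0 s z * expR (- C * h n + (H (x + dr2 n x + z) - H x)) -
    normal_pdf (sh n x) (sg1 n x * s) z| <= rho * normal_pdf 0 (2 * s) z.
  (* Kernels are compared only at positions not yet detected. These lie above [m + eta], exactly
     where the expansion of [H] is available. *)
  move=> bx; have mx : m + eta <= x.
    by rewrite (le_trans (bm (kh0 k)))// (le_trans _ (ltW bx))// lerDl ltW.
  have := @kernel_dist R K C (nu x) (lam x) (el x) s (fun y => H (x + y) - H x) z
    K1 s0.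
  rewrite s2 => /(_ Kh (ht_C ht) (ht_nu ht x) (ht_lam ht x) (ht_el ht x)).
  move=> /(_ (ht_elE ht x)).
  rewrite /sg1 (mulrC _^-1 s) /dr2 -(addrA x); apply.
    by move=> y; have := ht_H_lip ht x (x + y); rewrite (addrC x y) addrK.
  by move=> y; exact: (ht_taylor ht).
pose bnd (k : nat) := expR (`|C| * (k%:R * h n) + U).
have wbnd k x : x <= beta k -> martingale_weight (h n) C H x0 k x <= bnd k.
  move=> xb; rewrite ler_expR lerD//; last first.
    by apply: H_ub; rewrite (le_trans xb)// lerD// bB.
  by rewrite ler_wpM2r// -normrN ler_norm.
have bnd_mono : {homo bnd : i j / (i <= j)%N >-> i <= j}.
  move=> i j ij; rewrite ler_expR lerD2r ler_wpM2l// ler_wpM2r ?ler_nat//.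
  exact: ltW.
have := @mean_passage_value_dist R s (h n) C rho H beta x0 (dr2 n) (sh n) (sg1 n)
  s0 rho0 mH (mdr2 n) (msh n) (msg1 n) sg10 close bnd wbnd bnd_mono n.+1 0 x0.
have -> : martingale_weight (h n) C H x0 0 x0 = 1.
  by rewrite /martingale_weight mul0r mulr0 subrr addr0 expR0.
rewrite divr1 => /le_trans; apply; rewrite lerD2r.
have -> : M * tau * s = n.+1%:R * rho.
  rewrite /rho -[X in M * X * s](mesh_mul tau n) -s2; ring.
rewrite expRM_natl lerXn2r ?nnegrE ?expR_ge0 ?expR_ge1Dx//.
by rewrite addr_ge0.
Qed.

Context d1 (Omega1 : measurableType d1) (P1 : probability Omega1 R).
Context d2 (Omega2 : measurableType d2) (P2 : probability Omega2 R).
Variables (F1 : R -> set (set Omega1)) (W1 X : R -> Omega1 -> R).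
Variables (F2 : R -> set (set Omega2)) (W2 Z : R -> Omega2 -> R).
Hypotheses (hF1 : filtration F1) (hW1 : brownian_motion P1 F1 W1).
Hypotheses (hF2 : filtration F2) (hW2 : brownian_motion P2 F2 W2).
Variables I1 I2 : set R.
Hypothesis hX : sde_solution P1 F1 W1 I1 f1 x0 X.
Hypothesis hZ : sde_solution P2 F2 W2 I2 f2 x0 Z.

(** For [X] the weight is taken with [C = 0] and [H = 0], so that its side is the probability of a
    passage before [tau]. Both sides are within [z / 3] of their discrete expectations for a common
    [eps] and mesh, and the discrete expectations are within [z / 3] of each other. *)
Lemma integral_passage_weight :
  (\int[P1]_w (passage_weight X tau x0 0 (fun=> 0) b w)%:E =
   \int[P2]_w (passage_weight Z tau x0 C H b w)%:E)%E.
Proof.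
have [N0 N0P] := N0_exists.
have [aX cX _ eqX] := hX; have [aZ cZ _ eqZ] := hZ.
have bm' t : 0 <= t -> m <= b t.
  by move=> t0; rewrite (le_trans _ (bm t0))// lerDl ltW.
have H0_lip (y z : R) : `|(0 : R) - 0| <= K2 * `|z - y|.
  by rewrite subrr normr0 mulr_ge0// ltW.
have H0_ub (y : R) : y <= B + 1 -> (0 : R) - 0 <= 0 by rewrite subrr.
have dr1P n y (Nn : (N0 <= n)%N) := dr1_mu y (N0P n Nn).
have sg1P n y (Nn : (N0 <= n)%N) := sg1_1 y (N0P n Nn).
have dr2P n y (Nn : (N0 <= n)%N) := dr2_mu n y.
have sg2P n y (Nn : (N0 <= n)%N) := sg2_1 n y.
have m0 : measurable_fun setT (fun _ : R => 0 : R) by exact: measurable_cst.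
have msg2 n : measurable_fun setT (sg2 n) by exact: measurable_cst.
have cv1 := @detected_weight_cvg R _ Omega1 P1 F1 W1 X tau K2 m B 0 x0 0
  (fun y => nu y + lam y) f1 (fun=> 0) b dr1 sg1 N0 tau0 K2p hF1 hW1 aX cX eqX
  f1E mu_lip dr1P sg1P H0_lip H0_ub mdr1 msg1 m0 cb bm' bB bx0.
have cv2 := @detected_weight_cvg R _ Omega2 P2 F2 W2 Z tau K2 m B U x0 C
  nu f2 H b dr2 sg2 N0 tau0 K2p hF2 hW2 aZ cZ eqZ
  f2E nu_lip dr2P sg2P H_lip H_ub mdr2 msg2 mH cb bm' bB bx0.
have ex1 := @expectation_detected_weight R _ Omega1 P1 F1 W1 tau B 0 x0 0
  (fun=> 0) b dr1 sg1 tau0 hF1 hW1 H0_ub mdr1 msg1 m0 bB.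
have ex2 := @expectation_detected_weight R _ Omega2 P2 F2 W2 tau B U x0 C
  H b dr2 sg2 tau0 hF2 hW2 H_ub mdr2 msg2 mH bB.
have pr1 := @detected_weight_props R _ Omega1 P1 F1 W1 tau B 0 x0 0
  (fun=> 0) b dr1 sg1 tau0 hF1 hW1 H0_ub mdr1 msg1 m0 bB.
have pr2 := @detected_weight_props R _ Omega2 P2 F2 W2 tau B U x0 C
  H b dr2 sg2 tau0 hF2 hW2 H_ub mdr2 msg2 mH bB.
have pm1 := @measurable_passage_weight R _ Omega1 F1 X tau x0 0 (fun=> 0) b
  hF1 aX cX m0 cb.
have pm2 := @measurable_passage_weight R _ Omega2 F2 Z tau x0 C H b
  hF2 aZ cZ mH cb.
have bd1 := @passage_weight_bounds R _ Omega1 X tau B 0 x0 0 (fun=> 0) b H0_ub bB.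
have bd2 := @passage_weight_bounds R _ Omega2 Z tau B U x0 C H b H_ub bB.
have [a1 a1E] := bounded_integral_EFin P1 pm1 bd1.
have [a2 a2E] := bounded_integral_EFin P2 pm2 bd2.
rewrite -a1E -a2E; congr EFin; apply/eqP; rewrite -subr_eq0 -normr_le0.
apply/ler_addgt0Pr => z z0; rewrite add0r.
have z30 : 0 < z / 3 by rewrite divr_gt0.
have [J1 J1P] := cv1 _ z30; have [J2 J2P] := cv2 _ z30.
pose j := maxn J1 J2; pose eps : R := j.+1%:R^-1.
have [N1 N1P] := J1P j (leq_maxl _ _); have [N2 N2P] := J2P j (leq_maxr _ _).
have eps0 : 0 < eps by rewrite invr_gt0.
have eps1 : eps <= 1 by rewrite invf_le1// ler1n.
have Mt0 : 0 < M * tau := mulr_gt0 M0 tau0.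
(* The size of [sqrt h] below which [exp (M tau sqrt h) - 1 <= z / 3]. *)
pose dl := ln (1 + z / 3) / (M * tau).
have dl0 : 0 < dl by rewrite divr_gt0// ln_gt0// ltrDl.
have [N3 N3P] := mesh_lt tau0 (exprn_gt0 2 dl0).
pose n := maxn N0 (maxn N1 (maxn N2 N3)).
have n0 : (N0 <= n)%N by exact: leq_maxl.
have n1 : (N1 <= n)%N by rewrite /n !leq_max leqnn !orbT.
have n2 : (N2 <= n)%N by rewrite /n !leq_max leqnn !orbT.
have n3 : (N3 <= n)%N by rewrite /n !leq_max leqnn !orbT.
have [mV1 V10 _] := pr1 eps n eps1; have [mV2 V20 _] := pr2 eps n eps1.
have q1 := N1P n n1; have q2 := N2P n n2.
have GE : martingale_weight (h n) 0 (fun=> 0) x0 = (fun _ _ => 1).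
  apply/funext => k; apply/funext => y.
  by rewrite /martingale_weight !oppr0 mul0r !addr0 expR0.
have e1 := ex1 eps n eps1; have e2 := ex2 eps n eps1; rewrite GE in e1.
have d1' := @integral_dist_le _ _ _ P1 _ _ _ _ _ _ mV1 pm1
  (measurableT_comp (@normr_measurable R setT) (measurable_funB mV1 pm1))
  V10 (fun w => (andP (bd1 w)).1) (fun w => normr_ge0 _) (fun w => lexx _)
  (esym e1) a1E q1.
have d2' := @integral_dist_le _ _ _ P2 _ _ _ _ _ _ mV2 pm2
  (measurableT_comp (@normr_measurable R setT) (measurable_funB mV2 pm2))
  V20 (fun w => (andP (bd2 w)).1) (fun w => normr_ge0 _) (fun w => lexx _)
  (esym e2) a2E q2.
have d3 := mean_value_dist (N0P n n0) eps0 eps1.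
have ez : expR (M * tau * Num.sqrt (h n)) - 1 <= z / 3.
  rewrite lerBlDl -[leRHS]lnK ?posrE ?ltr_wpDl// ler_expR mulrC -ler_pdivlMr//.
  rewrite -/dl -(ler_pXn2r (ltn0Sn 1)) ?nnegrE ?sqrtr_ge0 ?(ltW dl0)//.
  by rewrite sqr_sqrtr ?(ltW (h0 n))// ltW// N3P.
have {}d3 := le_trans d3 ez; rewrite /mean_value in d3.
move: d1' d2' d3; set u1 := mean_passage_value _ _ _ _ _ _ _ _.
set u2 := mean_passage_value _ _ _ _ _ _ _ _.
rewrite !ler_norml => /andP[? ?] /andP[? ?] /andP[? ?]; apply/andP; split; lra.
Qed.

End first_passage_law.

Lemma frozen_continuous {R : realType} {f : R -> R} (tau : R) : 0 <= tau ->
  {within `[0, +oo[, continuous f} ->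
  {within `[0, +oo[, continuous (fun t => f (Num.min t tau))}.
Proof.
move=> tau0 cf; apply/subspace_continuousP => s; rewrite /= in_itv/= andbT => s0.
apply/cvgrPdist_lt => e e0.
have As : `[0, +oo[%classic (Num.min s tau) by rewrite /= in_itv/= andbT le_min s0.
have [d d0 dP] := within_continuous_dist cf As e0.
rewrite near_withinE; apply/nbhs_ballP; exists d => //= t.
rewrite /ball/= in_itv/= andbT => st t0; rewrite distrC; apply: dP.
  by rewrite /= in_itv/= andbT le_min t0.
apply: le_lt_trans st; rewrite distrC.
have [u|u] := leP s tau; have [v|v] := leP t tau.
- by [].
- by rewrite !ler0_norm; lra.
- by rewrite !ger0_norm; lra.
- by rewrite subrr normr0.
Qed.

Lemma frozen_first_passage {R : realType} {Omega : Type} {X : R -> Omega -> R}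
    {b : R -> R} (tau : R) (w : Omega) :
  0 <= tau -> continuous_process X -> {within `[0, +oo[, continuous b} ->
  ((first_passage X (fun t => b (Num.min t tau)) w <= tau%:E)%E =
    (first_passage X b w <= tau%:E)%E) /\
  ((first_passage X b w <= tau%:E)%E ->
    first_passage X (fun t => b (Num.min t tau)) w = first_passage X b w).
Proof.
move=> tau0 cX cb; have cb' := frozen_continuous tau tau0 cb.
set b' := fun t : R => _.
have bE t : t <= tau -> b' t = b t by move=> tt; rewrite /b' min_l.
have le t : t <= tau ->
    (first_passage X b' w <= t%:E)%E <-> (first_passage X b w <= t%:E)%E.
  move=> tt; split=> /(first_passage_leP cX _)[//|s [s0 st]].
    rewrite bE; last exact: le_trans tt.
    by move=> Xs; apply/(first_passage_leP cX cb); exists s.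
  rewrite -bE; last exact: le_trans tt.
  by move=> Xs; apply/(first_passage_leP cX cb'); exists s.
split; first by apply/idP/idP => /le; apply.
move=> Tt; have Tt' := (le _ (lexx _)).2 Tt.
have fin (c : R -> R) : (first_passage X c w <= tau%:E)%E ->
    exists t, first_passage X c w = t%:E.
  by move: (first_passage_ge0 X c w); case: (first_passage X c w) => // t _ _;
    exists t.
have [t e] := fin _ Tt; have [t' e'] := fin _ Tt'.
rewrite e e' !lee_fin in Tt Tt' *.
apply/eqP; rewrite eq_le -[X in X && _]lee_fin -[X in _ && X]lee_fin.
rewrite -{1}e' -{2}e; apply/andP; split.
  by apply/le => //; rewrite e.
by apply/le => //; rewrite e'.
Qed.

Lemma measure_of_density {d} {T : measurableType d} {R : realType}
    (mu : {measure set T -> \bar R}) {f : T -> \bar R} :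
  measurable_fun setT f -> (forall x, (0 <= f x)%E) ->
  exists nu : {measure set T -> \bar R},
    forall A, nu A = (\int[mu]_(x in A) f x)%E.
Proof.
move=> mf f0; pose nu A := (\int[mu]_(x in A) f x)%E.
have nu0 : nu set0 = 0%E by rewrite /nu integral_set0.
have nu_ge0 A : (0 <= nu A)%E by exact: integral_ge0.
have nu_sigma : semi_sigma_additive nu.
  move=> A mA tA mUA; rewrite /nu ge0_integral_bigcup//; last first.
    exact: measurable_funTS.
  by apply: is_cvg_ereal_nneg_natsum_cond => n _ _; exact: integral_ge0.
pose nuM : {measure set T -> \bar R} :=
  HB.pack nu (isMeasure.Build _ _ _ nu nu0 nu_ge0 nu_sigma).
by exists nuM.
Qed.

(** The comparison of the processes only yields distribution functions. Rays are stable under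
    intersection, generate the Borel sets and exhaust the line with finite mass, so they determine
    the measure. *)
Lemma measure_ray_unique {R : realType}
    (m1 m2 : {measure set (measurableTypeR R) -> \bar R}) :
  (forall s : R, m1 `]-oo, s]%classic = m2 `]-oo, s]%classic) ->
  (forall s : R, (m1 `]-oo, s]%classic < +oo)%E) ->
  forall A, measurable A -> m1 A = m2 A.
Proof.
move=> m12 m1oo A mA.
pose G := [set A : set (measurableTypeR R) | exists s, A = `]-oo, s]%classic].
apply: (measure_unique G (fun k => `]-oo, k%:R]%classic)) => //.
- rewrite [LHS]RGenOInfty.measurableE; apply/seteqP; split=> A'.
    apply: smallest_sub; first exact: smallest_sigma_algebra.
    move=> _ [s ->]; rewrite -setCitvl; apply: sigma_algebraC.
    by apply: sub_sigma_algebra; exists s.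
  apply: smallest_sub; first exact: smallest_sigma_algebra.
  move=> _ [s ->]; rewrite -setCitvr; apply: sigma_algebraC.
  by apply: sub_sigma_algebra; exists s.
- move=> _ _ [s ->] [t ->]; exists (Num.min s t).
  apply/seteqP; split=> x/=; rewrite !in_itv/= le_min; first by move=> [-> ->].
  by move/andP.
- by move=> k; exists k%:R.
- apply/seteqP; split=> // x _; exists (Num.bound x) => //=.
  rewrite in_itv/=; have [x0|/ltW x0] := leP 0 x.
    exact/ltW/archi_boundP.
  by rewrite (le_trans x0).
- by move=> _ [s ->].
Qed.

Lemma measurable_lee_cst {R : realType} {d} {Omega : measurableType d}
    {T : Omega -> \bar R} (s : R) :
  measurable_fun setT T -> measurable [set w | (T w <= s%:E)%E].
Proof.
move=> mT; have := mT measurableT _ (emeasurable_itv `]-oo, s%:E]).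
by rewrite setTI; congr measurable; apply/seteqP; split=> w/=; rewrite in_itv.
Qed.

Lemma measurable_lt_pinfty {R : realType} {d} {Omega : measurableType d}
    {T : Omega -> \bar R} :
  measurable_fun setT T -> measurable [set w | (T w < +oo)%E].
Proof.
move=> mT; have -> : [set w | (T w < +oo)%E] = ~` (T @^-1` [set +oo%E]).
  by apply/seteqP; split=> w/=; rewrite ltey; move/eqP.
apply: measurableC; rewrite -[X in measurable X]setTI.
exact: mT measurableT _ (emeasurable_set1 _).
Qed.

Lemma measurable_preimage_EFin {R : realType} {d} {Omega : measurableType d}
    {T : Omega -> \bar R} {B : set R} :
  measurable_fun setT T -> measurable B ->
  measurable [set w | exists2 t, B t & T w = t%:E].
Proof.
move=> mT mB; have := mT measurableT _ (measurable_image_EFin mB); rewrite setTI.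
congr measurable; apply/seteqP; split=> w/=.
  by move=> [t Bt <-]; exists t.
by move=> [t Bt ->]; exists t.
Qed.

(** The measure is the image under [fine] of [T] of the measure with density [r] on the event of a
    finite time; being a measure on the line, it can be compared across different probability
    spaces. *)
Lemma exists_weighted_law {R : realType} {d} {Omega : measurableType d}
    (P : probability Omega R) {T : Omega -> \bar R} {r : Omega -> R} :
  measurable_fun setT T -> (forall w, (0 <= T w)%E) ->
  measurable_fun setT r -> (forall w, 0 <= r w) ->
  exists m : {measure set (measurableTypeR R) -> \bar R},
    (forall B, measurable B -> m B =
      (\int[P]_(w in [set w | exists2 t, B t & T w = t%:E]) (r w)%:E)%E) /\
    (forall G : R -> \bar R, measurable_fun setT G -> (forall t, (0 <= G t)%E) ->
      (\int[m]_t G t =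
       \int[P]_(w in [set w | (T w < +oo)%E]) (G (fine (T w)) * (r w)%:E))%E).
Proof.
move=> mT T0 mr r0.
have mD : measurable [set w | (T w < +oo)%E] := measurable_lt_pinfty mT.
pose fT w : measurableTypeR R := fine (T w).
have mfT : measurable_fun setT fT.
  by apply: measurableT_comp => //; exact: mT.
(* The indicator discards the event [T = +oo], whose mass [fine] would otherwise place at time 0. *)
pose f w := r w * \1_[set w | (T w < +oo)%E] w.
have mf : measurable_fun setT f.
  by apply: measurable_funM => //; exact: measurable_indic.
have f0 w : 0 <= f w by rewrite mulr_ge0// indicE.
have mfE : measurable_fun setT (EFin \o f) by exact/measurable_EFinP.
have [nu nuE] := measure_of_density P mfE f0.
pose fTM : {mfun Omega >-> measurableTypeR R} :=
  HB.pack fT (isMeasurableFun.Build _ _ _ _ _ mfT).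
unshelve (exists (pushforward nu fTM)); first exact: mfT.
split=> [B mB|G mG G0].
  transitivity (nu (fT @^-1` B)); first by []; rewrite nuE; have -> : [set w | exists2 t, B t & T w = t%:E] =
      (fT @^-1` B) `&` [set w | (T w < +oo)%E].
    apply/seteqP; split=> w/=; first by rewrite /fT => -[t Bt ->]; rewrite ltry.
    move=> [Bw Tw]; exists (fine (T w)) => //.
    by rewrite fineK// ge0_fin_numE.
  by rewrite [RHS]integral_mkcondr epatch_indic; apply: eq_integral => w _.
have mGf : measurable_fun setT (G \o fT) by exact: measurableT_comp mG mfT.
transitivity (\int[nu]_w G (fT w))%E.
  exact: (@ge0_integral_pushforward _ _ _ _ _ fT mfT nu setT G measurableT mG
    (fun t _ => G0 t)).
rewrite (@ge0_integral_density _ _ _ P nu setT f measurableT mf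
  (fun w _ => f0 w) (fun A _ _ => nuE A) (G \o fT) mGf (fun w _ => G0 _)).
rewrite [RHS]integral_mkcond epatch_indic; apply: eq_integral => w _.
by rewrite /= /f EFinM muleA.
Qed.

(** * From the passage probabilities to the density and the Laplace transform *)

Section law_of_first_passage.
Local Set Implicit Arguments.
Local Unset Strict Implicit.
Variables (R : realType) (C D a l x0 : R) (theta dtheta b : R -> R).
Context d1 (Omega1 : measurableType d1) (P1 : probability Omega1 R).
Context d2 (Omega2 : measurableType d2) (P2 : probability Omega2 R).
Variables (F1 : R -> set (set Omega1)) (W1 X : R -> Omega1 -> R).
Variables (F2 : R -> set (set Omega2)) (W2 Z : R -> Omega2 -> R).
Variables I1 I2 : set R.
Hypotheses (a0 : 0 <= a) (aD : a ^+ 2 = a + D) (l0 : 0 <= l).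
Hypothesis dt : forall x : R, 0 < x -> is_derive x 1 theta (dtheta x).
Hypothesis ddt : forall x : R, 0 < x ->
  is_derive x 1 dtheta ((2 * C + D / x ^+ 2) * theta x).
Hypothesis theta_gt0 : forall x : R, l < x -> 0 < theta x.
Hypothesis cb : {within `[0, +oo[, continuous b}.
Hypotheses (lb : forall t : R, 0 <= t -> l < b t) (bx0 : b 0 < x0).
Hypotheses (hF1 : filtration F1) (hW1 : brownian_motion P1 F1 W1).
Hypotheses (hF2 : filtration F2) (hW2 : brownian_motion P2 F2 W2).
Hypothesis hX : sde_solution P1 F1 W1 I1 (fun x => dtheta x / theta x) x0 X.
Hypothesis hZ : sde_solution P2 F2 W2 I2 (fun z => a / z) x0 Z.

Definition passage_density_ratio (t : R) : R :=
  x0 `^ a / b t `^ a * (theta (b t) / theta x0) * expR (- C * t).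

Lemma exp_log_ratio x y : 0 < x -> 0 < y -> 0 < theta x -> 0 < theta y ->
  expR ((ln (theta y) - a * ln y) - (ln (theta x) - a * ln x)) =
  x `^ a / y `^ a * (theta y / theta x).
Proof.
move=> x00 y0 tx ty; rewrite /powR !gt_eqF// !expRB !lnK ?posrE//.
have e1 := expR_gt0 (a * ln x); have e2 := expR_gt0 (a * ln y).
by field; rewrite !gt_eqF.
Qed.

(* Freezing the boundary at time [tau] makes it bounded and keeps it away from
   [l], without changing the passages before [tau]. *)
Lemma first_passage_law_le tau : 0 < tau ->
  (P1 [set w | (first_passage X b w <= tau%:E)%E] =
   \int[P2]_(w in [set w | (first_passage Z b w <= tau%:E)%E])
     (passage_density_ratio (fine (first_passage Z b w)))%:E)%E.
Proof.
move=> tau0; have tau0' := ltW tau0.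
have sub : `[0, tau]%classic `<=` (`[0, +oo[%classic : set R).
  by move=> s/=; rewrite !in_itv/= andbT => /andP[].
have cbt := continuous_subspaceW sub cb.
have [t1 t1I bmin] := EVT_min tau0' cbt; have [t2 t2I bmax] := EVT_max tau0' cbt.
have lb1 : l < b t1 by apply: lb; move: t1I; rewrite in_itv/= => /andP[].
(* The cut-off level is the midpoint between [l] and the minimum of [b] on [[0, tau]]: it stays
   above [l] and lies [eta] below the boundary. *)
pose eta := (b t1 - l) / 2; pose m := b t1 - eta.
have eta0 : 0 < eta by rewrite divr_gt0// subr_gt0.
have lm : l < m by rewrite /m /eta; lra.
have m0 : 0 < m by exact: le_lt_trans lm.
pose b' t := b (Num.min t tau).
have cb' : {within `[0, +oo[, continuous b'} := frozen_continuous tau tau0' cb.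
have mI t : 0 <= t -> Num.min t tau \in `[0, tau].
  by move=> t0; rewrite in_itv/= le_min t0 tau0'/= ge_min lexx orbT.
have bm t : 0 <= t -> m + eta <= b' t.
  by move=> t0; rewrite /m subrK; apply: bmin; exact: mI.
have bB t : 0 <= t -> b' t <= b t2 by move=> t0; apply: bmax; exact: mI.
have bx0' : b' 0 < x0 by rewrite /b' min_l.
have mb t : 0 <= t -> m <= b' t.
  by move=> t0; rewrite (le_trans _ (bm t t0))// lerDl ltW.
have mx0 : m <= x0 by rewrite (le_trans (mb 0 (lexx 0)))// ltW.
have [K ht] := h_transform_exists a0 aD l0 lm eta0 dt ddt theta_gt0.
set H := (fun x : R => ln _ - _) in ht.
(* The Lipschitz bound alone is useless for very negative [y]; as [H] is constant below [m], [y] may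
   first be replaced by [Num.max y m], which is bounded on both sides. *)
pose U := K * (`|b t2 + 1| + `|m| + `|x0|).
have Hub y : y <= b t2 + 1 -> H y - H x0 <= U.
  move=> yB; pose y' := Num.max y m.
  have -> : H y = H y' by rewrite /H /y' -maxA maxxx.
  apply: (le_trans (ler_norm _)); apply: (le_trans (ht_H_lip ht x0 y')).
  rewrite ler_wpM2l ?(le_trans _ (ht_K ht))//.
  apply: (le_trans (ler_normB _ _)); rewrite lerD2r.
  have y'm : m <= y' by rewrite le_max lexx orbT.
  have y'B : y' <= `|b t2 + 1| + `|m|.
    rewrite ge_max; apply/andP; split.
      by apply: (le_trans yB); apply: (le_trans (ler_norm _)); rewrite lerDl.
    by apply: (le_trans (ler_norm m)); rewrite lerDr.
  by rewrite ger0_norm// (le_trans (ltW m0)).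
have key := @integral_passage_weight R tau C m eta K (b t2) U x0 _ _ _ H b'
  (fun x => dtheta x / theta x) (fun z => a / z) ht tau0 eta0 cb' bm bB bx0' Hub.
have f1E (y : R) : m <= y -> dtheta y / theta y =
    a / Num.max y m
    + (dtheta (Num.max y m) / theta (Num.max y m) - a / Num.max y m).
  by move=> my; rewrite max_l// addrC subrK.
have f2E (y : R) : m <= y -> a / y = a / Num.max y m.
  by move=> my; rewrite max_l.
have := key f1E f2E _ _ P1 _ _ P2 _ _ _ _ _ _ hF1 hW1 hF2 hW2 _ _ hX hZ.
have [aX cX _ _] := hX; have [aZ cZ _ _] := hZ.
have mle d (Omega : measurableType d) (P : probability Omega R) F Y :
    filtration F -> adapted F Y -> continuous_process Y ->
    measurable [set w : Omega | (first_passage Y b w <= tau%:E)%E].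
  move=> [_ Fm _] aY cY.
  apply: measurable_lee_cst.
  apply: measurable_first_passage => // t t0 _ A mA; rewrite setTI.
  by apply: (Fm t t0); exact: aY.
have memE (Omega : Type) (A : pred Omega) w : (w \in [set w | A w]) = A w.
  by apply/idP/idP; rewrite inE.
have mg := mle _ _ P1 _ _ hF1 aX cX; have mz := mle _ _ P2 _ _ hF2 aZ cZ.
have -> : (\int[P1]_w (passage_weight X tau x0 0 (fun=> 0) b' w)%:E)%E =
    P1 [set w | (first_passage X b w <= tau%:E)%E].
  transitivity (\int[P1]_w
      (\1_[set w | (first_passage X b w <= tau%:E)%E] w)%:E)%E.
    apply: eq_integral => w _.
    have [e _] := frozen_first_passage tau w tau0' cX cb.
    rewrite /passage_weight e indicE memE.
    case: ifP => // _.
    by rewrite !oppr0 mul0r !addr0 expR0.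
  by rewrite integral_indic// setIT.
move=> ->; rewrite [RHS]integral_mkcond; apply: eq_integral => w _.
have [e1 e2] := frozen_first_passage tau w tau0' cZ cb.
rewrite patchE /passage_weight e1 memE; case: ifPn => // Tw.
rewrite e2//.
have [t Tt] : exists t, first_passage Z b w = t%:E.
  by move: (first_passage_ge0 Z b w) Tw; case: (first_passage Z b w) => // t _ _;
    exists t.
rewrite Tt lee_fin in Tw *.
have t0 : 0 <= t by rewrite -lee_fin -Tt first_passage_ge0.
rewrite /= (max_l t0) /b' (min_l Tw) expRD mulrC /passage_density_ratio.
congr (_ * _)%:E.
have mbt : m <= b t by have := mb t t0; rewrite /b' min_l.
rewrite /H !max_l// exp_log_ratio//.
- exact: lt_le_trans mx0.
- exact: lt_le_trans mbt.
- exact/theta_gt0/(lt_le_trans lm).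
- exact/theta_gt0/(lt_le_trans lm).
Qed.

Lemma measurable_adapted_first_passage d (Omega : measurableType d) F Y :
  filtration F -> adapted F Y -> continuous_process Y ->
  measurable_fun setT (first_passage (Y : R -> Omega -> R) b).
Proof.
move=> [_ Fm _] aY cY; apply: measurable_first_passage => // t t0 _ A mA.
by rewrite setTI; apply: (Fm t t0); exact: aY.
Qed.

Lemma measurable_boundary_comp (G : R -> R) :
  measurable_fun (`]0, +oo[%classic : set R) G ->
  measurable_fun setT (fun t : R => G (b (Num.max t 0))).
Proof.
move=> mG.
have mmax : measurable_fun setT (fun t : R => Num.max t 0).
  exact: measurable_maxr.
have mb : measurable_fun (`[0, +oo[%classic : set R) b.
  exact: (subspace_continuous_measurable_fun (measurable_itv _) cb).
have mbt : measurable_fun setT (b \o (fun t : R => Num.max t 0)).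
  apply: measurable_comp mb mmax => //.
  by move=> _ [t _ <-]/=; rewrite in_itv/= andbT le_max lexx orbT.
apply: measurable_comp mG mbt => //.
move=> _ [t _ <-]/=; rewrite in_itv/= andbT (le_lt_trans l0)// lb//.
by rewrite le_max lexx orbT.
Qed.

Lemma measurable_theta_powR :
  measurable_fun (`]0, +oo[%classic : set R) (fun x => theta x / x `^ a).
Proof.
apply: measurable_funM; last first.
  by apply: measurable_funTS; apply: (measurableT_comp measurable_inv);
    exact: measurable_powR.
apply: open_continuous_measurable_fun; first exact: interval_open.
move=> x; rewrite inE/= in_itv/= andbT => x00; have ? := dt x00.
exact/differentiable_continuous/derivable1_diffP/ex_derive.
Qed.

Lemma passage_density_ratioE t : passage_density_ratio t =
  x0 `^ a / theta x0 * (theta (b t) / b t `^ a * expR (- C * t)).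
Proof.
rewrite /passage_density_ratio [RHS]mulrA; congr (_ * _).
by rewrite mulrACA [(b t `^ a)^-1 * _]mulrC mulrACA.
Qed.

Lemma measurable_passage_density_ratio :
  measurable_fun setT (fun t : R => passage_density_ratio (Num.max t 0)).
Proof.
under eq_fun do rewrite passage_density_ratioE.
apply: measurable_funM => //; apply: measurable_funM.
  exact: measurable_boundary_comp measurable_theta_powR.
apply: measurableT_comp => //; apply: measurable_funM => //.
exact: measurable_maxr.
Qed.

Lemma passage_density_ratio_ge0 t : 0 <= t -> 0 <= passage_density_ratio t.
Proof.
move=> t0; rewrite mulr_ge0 ?expR_ge0// mulr_ge0//.
  by rewrite divr_ge0 ?powR_ge0.
by rewrite divr_ge0// ltW// theta_gt0 ?lb// (lt_trans (lb (lexx 0))).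
Qed.

(** The start is almost surely strictly above the boundary. This settles the rays ending at
    [s <= 0], which the comparison for [tau > 0] leaves open, and removes passages at time 0. *)
Lemma first_passage_le0_negligible d (Omega : measurableType d)
    (P : probability Omega R) F W I f Y s :
  filtration F -> brownian_motion P F W -> sde_solution P F W I f x0 Y ->
  s <= 0 -> P [set w | (first_passage Y b w <= s%:E)%E] = 0%E.
Proof.
move=> hF hW [aY cY _ eqY] s0.
have mT := measurable_adapted_first_passage hF aY cY.
have mS : measurable [set w | (first_passage Y b w <= s%:E)%E].
  exact: measurable_lee_cst.
have [_ _ W00 _ _] := hW.
have [N [mN PN0 subN]] : {ae P, forall w, Y 0 w = x0}.
  move: eqY W00; apply: filterS2 => w eqw W0w.
  by have [_ ->] := eqw 0 (lexx 0); rewrite set_itv1 Rintegral_set1 W0w !addr0.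
apply/eqP; rewrite -measure_le0 -PN0 le_measure ?inE// => w /= Tw.
apply: subN => /= Yw; move/(first_passage_leP cY cb): Tw => [u [u0 us]].
have -> : u = 0 by apply/eqP; rewrite eq_le u0 (le_trans us).
by rewrite Yw leNgt bx0.
Qed.

(** One measure on the line seen from both spaces: as the law of the passage of [X], and as the
    reweighted law of the passage of [Z]. The two images agree on rays, hence everywhere, so both
    claims reduce to a choice of test function. *)
Lemma exists_first_passage_law :
  exists m : {measure set (measurableTypeR R) -> \bar R},
  [/\ forall B, measurable B ->
        m B = P1 [set w | exists2 t, B t & first_passage X b w = t%:E],
      forall G : R -> \bar R, measurable_fun setT G -> (forall t, (0 <= G t)%E) ->
        (\int[m]_t G t =
         \int[P1]_(w in [set w | (first_passage X b w < +oo)%E])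
           G (fine (first_passage X b w)))%E &
      forall G : R -> \bar R, measurable_fun setT G -> (forall t, (0 <= G t)%E) ->
        (\int[m]_t G t =
         \int[P2]_(w in [set w | (first_passage Z b w < +oo)%E])
           (G (fine (first_passage Z b w)) *
            (passage_density_ratio (fine (first_passage Z b w)))%:E))%E].
Proof.
have [aX cX _ _] := hX; have [aZ cZ _ _] := hZ.
set Tg := first_passage X b; set Tb := first_passage Z b.
have mTg : measurable_fun setT Tg := measurable_adapted_first_passage hF1 aX cX.
have mTb : measurable_fun setT Tb := measurable_adapted_first_passage hF2 aZ cZ.
have Tg0 w : (0 <= Tg w)%E by exact: first_passage_ge0.
have Tb0 w : (0 <= Tb w)%E by exact: first_passage_ge0.
pose r w := passage_density_ratio (Num.max (fine (Tb w)) 0).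
have rE w : r w = passage_density_ratio (fine (Tb w)).
  by rewrite /r max_l// fine_ge0.
have mr : measurable_fun setT r.
  by apply: measurableT_comp measurable_passage_density_ratio _;
    apply: measurableT_comp => //; exact: mTb.
have r0 w : 0 <= r w by apply: passage_density_ratio_ge0; rewrite le_max lexx orbT.
have ray (Omega : Type) (T : Omega -> \bar R) s : (forall w, 0 <= T w)%E ->
    [set w | exists2 t, `]-oo, s]%classic t & T w = t%:E] =
    [set w | (T w <= s%:E)%E].
  move=> T0; apply/seteqP; split=> w/=.
    by move=> [t]; rewrite in_itv/= => ts ->; rewrite lee_fin.
  move=> Ts; have e : (fine (T w))%:E = T w.
    by rewrite fineK// ge0_fin_numE// (le_lt_trans Ts)// ltry.
  by exists (fine (T w)) => //=; rewrite in_itv/= -lee_fin e.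
have m1c : measurable_fun setT ((fun=> 1) : Omega1 -> R) by exact: measurable_cst.
have [m1 [m1E m1G]] := exists_weighted_law P1 mTg Tg0 m1c (fun=> ler01).
have [m2 [m2E m2G]] := exists_weighted_law P2 mTb Tb0 mr r0.
have m1P B : measurable B -> m1 B = P1 [set w | exists2 t, B t & Tg w = t%:E].
  by move=> mB; rewrite m1E// integral_cst ?mul1e//; exact: measurable_preimage_EFin.
have m12 : forall B, measurable B -> m1 B = m2 B.
  apply: measure_ray_unique => s; last first.
    rewrite m1P//; apply: (@le_lt_trans _ _ 1%E); last exact: ltry.
    by apply: probability_le1; exact: measurable_preimage_EFin.
  rewrite m1P// m2E// (ray _ Tg s Tg0) (ray _ Tb s Tb0).
  have [s0|s0] := leP s 0; last first.
    by rewrite (first_passage_law_le s0); apply: eq_integral => w _; rewrite rE.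
  rewrite (first_passage_le0_negligible hF1 hW1 hX s0).
  apply/esym/null_set_integral.
  - exact: measurable_lee_cst.
  - by apply/measurable_EFinP; exact: measurable_funTS.
  - exact: (first_passage_le0_negligible hF2 hW2 hZ s0).
exists m1; split=> [B|G mG G0|G mG G0]; first exact: m1P.
  by rewrite (m1G G mG G0); apply: eq_integral => w _; rewrite mule1.
rewrite (eq_measure_integral m2); last by move=> B mB _; exact: m12.
by rewrite (m2G G mG G0); apply: eq_integral => w _; rewrite rE.
Qed.

(** At a positive finite passage time the process sits on the boundary, so the two integrands differ
    at most on the null event of a passage at time 0. *)
Lemma integral_at_first_passage (G k : R -> R) :
  (forall w t, 0 <= t -> 0 < Z t w) ->
  measurable_fun (`]0, +oo[%classic : set R) G -> measurable_fun setT k ->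
  (\int[P2]_(w in [set w | (first_passage Z b w < +oo)%E])
     (G (Z (fine (first_passage Z b w)) w) * k (fine (first_passage Z b w)))%:E =
   \int[P2]_(w in [set w | (first_passage Z b w < +oo)%E])
     (G (b (fine (first_passage Z b w))) * k (fine (first_passage Z b w)))%:E)%E.
Proof.
move=> Z0 mG mk; have [aZ cZ _ _] := hZ; set T := first_passage Z b.
have mT : measurable_fun setT T := measurable_adapted_first_passage hF2 aZ cZ.
have T0 w : (0 <= T w)%E by exact: first_passage_ge0.
have mfT : measurable_fun setT (fine \o T) by apply: measurableT_comp.
have mD : measurable [set w | (T w < +oo)%E] := measurable_lt_pinfty mT.
pose Gb w := G (b (Num.max (fine (T w)) 0)).
have mGb : measurable_fun setT Gb.
  exact: measurableT_comp (measurable_boundary_comp mG) mfT.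
have GbE w : Gb w = G (b (fine (T w))) by rewrite /Gb max_l// fine_ge0.
have mZ0 : measurable_fun setT (Z 0).
  have [_ Fm _] := hF2.
  by move=> _ B mB; rewrite setTI; apply: (Fm 0 (lexx 0)); exact: aZ.
have mGZ0 : measurable_fun setT (G \o Z 0).
  apply: measurable_comp mG mZ0 => //.
  by move=> _ [w _ <-]/=; rewrite in_itv/= andbT Z0.
(* This also yields measurability of the process at its random passage time: it is expressed through
   the boundary for a positive time and through the starting value otherwise. *)
have ZE w : (T w < +oo)%E ->
    G (Z (fine (T w)) w) = if 0 < fine (T w) then Gb w else G (Z 0 w).
  move=> Tw; have Tfin : T w = (fine (T w))%:E.
    by rewrite fineK// ge0_fin_numE.
  case: ltP => [t0|t0].
    by rewrite GbE (first_passage_eq cZ cb t0 Tfin).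
  congr (G (Z _ w)); apply/eqP; rewrite eq_le t0.
  by rewrite fine_ge0.
have mkT : measurable_fun setT (fun w => k (fine (T w))).
  exact: measurableT_comp mk mfT.
apply: ae_eq_integral => //.
- apply/measurable_EFinP; apply: measurable_funM; last exact: measurable_funTS.
  apply: (eq_measurable_fun (fun w => if 0 < fine (T w) then Gb w else G (Z 0 w))).
    by move=> w; rewrite inE /= => /ZE ->.
  apply: measurable_funTS; apply: measurable_fun_ifT => //.
  exact: measurable_fun_ltr.
- apply/measurable_EFinP; apply: measurable_funM; last exact: measurable_funTS.
  apply: measurable_funTS; apply: eq_measurable_fun mGb => w _.
  exact: GbE.
- exists [set w | (T w <= 0%:E)%E]; split.
  + exact: measurable_lee_cst.
  + exact: (first_passage_le0_negligible hF2 hW2 hZ (lexx 0)).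
  + move=> w /= nTw; rewrite leNgt; apply/negP => Tw; apply: nTw => Dw.
    rewrite (ZE w Dw) -GbE; case: ifPn => //; rewrite -leNgt => t0.
    by move: Tw; rewrite -(@fineK _ (T w)) ?lte_fin ?ge0_fin_numE// ltNge t0.
Qed.

(** The test function is [exp (- lambda t)]; its product with the density ratio merges the
    exponentials into [lambda + C], and the factor depending on [x0] alone leaves the integral. *)
Lemma first_passage_laplace (lambda : R) :
  (forall w t, 0 <= t -> 0 < Z t w) ->
  (\int[P1]_(w in [set w | first_passage X b w < +oo])
     (expR (- lambda * fine (first_passage X b w)))%:E =
   (x0 `^ a / theta x0)%:E *
   \int[P2]_(w in [set w | first_passage Z b w < +oo])
     (theta (Z (fine (first_passage Z b w)) w) /
        Z (fine (first_passage Z b w)) w `^ a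
      * expR (- (lambda + C) * fine (first_passage Z b w)))%:E)%E.
Proof.
move=> Z0; have [m [_ mX mZ]] := exists_first_passage_law.
have [aZ cZ _ _] := hZ.
have mT : measurable_fun setT (first_passage Z b) :=
  measurable_adapted_first_passage hF2 aZ cZ.
have mfT : measurable_fun setT (fine \o first_passage Z b).
  by apply: measurableT_comp.
have mexp c : measurable_fun setT (fun t : R => expR (c * t)).
  by apply: measurableT_comp => //; exact: measurable_funM.
have mE : measurable_fun setT (fun t : R => (expR (- lambda * t))%:E).
  by apply/measurable_EFinP; exact: mexp.
have E0 t : (0 <= (expR (- lambda * t))%:E)%E by rewrite lee_fin expR_ge0.
rewrite -(mX _ mE E0) (mZ _ mE E0).
rewrite (integral_at_first_passage Z0 measurable_theta_powR (mexp _)).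
set T := first_passage Z b in mT mfT *.
have T0 w : (0 <= T w)%E by exact: first_passage_ge0.
have x00 : l < x0 by exact: lt_trans (lb (lexx 0)) bx0.
have mD : measurable [set w | (T w < +oo)%E] := measurable_lt_pinfty mT.
rewrite -ge0_integralZl.
- apply: eq_integral => w _; rewrite -!EFinM passage_density_ratioE; congr EFin.
  rewrite mulrCA; congr (_ * _); rewrite mulrCA; congr (_ * _).
  by rewrite -expRD; congr expR; ring.
- exact: mD.
- apply/measurable_EFinP; apply: measurable_funTS; apply: measurable_funM.
    apply: (eq_measurable_fun (fun w =>
      theta (b (Num.max (fine (T w)) 0)) / b (Num.max (fine (T w)) 0) `^ a)).
      by move=> w _; rewrite max_l// fine_ge0.
    exact: measurableT_comp (measurable_boundary_comp measurable_theta_powR) mfT.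
  exact: measurableT_comp (mexp _) mfT.
- move=> w _; rewrite lee_fin mulr_ge0 ?expR_ge0// divr_ge0 ?powR_ge0//.
  by rewrite ltW// theta_gt0// lb// fine_ge0.
- by rewrite lee_fin divr_ge0 ?powR_ge0// ltW// theta_gt0.
Qed.

(** The test function is the indicator of [A]: its integral is that of the density ratio over [A]
    against the law [n] of the passage of [Z], and on [A] that law has density [rho]. *)
Lemma first_passage_density rho : is_density P2 (first_passage Z b) rho ->
  is_density P1 (first_passage X b) (fun t => passage_density_ratio t * rho t).
Proof.
move=> [mTb mrho rho0 rhoE]; have [m [mP _ mZ]] := exists_first_passage_law.
have [aX cX _ _] := hX.
have mr : measurable_fun setT (fun t : R => passage_density_ratio (Num.max t 0)) :=
  measurable_passage_density_ratio.
have I0 (t : R) : `[0, +oo[%classic t -> 0 <= t by rewrite /= in_itv/= andbT.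
have r0 t : 0 <= passage_density_ratio (Num.max t 0).
  by apply: passage_density_ratio_ge0; rewrite le_max lexx orbT.
split.
- exact: measurable_adapted_first_passage hF1 aX cX.
- apply: measurable_funM => //.
  apply: (eq_measurable_fun (fun t : R => passage_density_ratio (Num.max t 0))).
    by move=> t; rewrite inE => /I0 t0; rewrite max_l.
  exact: measurable_funTS.
- by move=> t t0; rewrite mulr_ge0 ?rho0// passage_density_ratio_ge0.
move=> A mA sA; rewrite -mP//.
set T := first_passage Z b in mTb rhoE mZ.
have T0 w : (0 <= T w)%E by exact: first_passage_ge0.
have m1c : measurable_fun setT ((fun=> 1) : Omega2 -> R) by exact: measurable_cst.
have [n [nP nZ]] := exists_weighted_law P2 mTb T0 m1c (fun=> ler01).
pose G (t : R) := (passage_density_ratio (Num.max t 0) * \1_A t)%:E.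
have mG : measurable_fun setT G.
  by apply/measurable_EFinP; apply: measurable_funM.
have G0 t : (0 <= G t)%E by rewrite lee_fin mulr_ge0// indicE.
transitivity (\int[m]_t (\1_A t)%:E)%E; first by rewrite integral_indic// setIT.
have mI : measurable_fun setT (fun t : R => (\1_A t : R)%:E).
  by apply/measurable_EFinP; exact: measurable_indic.
have ind0 (t : R) : (0 <= (\1_A t : R)%:E)%E by rewrite lee_fin indicE.
rewrite (mZ _ mI ind0).
transitivity (\int[n]_t G t)%E.
  rewrite (nZ G mG G0); apply: eq_integral => w _.
  by rewrite mule1 /G EFinM muleC max_l// fine_ge0.
transitivity (\int[n]_(t in A) (passage_density_ratio (Num.max t 0))%:E)%E.
  rewrite [RHS]integral_mkcond epatch_indic; apply: eq_integral => t _.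
  by rewrite /G EFinM.
rewrite (@ge0_integral_density _ _ _ lebesgue_measure n A rho mA).
- by apply: eq_integral => t; rewrite inE => /sA/I0 t0; rewrite max_l// EFinM.
- exact: measurable_funS mrho.
- by move=> t /sA/I0/rho0.
- move=> B mB BA; rewrite nP// integral_cst ?mul1e; last first.
    exact: measurable_preimage_EFin.
  by apply: rhoE => //; exact: subset_trans sA.
- by apply/measurable_EFinP; exact: measurable_funTS.
- by move=> t _; rewrite lee_fin.
Qed.

End law_of_first_passage.

(** A possibly defective density has mass at most 1 and is therefore integrable; integrable
    functions with equal integrals over all measurable subsets agree almost everywhere. *)
Lemma is_density_unique {R : realType} {d} {Omega : measurableType d}
    {P : probability Omega R} {T : Omega -> \bar R} {rho1 rho2 : R -> R} :
  is_density P T rho1 -> is_density P T rho2 ->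
  {ae lebesgue_measure, forall t : R, 0 <= t -> rho1 t = rho2 t}.
Proof.
move=> [mT mrho1 rho10 rho1E] [_ mrho2 _ rho2E].
have mI : measurable (`[0, +oo[%classic : set R) by exact: measurable_itv.
have I0 (t : R) : `[0, +oo[%classic t -> 0 <= t by rewrite /= in_itv/= andbT.
have : ae_eq lebesgue_measure (`[0, +oo[%classic : set R) (EFin \o rho1)
    (EFin \o rho2).
  apply: integral_ae_eq => //.
  - apply/integrableP; split; first exact/measurable_EFinP.
    have -> : (\int[lebesgue_measure]_(t in `[0%R, +oo[%classic) `|(EFin \o rho1) t| =
        \int[lebesgue_measure]_(t in `[0%R, +oo[%classic) (rho1 t)%:E)%E.
      apply: eq_integral => t; rewrite inE => /I0 t0.
      by rewrite /= ger0_norm// rho10.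
    rewrite -rho1E//; apply: (@le_lt_trans _ _ 1%E); last exact: ltry.
    by apply: probability_le1; exact: measurable_preimage_EFin.
  - exact/measurable_EFinP.
  - by move=> E EI mE; rewrite -rho1E// -rho2E.
apply: filterS => t /= h t0; apply: EFin_inj; apply: h.
by rewrite in_itv/= andbT.
Qed.

Theorem theorem3p7 (R : realType) (C D delta : R) (theta b : R -> R) (l x0 : R)
  (d1 : measure_display) (Omega1 : measurableType d1)
  (P1 : probability Omega1 R) (F1 : R -> set (set Omega1))
  (W1 X : R -> Omega1 -> R)
  (d2 : measure_display) (Omega2 : measurableType d2)
  (P2 : probability Omega2 R) (F2 : R -> set (set Omega2))
  (W2 Z : R -> Omega2 -> R)
  (hD : - (1 / 4) <= D)
  (hdelta : delta = 2 + Num.sqrt (4 * D + 1))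
  (htheta1 : forall x : R, 0 < x -> derivable theta x 1)
  (htheta2 : forall x : R, 0 < x -> derivable (theta^`()%classic) x 1)
  (htheta : forall x : R, 0 < x -> (theta^`(2)%classic) x = (2 * C + D / x ^+ 2) * theta x)
  (hl : 0 <= l)
  (htheta_pos : forall x : R, l < x -> 0 < theta x)
  (hb_cont : {within `[0, +oo[, continuous b})
  (hb_int : forall t : R, 0 <= t -> l < b t)
  (hx0 : b 0 < x0)
  (hF1 : filtration F1) (hW1 : brownian_motion P1 F1 W1)
  (hX : unique_sde_solution P1 F1 W1 `]l, +oo[
          (fun x => (theta^`()%classic) x / theta x) x0 X)
  (hF2 : filtration F2) (hW2 : brownian_motion P2 F2 W2)
  (hZ : sde_solution P2 F2 W2 `]0, +oo[
          (fun z => (delta - 1) / (2 * z)) x0 Z) :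
  let Tg := first_passage X b in
  let Tb := first_passage Z b in
  let rhs (rho : R -> R) (t : R) : R :=
    x0 `^ ((delta - 1) / 2) / b t `^ ((delta - 1) / 2)
    * (theta (b t) / theta x0) * expR (- C * t) * rho t in
  (forall rhob : R -> R, is_density P2 Tb rhob ->
     is_density P1 Tg (rhs rhob) /\
     forall rhog : R -> R, is_density P1 Tg rhog ->
       {ae lebesgue_measure, forall t : R, 0 <= t -> rhog t = rhs rhob t}) /\
  (forall lambda : R,
     (\int[P1]_(w in [set w | Tg w < +oo]) (expR (- lambda * fine (Tg w)))%:E =
      (x0 `^ ((delta - 1) / 2) / theta x0)%:E *
      \int[P2]_(w in [set w | Tb w < +oo])
        (theta (Z (fine (Tb w)) w) / Z (fine (Tb w)) w `^ ((delta - 1) / 2)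
         * expR (- (lambda + C) * fine (Tb w)))%:E)%E).
Proof.
move=> Tg Tb rhs.
pose a := (delta - 1) / 2.
have s0 : 0 <= 4 * D + 1 by lra.
have q0 := sqrtr_ge0 (4 * D + 1); have q2 := sqr_sqrtr s0.
have a0 : 0 <= a by rewrite /a hdelta; lra.
(* Here [a = (1 + sqrt (4 D + 1)) / 2] is the larger root of [a ^ 2 - a = D]; the bound on [D] makes
   the root real. *)
have aD : a ^+ 2 = a + D.
  by rewrite /a hdelta; move: q2; set q := Num.sqrt _ => q2; nra.
have dt (x : R) : 0 < x -> is_derive x 1 theta ((theta^`()%classic) x).
  by move=> x00; rewrite derive1E; exact/derivableP/htheta1.
have ddt (x : R) : 0 < x ->
    is_derive x 1 (theta^`()%classic) ((2 * C + D / x ^+ 2) * theta x).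
  move=> x00; have <- := htheta x x00.
  have -> : (theta^`(2)%classic) x = 'D_1 (theta^`()%classic) x.
    by rewrite -derive1E.
  exact/derivableP/htheta2.
have [hX1 _] := hX.
have hZa : sde_solution P2 F2 W2 `]0, +oo[ (fun z => a / z) x0 Z.
  suff -> : (fun z => a / z) = (fun z => (delta - 1) / (2 * z)) by [].
  by apply/funext => z; rewrite /a invfM mulrA.
have Zpos w t : 0 <= t -> 0 < Z t w.
  move=> t0; have [_ _ Z0 _] := hZ.
  by have := Z0 w t t0; rewrite /= in_itv/= andbT.
split=> [rhob hrho|lambda]; last first.
  exact: (first_passage_laplace a0 aD hl dt ddt htheta_pos hb_cont hb_int hx0
    hF1 hW1 hF2 hW2 hX1 hZa).
have hd : is_density P1 Tg (rhs rhob) := first_passage_density a0 aD hl dt ddt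
  htheta_pos hb_cont hb_int hx0 hF1 hW1 hF2 hW2 hX1 hZa hrho.
by split=> // rhog hrhog; exact: is_density_unique hrhog hd.
Qed.
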